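(* Let $\mathbf{k}\{y_1,\ldots,y_n\}$ be the ring of ordinary differential polynomials over a differential field $\mathbf{k}$ of characteristic $0$, with a fixed ranking. Let $F_0\neq\varnothing$ and $H_0$ be finite sets of differential polynomials. Then the algorithm RGBound (written out in the context), applied to $(F_0,H_0)$, is correct and terminates. That is, it terminates and outputs a finite set $T$ of regular systems $(\mathbb{A},H)$ such that $$\{F_0\}:H_0^\infty=\bigcap_{(\mathbb{A},H)\in T}[\mathbb{A}]:H^\infty$$ and $$M(\mathbb{A}\cup H)\leqslant (n-1)!\,M(F_0\cup H_0)\quad\text{for all }(\mathbb{A},H)\in T.$$
   Context: **Differential polynomials.** $\mathbf{k}$ is a differential field of characteristic $0$ with one derivation $\delta$; $Y=\{y_1,\ldots,y_n\}$; $\mathbf{k}\{Y\}=\mathbf{k}[y_i^{(j)}: 1\le i\le n, j\ge 0]$ with $\delta y_i^{(j)}=y_i^{(j+1)}$. The $y_i^{(j)}=\delta^jy_i$ are called derivatives. A ranking is a total order on derivatives with $\delta u\ge u$ and $u\ge v\Rightarrow\delta u\ge\delta v$. For $f\in\mathbf{k}\{Y\}\setminus\mathbf{k}$: the leader $\mathrm{ld} f=\mathbf{u}_f$ is the highest derivative in $f$; if $\mathbf{u}_f=y_j^{(d)}$ then $\mathrm{lv} f=y_j$ is the leading variable; writing $f=\mathbf{i}_f\mathbf{u}_f^d+\ldots$ as a polynomial in $\mathbf{u}_f$ of degree $d$, the rank is $\mathrm{rk} f=\mathbf{u}_f^d$, the initial is $\mathbf{i}_f$, the separant is $\mathbf{s}_f=\partial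 f/\partial\mathbf{u}_f$. Ranks are ordered by $u_1^{d_1}>u_2^{d_2}$ iff $u_1>u_2$, or $u_1=u_2$ and $d_1>d_2$; elements of $\mathbf{k}$ are considered to have smaller rank than all elements of $\mathbf{k}\{Y\}\setminus\mathbf{k}$. For a set, $\mathrm{ld},\mathrm{lv},\mathrm{rk}$ are applied elementwise. $H_f=\{\mathbf{i}_f,\mathbf{s}_f\}$ and $H_{\mathbb{A}}=\bigcup_{f\in\mathbb{A}}H_f$. **Reduction.** $f$ is partially reduced w.r.t. $g$ if no proper derivative of $\mathbf{u}_g$ (i.e. $\delta^j\mathbf u_g$, $j\geq 1$) appears in $f$; algebraically reduced w.r.t. $g$ if $\deg_{\mathbf{u}_g}f<\deg_{\mathbf{u}_g}g$; reduced if both. (W.r.t. a set: w.r.t. every element.) A set is autoreduced if each element is reduced w.r.t. all the others. A set of non-constant polynomials is weak d-triangular if the leading variables of its elements are pairwise distinct. $\mathrm{algrem}(f,S)$ is an algebraic pseudo-remainder: a polynomial obtained from $f$ by successive pseudo-divisions by elements $b\in S$ in the variable $\mathbf{u}_b$ (multiplying only by powers of $\mathbf{i}_b$), continued until the result is algebraically reduced w.r.t. all elements of $S$. For a set $G$, $\mathrm{algrem}(G,S)=\{\mathrm{algrem}(g,S): g\in G\}$. **Ideals.** $[F]$ and $\{F\}$ are the differential ideal and the radical differential ideal generated by $F$. $S^\infty$ is the multiplicative set generated by $S\cup\{1\}$, and $I:S^\infty=\{a: \exists s\in S^\infty,\ sa\in I\}$. An intersection over the empty index set is the whole ring. A regular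 system is a pair $(\mathbb{A},H)$ with $\mathbb{A}$ autoreduced, $H$ partially reduced w.r.t. $\mathbb{A}$, and $H\supseteq H_{\mathbb{A}}$. **Orders.** $m_i(F)=m_{y_i}(F)$ is the maximal order $j$ of a derivative $y_i^{(j)}$ occurring in $F$ ($0$ if $y_i$ does not occur). $\mathrm{ord}_{y_i}f$ is the maximal order of a derivative of $y_i$ occurring in the polynomial $f$. $M(F)=\sum_{i=1}^n m_i(F)$. **Algorithm Differentiate&Autoreduce**$(\mathbb{C},\{m_i\})$. Input: a weak d-triangular set $\mathbb{C}$ with (after renumbering) $\mathrm{ld}\,\mathbb{C}=\{y_1^{(d_1)},\ldots,y_k^{(d_k)}\}$ and non-negative integers $m_i\ge m_i(\mathbb{C})$, $1\le i\le k$. For a set $\mathbb{B}$ of polynomials with distinct leaders and $v\in\mathrm{lv}\,\mathbb{B}$ let $\mathbb{B}_v=\{f\in\mathbb{B}:\mathrm{lv} f=v\}$; $\mathbb{B}^0$ (resp. $\mathbb{B}^*$) consists of the elements of minimal (resp. maximal) rank of the sets $\mathbb{B}_v$, $v\in\mathrm{lv}\,\mathbb{B}$. For a set $F$ of polynomials, $F_{\{m_i\}}=\{f\in F:\mathrm{ord}_{y_i}f\le m_i,\ i=1,\ldots,k\}$. $\delta\mathbb{B}^*=\{\delta g:g\in\mathbb{B}^*\}$, and similarly $\delta\mathbb{B}^0$. (1) $\mathbb{D}:=\mathbb{C}$, $\mathbb{B}:=\varnothing$. (2) While $\mathbb{D}\cup(\delta\mathbb{B}^* )_{\{m_i\}}\ne\varnothing$: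 let $f$ be the element of least rank of this set; if $f\in\mathbb{D}$, put $\bar f:=\mathrm{algrem}(f,\mathbb{B})$ and $\mathbb{D}:=\mathbb{D}\setminus\{f\}$; otherwise put $\bar f:=\mathrm{algrem}(f,\mathbb{B}\cup(\delta\mathbb{B}^0\setminus\{f\}))$. If $\mathrm{rk}\bar f\ne\mathrm{rk} f$, return $\{1\}$; else $\mathbb{B}:=\mathbb{B}\cup\{\bar f\}$. (3) Return $\mathbb{B}$. **Algorithm RGBound**$(F_0,H_0)$. Set $T:=\varnothing$, $U:=\{(F_0,\varnothing,H_0)\}$. While $U\neq\varnothing$ do: - Take and remove any $(F,\mathbb{C},H)\in U$. Let $f$ be an element of $F$ of least rank; $D:=\{C\in\mathbb{C}:\mathrm{lv} C=\mathrm{lv} f\}$; $G:=(F\cup D)\setminus\{f\}$; $\bar{\mathbb{C}}:=(\mathbb{C}\setminus D)\cup\{f\}$. - $\mathbb{B}:=$ Differentiate&Autoreduce$(\bar{\mathbb{C}},\{m_y(G\cup\bar{\mathbb{C}}\cup H): y\in\mathrm{lv}\,\bar{\mathbb{C}}\})$. - If $\mathbb{B}\ne\{1\}$: put $\bar F:=\mathrm{algrem}(G,\mathbb{B})\setminus\{0\}$, $\bar H:=\mathrm{algrem}(H,\mathbb{B})\cup H_{\mathbb{B}}$; if $\bar F\cap\mathbf{k}=\varnothing$ and $0\notin\bar H$, then: if $\bar F=\varnothing$, $T:=T\cup\{(\mathbb{B}^0,\bar H)\}$, else $U:=U\cup\{(\bar F,\mathbb{B}^0,\bar H)\}$. - If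 $\mathbf{s}_f\notin\mathbf{k}$: $U:=U\cup\{(F\cup\{\mathbf{s}_f\},\mathbb{C},H)\}$, and if moreover $\mathbf{i}_f\notin\mathbf{k}$, $U:=U\cup\{(F\cup\{\mathbf{i}_f\},\mathbb{C},H)\}$. Return $T$.
   Formalization: The set F_{m_i} bounds only the order of f in its own leading variable (with all bounds imposed, F_0 = {y_1^2-2, y_2+y_1, y_3+y_2'} yields a non-regular system); elements of k in F_0, which have no leader, are removed if zero, and a nonzero one makes T empty. *)

(* Defs.v *)
From HB Require Import structures.
From mathcomp Require Import all_boot all_order all_algebra.
From mathcomp Require Import finmap.
From mathcomp Require Export monalg.
From Stdlib Require Import Relation_Operators.

Set Implicit Arguments.
Unset Strict Implicit.
Unset Printing Implicit Defensive.

Import GRing.Theory.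
Local Open Scope fset_scope.
Local Open Scope ring_scope.

(* The pair (i, j) stands for the derivative y_i^(j). *)
Definition der (n : nat) := ('I_n * nat)%type.

Definition dern (n : nat) (j : nat) (u : der n) : der n := (u.1, (u.2 + j)%N).

Notation dpoly k n := {malg k[{cmonom der n}]}.

Definition derivation (k : nzRingType) (d : k -> k) : Prop :=
  (forall x y, d (x + y) = d x + d y) /\
  (forall x y, d (x * y) = d x * y + x * d y).

Definition ranking (n : nat) (le : rel (der n)) : Prop :=
  [/\ reflexive le, antisymmetric le, transitive le & total le] /\
  (forall u, le u (dern 1 u)) /\
  (forall u v, le u v -> le (dern 1 u) (dern 1 v)).

Section DifferentialPolynomials.
Context (n : nat) (k : fieldType).
Local Notation P := (dpoly k n).
Implicit Types (f g : P) (u : der n).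

Definition vars f : {fset der n} :=
  [fset u | m in msupp f, u in finsupp (cmonom_val m)].

(* Membership in the base field k. *)
Definition isconst f : bool := vars f == fset0.

Definition degv u f : nat := \max_(m <- msupp f) m u.

(* The coefficient of u^e in f, seen as a polynomial in u. *)
Definition coefv u (e : nat) f : P :=
  \sum_(m <- msupp f | m u == e) << f@_m *g divcm m (expcmn (ucm u) e) >>.

Definition pderiv u f : P :=
  \sum_(m <- msupp f) << f@_m *+ m u *g divcm m (ucm u) >>.

(* The derivation of k{Y}: d on the coefficients, y_i^(j) |-> y_i^(j+1),
   extended by the chain rule. *)
Definition delta (d : k -> k) f : P :=
  \sum_(m <- msupp f) << d f@_m *g m >> +
  \sum_(u <- vars f) pderiv u f * << ucm (dern 1 u) >>.

Definition ordv (i : 'I_n) f : nat := \max_(u <- vars f | u.1 == i) u.2.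

Definition mord (i : 'I_n) (F : {fset P}) : nat := \max_(f <- F) ordv i f.

Definition Mord (F : {fset P}) : nat := (\sum_(i < n) mord i F)%N.

(* Ideals are predicates on the ring; [F] and {F} are the intersections of the
   (radical) differential ideals that contain F. *)
Definition diff_ideal (d : k -> k) (I : P -> Prop) : Prop :=
  [/\ I 0, forall a b, I a -> I b -> I (a + b), forall a b, I b -> I (a * b)
    & forall a, I a -> I (delta d a)].

Definition radical (I : P -> Prop) : Prop := forall a e, I (a ^+ e) -> I a.

Definition diff_ideal_gen (d : k -> k) (F : {fset P}) (a : P) : Prop :=
  forall I, diff_ideal d I -> (forall f, f \in F -> I f) -> I a.

Definition rad_diff_ideal_gen (d : k -> k) (F : {fset P}) (a : P) : Prop :=
  forall I, diff_ideal d I -> radical I -> (forall f, f \in F -> I f) -> I a.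

Definition mult_gen (S : {fset P}) (s : P) : Prop :=
  exists2 l : seq P, {subset l <= S} & s = \prod_(x <- l) x.

Definition colon (I : P -> Prop) (S : {fset P}) (a : P) : Prop :=
  exists2 s, mult_gen S s & I (s * a).

End DifferentialPolynomials.

Section Ranked.
Context (n : nat) (k : fieldType) (d : k -> k) (le : rel (der n)).
Local Notation P := (dpoly k n).
Implicit Types (f g b : P) (u v : der n) (A B C D F G H S : {fset P}).

(* None exactly when f is in k. *)
Definition ld f : option (der n) :=
  omap val [pick u : vars f | [forall v : vars f, le (val v) (val u)]].

Definition lv f : option 'I_n := omap fst (ld f).

Definition rk f : option (der n * nat) := omap (fun u => (u, degv u f)) (ld f).

Definition rk_le (r s : option (der n * nat)) : bool :=
  match r, s with
  | None, _ => true
  | Some _, None => false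
  | Some (u, e), Some (v, e') => if u == v then (e <= e')%N else le u v
  end.

(* Initial and separant; the value for f in k is a dummy. *)
Definition init f : P := if ld f is Some u then coefv u (degv u f) f else 0.
Definition sep f : P := if ld f is Some u then pderiv u f else 0.

Definition Hset A : {fset P} := [fset init f | f in A] `|` [fset sep f | f in A].

(* For g in k the two notions below are vacuous; [autoreduced] therefore asks
   explicitly for elements outside k. *)
Definition partially_reduced f g : Prop :=
  if ld g is Some u then forall j, dern j.+1 u \notin vars f else True.

Definition alg_reduced f g : bool :=
  if ld g is Some u then (degv u f < degv u g)%N else true.

Definition reduced f g : Prop := partially_reduced f g /\ alg_reduced f g.

Definition autoreduced A : Prop :=
  (forall f, f \in A -> ~~ isconst f) /\
  (forall f g, f \in A -> g \in A -> f != g -> reduced f g).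

Definition regular_system A H : Prop :=
  [/\ autoreduced A, forall h a, h \in H -> a \in A -> partially_reduced h a
    & Hset A `<=` H].

(** Algebraic pseudo-remainders: no strategy is fixed, so [algrem] is a
    relation between the input and its possible outputs. *)

(* One pseudo-division of f by some b in S, in the variable ld b. *)
Definition pdiv_step S f r : Prop :=
  exists b e q, [/\ b \in S, ~~ alg_reduced f b,
                    init b ^+ e * f = q * b + r & alg_reduced r b].

Definition alg_reduced_set S f : Prop := forall b, b \in S -> alg_reduced f b.

Definition algrem S f r : Prop :=
  clos_refl_trans _ (pdiv_step S) f r /\ alg_reduced_set S r.

Definition algrem_set S G R : Prop :=
  exists2 rho : P -> P,
    forall g, g \in G -> algrem S g (rho g) & R = [fset rho g | g in G].

Definition least F f : Prop :=
  f \in F /\ forall g, g \in F -> rk_le (rk f) (rk g).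

Definition minrk B : {fset P} :=
  [fset f in B | [forall g : B, (lv (val g) == lv f) ==> rk_le (rk f) (rk (val g))]].

Definition maxrk B : {fset P} :=
  [fset f in B | [forall g : B, (lv (val g) == lv f) ==> rk_le (rk (val g)) (rk f)]].

Definition deltas B : {fset P} := [fset delta d f | f in B].

(* F_{m_i}: the bound m_i applies to the polynomials with leading variable
   y_i, so ordv i f is the order of their leader.  Imposing every bound m_i on
   every polynomial would be wrong: with y_1^(i) < y_2^(j) < y_3^(l), the input
   {y_1^2 - 2, y_2 + y_1, y_3 + y_2'} would be returned unchanged, because y_1'
   occurs in the derivatives of the first two, and it is not autoreduced. *)
Definition bounded (m : 'I_n -> nat) F : {fset P} :=
  [fset f in F | if lv f is Some i then (ordv i f <= m i)%N else true].

(** Differentiate&Autoreduce *)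

Inductive da_state :=
| DALoop of {fset P} & {fset P}
| DAReturn of {fset P}.

Definition da_work m D B : {fset P} := D `|` bounded m (deltas (maxrk B)).

Definition da_divisors D B f : {fset P} :=
  if f \in D then B else B `|` (deltas (minrk B) `\ f).

Inductive da_step (m : 'I_n -> nat) : da_state -> da_state -> Prop :=
| da_exit D B : da_work m D B = fset0 -> da_step m (DALoop D B) (DAReturn B)
| da_fail D B f g : least (da_work m D B) f -> algrem (da_divisors D B f) f g ->
    rk g <> rk f -> da_step m (DALoop D B) (DAReturn [fset 1])
| da_keep D B f g : least (da_work m D B) f -> algrem (da_divisors D B f) f g ->
    rk g = rk f -> da_step m (DALoop D B) (DALoop (D `\ f) (g |` B)).

Definition diff_autoreduce C m B : Prop :=
  clos_refl_trans _ (da_step m) (DALoop C fset0) (DAReturn B).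

(** RGBound *)

Local Notation triple := ({fset P} * {fset P} * {fset P})%type.
Local Notation system := ({fset P} * {fset P})%type.

Definition rg_D C f : {fset P} := [fset c in C | lv c == lv f].
Definition rg_G F C f : {fset P} := (F `|` rg_D C f) `\ f.
Definition rg_C C f : {fset P} := f |` (C `\` rg_D C f).
Definition rg_m F C H f (i : 'I_n) : nat := mord i (rg_G F C f `|` rg_C C f `|` H).

Definition rg_reduce B G H F' H' : Prop :=
  exists R K, [/\ algrem_set B G R, F' = R `\ 0, algrem_set B H K
                & H' = K `|` Hset B].

Definition rg_consistent F' H' : Prop :=
  (forall f, f \in F' -> ~~ isconst f) /\ 0 \notin H'.

(* [rg_main G H B dU dT]: dU and dT are what the second item of the loop body
   adds to U and T. *)
Inductive rg_main G H B : {fset triple} -> {fset system} -> Prop :=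
| rg_unit : B = [fset 1] -> rg_main G H B fset0 fset0
| rg_drop F' H' : B <> [fset 1] -> rg_reduce B G H F' H' ->
    ~ rg_consistent F' H' -> rg_main G H B fset0 fset0
| rg_output F' H' : B <> [fset 1] -> rg_reduce B G H F' H' ->
    rg_consistent F' H' -> F' = fset0 ->
    rg_main G H B fset0 [fset (minrk B, H')]
| rg_push F' H' : B <> [fset 1] -> rg_reduce B G H F' H' ->
    rg_consistent F' H' -> F' <> fset0 ->
    rg_main G H B [fset (F', minrk B, H')] fset0.

Definition rg_split F C H f : {fset triple} :=
  if isconst (sep f) then fset0 else
  (sep f |` F, C, H) |`
    (if isconst (init f) then fset0 else [fset (init f |` F, C, H)]).

Definition rg_state := ({fset triple} * {fset system})%type.

Inductive rg_step : rg_state -> rg_state -> Prop :=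
| rg_loop U T F C H f B dU dT :
    (F, C, H) \in U -> least F f ->
    diff_autoreduce (rg_C C f) (rg_m F C H f) B ->
    rg_main (rg_G F C f) H B dU dT ->
    rg_step (U, T) ((U `\ (F, C, H)) `|` dU `|` rg_split F C H f, T `|` dT).

(* For F0 disjoint from k this is U = {(F0, {}, H0)}, T = {} (lemma below).  The
   loop needs leaders, so elements of k in F0 are treated as the loop treats
   them in the systems it creates: zeros are deleted, a system with a nonzero
   constant is discarded, and one with no equation left is output. *)
Definition rg_init F0 H0 : rg_state :=
  let F := F0 `\ 0 in
  if [exists f : F, isconst (val f)] then (fset0, fset0)
  else if F == fset0 then (fset0, [fset (fset0, H0)])
  else ([fset (F, fset0, H0)], fset0).

Definition RGBound F0 H0 (T : {fset system}) : Prop :=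
  clos_refl_trans _ rg_step (rg_init F0 H0) (fset0, T).

(** Termination.  [rg_step] and [da_step] treat a subroutine call as a single
    step, so we also follow executions into the calls. *)

Inductive config :=
| CRem of {fset P} & P
| CDA of ('I_n -> nat) & da_state
| CRG of rg_state.

Inductive advance : config -> config -> Prop :=
| adv_rem S f g : pdiv_step S f g -> advance (CRem S f) (CRem S g)
| adv_da m s t : da_step m s t -> advance (CDA m s) (CDA m t)
| adv_rg s t : rg_step s t -> advance (CRG s) (CRG t).

Inductive call : config -> config -> Prop :=
| call_da_rem m D B f : least (da_work m D B) f ->
    call (CDA m (DALoop D B)) (CRem (da_divisors D B f) f)
| call_rg_da U T F C H f : (F, C, H) \in U -> least F f ->
    call (CRG (U, T)) (CDA (rg_m F C H f) (DALoop (rg_C C f) fset0))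
| call_rg_rem U T F C H f B g : (F, C, H) \in U -> least F f ->
    diff_autoreduce (rg_C C f) (rg_m F C H f) B -> B <> [fset 1] ->
    g \in rg_G F C f `|` H ->
    call (CRG (U, T)) (CRem B g).

Definition exec (c c' : config) : Prop := advance c c' \/ call c c'.

Definition final (c : config) : Prop :=
  match c with
  | CRem Q f => alg_reduced_set Q f
  | CDA _ s => if s is DAReturn _ then True else False
  | CRG s => s.1 = fset0
  end.

(* Every execution is finite, and none gets stuck before its end. *)
Definition terminates (c : config) : Prop :=
  Acc (fun c2 c1 => exec c1 c2) c /\
  forall c', clos_refl_trans _ exec c c' -> final c' \/ exists c'', advance c' c''.

End Ranked.

Lemma isconst0 (n : nat) (k : fieldType) : isconst (0 : dpoly k n).
Proof.
rewrite /isconst; apply/eqP/fsetP => u; rewrite in_fset0; apply/negP.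
by case/imfset2P => m /=; rewrite msupp0.
Qed.

Lemma rg_init_nonconst (n : nat) (k : fieldType) (F0 H0 : {fset dpoly k n}) :
  F0 != fset0 -> (forall f, f \in F0 -> ~~ isconst f) ->
  rg_init F0 H0 = ([fset (F0, fset0, H0)], fset0).
Proof.
move=> F0n F0c; rewrite /rg_init.
have -> : F0 `\ 0 = F0.
  apply/fsetP => f; rewrite in_fsetD1; case: eqP => //= ->.
  by apply/esym/negP => /F0c; rewrite isconst0.
rewrite (negbTE F0n); case: ifP => // /existsP[f].
by rewrite (negbTE (F0c _ (valP f))).
Qed.

(* Main.v *)
(* Quotients [I : x] of a radical differential ideal I are again radical
   differential ideals.  Hence {F} : H^oo is the intersection of the radical
   differential ideals that contain F and modulo which no element of H is a zero
   divisor, and each operation of the algorithm can be checked on one such ideal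
   I at a time: a pseudo-remainder differs from its input, modulo I, by a factor
   that is not a zero divisor, and the two splitting branches take care of
   [I : x] for those x that kill the separant or the initial.

   The ideal [A] is generated, as an ideal, by the delta^j a.  These have
   distinct leaders, so [A] : H^oo is radical as soon as an element outside it
   is nonzero at some zero, over an extension field, of the finitely many
   polynomials delta^j a that matter; such a zero is built one leader at a time.

   For the orders, a variable that leads an element of C has order at most that
   of the leader, and [potential] bounds the remaining ones.  For termination,
   each new triple either lowers one rank in C or keeps C and lowers the least
   rank of F. *)

(* Quotients [I : x] are preferred to sums [I + (s)] because a sum would have to be made radical and
   differential again, whereas [x b] in [I] puts [(x b')^2] in [I], so the quotient is both at once;
   elements regular modulo [I] stay regular modulo [I : x].

   Testing one ideal at a time avoids prime components and zeros of differential systems. The one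
   structural input is that [[A] : H^oo] is radical. With a single derivation and distinct leading
   variables there are no cross-derivatives, so every prolongation of [A] is triangular and no
   coherence condition arises.

   The delicate point of Differentiate&Autoreduce is that remainders are only algebraically reduced,
   yet its output must be partially reduced. This works because derivatives are linear in their
   leaders and, at the end, fill every order up to the bound [m_i].

   Origin of [(n-1)!]: at most [n - c] variables are free when [C] has [c] elements, and each may
   gain all the orders spent on differentiations. Growing [C] to [c] elements therefore costs a
   factor [n - c] (or 1), and the product over [c = 1, ..., n] is [(n-1)!]. *)
From HB Require Import structures.
From Stdlib Require Import Classical ClassicalEpsilon Relation_Operators Operators_Properties.
Require Import Defs.
From mathcomp Require Import all_boot all_order all_algebra fieldext.
From mathcomp Require Import finmap zify ring.

Set Implicit Arguments.
Unset Strict Implicit.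
Unset Printing Implicit Defensive.

Import GRing.Theory.
Local Open Scope fset_scope.
Local Open Scope ring_scope.

(** * Polynomials in one derivative *)

(* Locked, like [upoly] and [ev] below: unification of unfolded products in
   the monoid algebra diverges. *)
HB.lock Definition dterm (n : nat) (k : fieldType) (c : k) (m : cmonom (der n)) : dpoly k n :=
  << c *g m >>.

Section Monomials.
Context (n : nat) (k : fieldType).
Local Notation P := (dpoly k n).
Local Notation mo := (@dterm n k).
Implicit Types (c : k) (f g b : P) (u v w : der n) (m : cmonom (der n)).

Lemma expcmE m e u : expcmn m e u = (e * m u)%N.
Proof.
rewrite /expcmn; case: e => [|e]; first by rewrite onecmE.
by rewrite /iterop; elim: e => [|e IH]; rewrite ?iteriS /= ?mul1n // mulcmE mulSn IH.
Qed.

Lemma moM c c' m m' : mo c m * mo c' m' = mo (c * c') (mulcm m m').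
Proof. by rewrite !dterm.unlock malgM_def; apply: fgmulUU. Qed.

Lemma moMn c m e : mo c m *+ e = mo (c *+ e) m.
Proof. by rewrite !dterm.unlock; apply: esym (monalgUMn _ _ _). Qed.

Lemma mo0 m : mo 0 m = 0.
Proof. by rewrite dterm.unlock; apply: monalgU0. Qed.

Lemma malg_mo f : f = \sum_(m <- msupp f) mo f@_m m.
Proof. by rewrite {1}[f]monalgE; apply: eq_bigr => m _; rewrite dterm.unlock. Qed.

Lemma moC c : mo c mone = c%:MP.
Proof. by rewrite dterm.unlock. Qed.

Definition dvar u : P := mo 1 (ucm u).
Definition upart u m := expcmn (ucm u) (m u).
Definition umon u m : {poly P} := (mo 1 (divcm m (upart u m)))%:P * 'X^(m u).

Lemma dvarX u j : dvar u ^+ j = mo 1 (expcmn (ucm u) j).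
Proof.
elim: j => [|j IH].
  by rewrite expr0 -[1]/(1%:MP) -moC; have -> : expcmn (ucm u) 0 = mone by apply/eqP/cmP => w; rewrite expcmE mul0n.
rewrite exprS IH moM mulr1.
have -> : mulcm (ucm u) (expcmn (ucm u) j) = expcmn (ucm u) j.+1.
  by apply/eqP/cmP => w; rewrite mulcmE !expcmE mulSn.
by [].
Qed.

(** Multiplicativity is what [mmap] needs in order to turn [umon] into a ring morphism; all algebra
    of [upoly] rests on it. *)
Lemma umon_morph u : mmorphism (umon u).
Proof.
split=> [x y|]; rewrite /umon.
  have -> : divcm (mmul x y) (upart u (mmul x y)) =
            mulcm (divcm x (upart u x)) (divcm y (upart u y)).
    apply/eqP/cmP => w; rewrite /upart !(divcmE, mulcmE, expcmE, ucmE).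
    by case: eqP => [->|_]; rewrite ?muln1 ?muln0 ?subnn ?subn0.
  have -> : mo 1 (mulcm (divcm x (upart u x)) (divcm y (upart u y))) =
     mo 1 (divcm x (upart u x)) * mo 1 (divcm y (upart u y)).
    by rewrite moM mulr1.
  rewrite cmM exprD polyCM !mulrA; congr (_ * _); rewrite -!mulrA; congr (_ * _).
  by rewrite mulrC.
rewrite cm1 mulr1.
have -> : divcm mone (upart u mone) = mone :> cmonom (der n).
  by apply/eqP/cmP => w; rewrite divcmE cm1.
by rewrite moC.
Qed.
HB.instance Definition _ u := monalg.isMultiplicative.Build _ _ (umon u) (umon_morph u).

Definition upoly_def u : P -> {poly P} :=
  mmap (polyC \o (@malgC (cmonom (der n)) k)) (umon u).
HB.instance Definition _ u := GRing.RMorphism.on (upoly_def u).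

End Monomials.

(** The coefficients stay in the same ring instead of moving to a ring without [u]; their freeness
    of [u] is expressed by [vars] ([coefv_free]). This keeps one type for all derivatives. *)
HB.lock Definition upoly (n : nat) (k : fieldType) (u : der n) (f : dpoly k n) :
  {poly (dpoly k n)} := upoly_def u f.

Section Univariate.
Context (n : nat) (k : fieldType).
Local Notation P := (dpoly k n).
Local Notation mo := (@dterm n k).
Local Notation dvar := (@dvar n k).
Implicit Types (c : k) (f g b : P) (u v w : der n) (m : cmonom (der n)).

Lemma upoly0 u : upoly u 0 = 0 :> {poly P}.
Proof. by rewrite upoly.unlock rmorph0. Qed.
Lemma upolyD u f g : upoly u (f + g) = upoly u f + upoly u g.
Proof. by rewrite upoly.unlock rmorphD. Qed.
Lemma upolyN u f : upoly u (- f) = - upoly u f.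
Proof. by rewrite upoly.unlock rmorphN. Qed.
Lemma upolyM u f g : upoly u (f * g) = upoly u f * upoly u g.
Proof. by rewrite upoly.unlock rmorphM. Qed.
Lemma upolyX u f e : upoly u (f ^+ e) = upoly u f ^+ e.
Proof. by rewrite upoly.unlock rmorphXn. Qed.
Lemma upoly_sum u I (r : seq I) (F : I -> P) :
  upoly u (\sum_(i <- r) F i) = \sum_(i <- r) upoly u (F i).
Proof. by rewrite (big_morph (upoly u) (upolyD u) (upoly0 u)). Qed.

Lemma upoly_mo u c m : upoly u (mo c m) = (mo c (divcm m (upart u m)))%:P * 'X^(m u).
Proof.
have -> : upoly u (mo c m) = (mo c mone)%:P * umon k u m.
  by rewrite upoly.unlock moC dterm.unlock; apply: mmapU.
rewrite mulrA -polyCM moM mulr1.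
by have -> : forall m', mulcm mone m' = m' by move=> m'; exact: mul1m.
Qed.

Lemma coef_upoly u e f : (upoly u f)`_e = coefv u e f.
Proof.
rewrite {1}[f]malg_mo upoly_sum coef_sum /coefv [RHS]big_mkcond /=.
apply: eq_bigr => m _; rewrite upoly_mo coefCM coefXn eq_sym.
by case: eqP => [<-|]; rewrite ?mulr1 ?mulr0 ?dterm.unlock.
Qed.

Lemma pdermonE u c m : (upoly u (mo c m))^`().[dvar u] = mo (c *+ m u) (divcm m (ucm u)).
Proof.
rewrite upoly_mo derivM derivC mul0r add0r derivXn.
rewrite hornerM hornerC hornerMn hornerXn dvarX mulrnAr moM mulr1 moMn.
(* For exponent 0 the truncated [divcm] returns [m] itself, but the coefficient [c *+ 0]
   vanishes. *)
case: (posnP (m u)) => [->|mu]; first by rewrite !mulr0n !mo0.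
suff -> : mulcm (divcm m (upart u m)) (expcmn (ucm u) (m u).-1) = divcm m (ucm u) by [].
apply/eqP/cmP => w; rewrite mulcmE !divcmE !expcmE !ucmE; case: eqP => [<-|_] /=.
  by rewrite !muln1 subnn add0n subn1.
by rewrite !muln0 addn0 !subn0.
Qed.

Lemma upoly_horner u f : (upoly u f).[dvar u] = f.
Proof.
rewrite {1}[f]malg_mo upoly_sum horner_sum [RHS]malg_mo; apply: eq_bigr => m _.
rewrite upoly_mo hornerM hornerC hornerXn dvarX moM mulr1.
suff -> : mulcm (divcm m (upart u m)) (expcmn (ucm u) (m u)) = m by [].
apply/eqP/cmP => w; rewrite mulcmE !divcmE !expcmE !ucmE; case: eqP => [<-|_] /=.
  by rewrite muln1 subnn.
by rewrite muln0 subn0 addn0.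
Qed.

Lemma pderiv_upoly u f : pderiv u f = (upoly u f)^`().[dvar u].
Proof.
have -> : (upoly u f)^`() = \sum_(m <- msupp f) (upoly u (mo f@_m m))^`().
  rewrite {1}[f]malg_mo upoly_sum.
  apply: (big_morph (@deriv _) (@derivD _)); first exact: deriv0.
by rewrite horner_sum; apply: eq_bigr => m _; rewrite pdermonE dterm.unlock.
Qed.

Lemma pderivD u f g : pderiv u (f + g) = pderiv u f + pderiv u g.
Proof. by rewrite !pderiv_upoly upolyD derivD hornerD. Qed.

Lemma pderivM u f g : pderiv u (f * g) = pderiv u f * g + f * pderiv u g.
Proof. by rewrite !pderiv_upoly upolyM derivM hornerD !hornerM !upoly_horner. Qed.

Lemma mem_vars v f : reflect (exists2 m, m \in msupp f & (0 < m v)%N) (v \in vars f).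
Proof.
apply: (iffP idP).
  case/imfset2P => /= m mf [w wm ->]; exists m => //.
  by rewrite lt0n cmE_neq0.
by case=> m mf mv; apply/imfset2P; exists m => //; exists v => //=; rewrite -cmE_neq0 -lt0n.
Qed.

Lemma degv_ge v f m : m \in msupp f -> (m v <= degv v f)%N.
Proof. by move=> mf; exact: (@leq_bigmax_seq _ _ _ (fun m : cmonom (der n) => m v)). Qed.

Lemma degv_le v f e : (forall m, m \in msupp f -> (m v <= e)%N) -> (degv v f <= e)%N.
Proof. by move=> H; apply/bigmax_leqP_seq => m mf _; apply: H. Qed.

Lemma degv0 v : degv v (0 : P) = 0%N.
Proof. by apply/eqP; rewrite -leqn0; apply: degv_le => m; rewrite msupp0. Qed.

Lemma degv_gt0 v f : (0 < degv v f)%N = (v \in vars f).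
Proof.
apply/idP/mem_vars => [|[m mf mv]]; last exact: leq_trans mv (degv_ge _ mf).
move=> d0; case E: (v \in vars f); first by case/mem_vars: E => m; exists m.
suff : (degv v f <= 0)%N by rewrite leqNgt d0.
apply: degv_le => m mf; rewrite leqNgt; apply/negP => mv.
by move/negP: E; apply; apply/mem_vars; exists m.
Qed.

Lemma degv_attained v f : f != 0 -> exists2 m, m \in msupp f & m v = degv v f.
Proof.
rewrite -msupp_eq0 => /fset0Pn [m0 m0f].
case: (boolP (has (fun m : cmonom (der n) => m v == degv v f) (msupp f))).
  by case/hasP => m mf /eqP E; exists m.
move=> /hasPn H; have lt m : m \in msupp f -> (m v < degv v f)%N.
  by move=> mf; rewrite ltn_neqAle (H m mf) degv_ge.
have d0 := leq_ltn_trans (leq0n _) (lt _ m0f).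
have : (degv v f <= (degv v f).-1)%N.
  by apply: degv_le => m /lt; move: d0; case: (degv v f).
by move: d0; case: (degv v f) => // e _; rewrite ltnn.
Qed.

Lemma expcm_ucm u e v : expcmn (ucm u) e v = (e * (u == v))%N.
Proof. by rewrite expcmE ucmE. Qed.

Lemma mcoeff_sum I (r : seq I) (Q : pred I) (F : I -> P) m :
  (\sum_(i <- r | Q i) F i)@_m = \sum_(i <- r | Q i) (F i)@_m.
Proof. exact: raddf_sum. Qed.

Lemma mcoeff_mo c m m' : (mo c m)@_m' = c *+ (m == m').
Proof. by rewrite dterm.unlock; apply: mcoeffU. Qed.

Lemma coefvE u e f :
  coefv u e f = \sum_(m <- msupp f | m u == e) mo f@_m (divcm m (expcmn (ucm u) e)).
Proof. by rewrite dterm.unlock. Qed.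

Lemma pderivE u f : pderiv u f = \sum_(m <- msupp f) mo (f@_m *+ m u) (divcm m (ucm u)).
Proof. by rewrite dterm.unlock. Qed.

Lemma msupp_coefv u e f m' : m' \in msupp (coefv u e f) ->
  exists m, [/\ m \in msupp f, m u = e & m' = divcm m (expcmn (ucm u) e)].
Proof.
rewrite -mcoeff_neq0 coefvE mcoeff_sum => /eqP H.
case: (boolP (has (fun m : cmonom (der n) =>
    (m u == e) && (m' == divcm m (expcmn (ucm u) e))) (msupp f))).
  by case/hasP => m mf /andP [/eqP E /eqP E']; exists m.
move/hasPn => H'; case: H; apply: big1_seq => m /andP[/eqP E mf].
by have := H' m mf; rewrite E eqxx /= mcoeff_mo eq_sym => /negbTE ->.
Qed.

Lemma mcoeff_coefv u f m : m \in msupp f ->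
  (coefv u (m u) f)@_(divcm m (expcmn (ucm u) (m u))) = f@_m.
Proof.
move=> mf; rewrite coefvE mcoeff_sum big_mkcond (bigD1_seq m) ?fset_uniq //=.
rewrite eqxx mcoeff_mo eqxx mulr1n big1_seq ?addr0 // => m2 /andP[m2m m2f].
case: eqP => // E; rewrite mcoeff_mo; case: eqP => // E2; case/eqP: m2m.
apply/eqP/cmP => v; have := congr1 (fun x : cmonom (der n) => x v) E2.
rewrite !divcmE !expcm_ucm; case: eqP => [<-|_]; rewrite ?muln0 ?subn0 //.
Qed.

Lemma msupp_pderiv u f m' : m' \in msupp (pderiv u f) ->
  exists2 m, m \in msupp f & m' = divcm m (ucm u).
Proof.
rewrite -mcoeff_neq0 pderivE mcoeff_sum => /eqP H.
case: (boolP (has (fun m : cmonom (der n) => m' == divcm m (ucm u)) (msupp f))).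
  by case/hasP => m mf /eqP E'; exists m.
move/hasPn => H'; case: H; apply: big1_seq => m /andP[_ mf].
by have := H' m mf; rewrite mcoeff_mo eq_sym => /negbTE ->.
Qed.

Lemma coefv_gt u e f : (degv u f < e)%N -> coefv u e f = 0.
Proof.
move=> lt; apply/eqP; rewrite -msupp_eq0; apply/eqP/fsetP => m'; rewrite in_fset0.
apply/negP => /msupp_coefv [m [mf E _]].
by have := degv_ge u mf; rewrite E leqNgt lt.
Qed.

Lemma coefv_deg_neq0 u f : f != 0 -> coefv u (degv u f) f != 0.
Proof.
move=> f0; have [m mf E] := degv_attained u f0; rewrite -E.
apply/eqP => E0; have := mcoeff_coefv u mf; rewrite E0 mcoeff0 => /esym /eqP.
by rewrite mcoeff_eq0 mf.
Qed.

Lemma upoly_eq0 u f : (upoly u f == 0) = (f == 0).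
Proof.
apply/eqP/eqP => [E|->]; last exact: upoly0.
by rewrite -(upoly_horner u f) E horner0.
Qed.

Lemma size_upoly u f : f != 0 -> size (upoly u f) = (degv u f).+1.
Proof.
move=> f0; apply/eqP; rewrite eqn_leq; apply/andP; split.
  by apply/leq_sizeP => j lt; rewrite coef_upoly coefv_gt.
rewrite ltnNge; apply/negP => /leq_sizeP /(_ _ (leqnn _)).
by rewrite coef_upoly => /eqP; rewrite (negbTE (coefv_deg_neq0 u f0)).
Qed.

Lemma degvE u f : degv u f = (size (upoly u f)).-1.
Proof.
have [->|f0] := eqVneq f 0; first by rewrite degv0 upoly0 size_poly0.
by rewrite size_upoly.
Qed.

Lemma lead_coef_upoly u f : lead_coef (upoly u f) = coefv u (degv u f) f.
Proof. by rewrite lead_coefE coef_upoly degvE. Qed.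

Lemma upoly_const v f : v \notin vars f -> upoly v f = f%:P.
Proof.
rewrite -degv_gt0 -leqNgt leqn0 => /eqP E.
have H : (size (upoly v f) <= 1)%N by move: E; rewrite degvE; case: (size _) => [|[]].
by rewrite -{2}(upoly_horner v f) (size1_polyC H) hornerC.
Qed.

Lemma upoly_constV v f g : upoly v f = g%:P -> v \notin vars f.
Proof. by rewrite -degv_gt0 degvE => ->; rewrite size_polyC; case: eqP. Qed.

(** Turns the absence of [v] into an equation, so that the closure properties below follow from
    [upoly] being a morphism. *)
Lemma upoly_constP v f : reflect (upoly v f = f%:P) (v \notin vars f).
Proof. by apply: (iffP idP) => [/upoly_const|/upoly_constV]. Qed.

Lemma notin_varsD v f g : v \notin vars f -> v \notin vars g -> v \notin vars (f + g).
Proof.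
by move=> /upoly_const F /upoly_const G; apply/upoly_constP; rewrite upolyD F G polyCD.
Qed.

Lemma notin_varsN v f : v \notin vars f -> v \notin vars (- f).
Proof. by move=> /upoly_const F; apply/upoly_constP; rewrite upolyN F polyCN. Qed.

Lemma notin_varsM v f g : v \notin vars f -> v \notin vars g -> v \notin vars (f * g).
Proof.
by move=> /upoly_const F /upoly_const G; apply/upoly_constP; rewrite upolyM F G polyCM.
Qed.

Lemma notin_varsC v c : v \notin vars (c%:MP : P).
Proof.
apply/negP => /mem_vars [m]; rewrite msuppC; case: ifP => // _.
by rewrite in_fset1 => /eqP ->; rewrite cm1.
Qed.

Lemma notin_vars0 v : v \notin vars (0 : P).
Proof. by rewrite -malgC0E notin_varsC. Qed.

Lemma notin_varsX v f e : v \notin vars f -> v \notin vars (f ^+ e).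
Proof.
by move=> F; elim: e => [|e IH]; rewrite ?expr0 ?notin_varsC // exprS notin_varsM.
Qed.

Lemma vars_dvar v u : (v \in vars (dvar u)) = (v == u).
Proof.
apply/mem_vars/eqP => [[m]|->].
  rewrite /dvar dterm.unlock msuppU oner_eq0 in_fset1 => /eqP ->.
  by rewrite ucmE; case: eqP.
exists (ucm u); first by rewrite /dvar dterm.unlock msuppU oner_eq0 in_fset1.
by rewrite ucmE eqxx.
Qed.

Lemma degv_coefv v u e f : (degv v (coefv u e f) <= degv v f)%N.
Proof.
apply: degv_le => m' /msupp_coefv [m [mf _ ->]].
by rewrite divcmE; apply: leq_trans (leq_subr _ _) (degv_ge v mf).
Qed.

Lemma degv_pderiv v u f : (degv v (pderiv u f) <= degv v f)%N.
Proof.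
apply: degv_le => m' /msupp_pderiv [m mf ->].
by rewrite divcmE; apply: leq_trans (leq_subr _ _) (degv_ge v mf).
Qed.

Lemma vars_coefv u e f v : v \in vars (coefv u e f) -> v \in vars f.
Proof. by rewrite -!degv_gt0 => H; apply: leq_trans H (degv_coefv _ _ _ _). Qed.

Lemma vars_pderiv u f v : v \in vars (pderiv u f) -> v \in vars f.
Proof. by rewrite -!degv_gt0 => H; apply: leq_trans H (degv_pderiv _ _ _). Qed.

Lemma coefv_free u e f : u \notin vars (coefv u e f).
Proof.
apply/negP => /mem_vars [m' /msupp_coefv [m [mf E ->]]].
by rewrite divcmE expcm_ucm eqxx E muln1 subnn.
Qed.

Lemma upoly_dvar u : upoly u (dvar u) = 'X.
Proof.
have E : divcm (ucm u) (upart u (ucm u)) = mone.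
  apply/eqP/cmP => w; rewrite divcmE expcm_ucm !ucmE eqxx mul1n subnn.
  exact: esym (cm1 _).
by rewrite /dvar upoly_mo E moC ucmE eqxx expr1 mul1r.
Qed.

(** Converse of [upoly_horner]; it fails without the hypothesis, since coefficients that contain [u]
    would be mixed with the indeterminate. *)
Lemma hornerK u (q : {poly P}) : (forall i, u \notin vars q`_i) -> upoly u q.[dvar u] = q.
Proof.
move=> H; rewrite horner_coef upoly_sum -[RHS]coefK poly_def.
by apply: eq_bigr => i _; rewrite upolyM upolyX upoly_dvar upoly_const // mul_polyC.
Qed.

End Univariate.

(** [S] plays the part of a subring. With [S] the polynomials free of [u], the remainder has
    coefficients free of [u], so its size still measures the degree in [u] after substituting [u]
    back ([hornerK]). *)
Lemma poly_pseudo_division (R : comNzRingType) (S : R -> Prop) :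
  S 0 -> (forall x y, S x -> S y -> S (x + y)) -> (forall x, S x -> S (- x)) ->
  (forall x y, S x -> S y -> S (x * y)) -> forall b f : {poly R},
  (forall i, S b`_i) -> (forall i, S f`_i) -> b != 0 ->
  exists e (q r : {poly R}), [/\ lead_coef b ^+ e *: f = q * b + r, (size r < size b)%N
    & forall i, S r`_i].
Proof.
move=> S0 SD SN SM b f Sb + b0; have [N] := ubnP (size f).
elim: N f => // N IH f; rewrite ltnS => fN Sf.
case: (ltnP (size f) (size b)) => [lt|le].
  by exists 0%N, 0, f; rewrite expr0 scale1r mul0r add0r.
pose x : {poly R} := lead_coef f *: 'X^(size f - size b).
pose g : {poly R} := lead_coef b *: f - x * b.
have f0 : (0 < size f)%N by apply: leq_trans le; rewrite size_poly_gt0.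
have Sl (p : {poly R}) : (forall i, S p`_i) -> S (lead_coef p) by move=> H; rewrite lead_coefE.
have Sg i : S g`_i.
  rewrite coefB coefZ -scalerAl coefZ coefXnM; apply: SD.
    by apply: SM; [apply: Sl|apply: Sf].
  by apply: SN; case: ltnP => _; [apply: SM => //|apply: SM => //]; apply: Sl.
have sg : (size g < size f)%N.
  rewrite -(prednK f0) ltnS; apply/leq_sizeP => j jf.
  have jf' : (size f - size b <= j)%N.
    have key s t : (0 < s -> 0 < t -> t.-1 <= j -> t - s <= j)%N by lia.
    by apply: key f0 jf; rewrite size_poly_gt0.
  rewrite coefB coefZ -scalerAl coefZ coefXnM ltnNge jf' /=.
  move: jf; rewrite leq_eqVlt => /orP[/eqP <-|lt].
    rewrite -lead_coefE mulrC; apply/eqP; rewrite subr_eq0; apply/eqP; congr (_ * _).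
    have key s t : (0 < s -> s <= t -> s.-1 = t.-1 - (t - s))%N by lia.
    by rewrite lead_coefE; congr (_`_ _); apply: key; rewrite ?size_poly_gt0.
  rewrite (prednK f0) in lt; rewrite [f`_j]nth_default // [b`_ _]nth_default ?mulr0 ?subrr //.
  have key s t : (s <= t -> t <= j -> s <= j - (t - s))%N by lia.
  exact: key.
have [e [q [r [E sr Sr]]]] := IH g (leq_trans sg fN) Sg.
exists e.+1, (q + lead_coef b ^+ e *: x), r; split=> //.
by rewrite exprSr -scalerA mulrDl -addrA [_ + r]addrC addrA -E -scalerAl -scalerDr subrK.
Qed.

Lemma poly_horner_eq (R : comNzRingType) (x c : R) (f q b r : {poly R}) :
  c *: f = q * b + r -> c * f.[x] = q.[x] * b.[x] + r.[x].
Proof. by move/(congr1 (horner^~ x)); rewrite hornerZ hornerD hornerM. Qed.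

Lemma opp_of_add (R : comNzRingType) (x y : R) : x + y = 0 -> y = - x.
Proof. by move=> E; apply/eqP; rewrite -addr_eq0 addrC E. Qed.

Section Algebra.
Context (n : nat) (k : fieldType).
Local Notation P := (dpoly k n).
Local Notation mo := (@dterm n k).
Local Notation dvar := (@dvar n k).
Implicit Types (c : k) (f g b : P) (u v w : der n) (m : cmonom (der n)).

Lemma coefvD u e f g : coefv u e (f + g) = coefv u e f + coefv u e g.
Proof. by rewrite -!coef_upoly upolyD coefD. Qed.

Lemma coefvMl u e g f : u \notin vars g -> coefv u e (g * f) = g * coefv u e f.
Proof. by move=> H; rewrite -!coef_upoly upolyM (upoly_const H) coefCM. Qed.

Lemma pderivMl u g f : u \notin vars g -> pderiv u (g * f) = g * pderiv u f.
Proof.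
move=> H; rewrite pderivM [pderiv u g]pderiv_upoly (upoly_const H) derivC horner0.
by rewrite mul0r add0r.
Qed.

Lemma pderiv_notin u f : u \notin vars f -> pderiv u f = 0.
Proof. by move=> H; rewrite pderiv_upoly (upoly_const H) derivC horner0. Qed.

Lemma constE f : (forall v, v \notin vars f) -> f = (f@_mone)%:MP.
Proof.
move=> H; rewrite -moC; apply/malgP => m; rewrite mcoeff_mo.
case: eqP => [<-|E]; rewrite ?mulr1n //.
apply/eqP; rewrite mulr0n mcoeff_eq0; apply/negP => mf; case: E; apply/esym/eqP/cmP => v.
rewrite cm1; apply/eqP; rewrite -leqn0 leqNgt; apply: contra (H v) => mv.
by apply/mem_vars; exists m.
Qed.

Lemma isconstP f : reflect (exists c, f = c%:MP) (isconst f).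
Proof.
apply: (iffP eqP) => [E|[c ->]].
  by exists f@_mone; apply: constE => v; rewrite E in_fset0.
by apply/fsetP => v; rewrite in_fset0 (negbTE (notin_varsC _ _)).
Qed.

(** Induction on a finite list of derivatives containing those of [f] and [g]: the leading
    coefficients in the first one are free of it, and their product is a coefficient of [f * g]. *)
Lemma dpoly_mulf_eq0 f g : f * g = 0 -> f = 0 \/ g = 0.
Proof.
have [s sf] : exists s : seq (der n), {subset vars f `|` vars g <= s}.
  by exists (vars f `|` vars g).
have {sf} [] : {subset vars f <= s} /\ {subset vars g <= s}.
  by split=> v vf; apply: sf; rewrite in_fsetU vf ?orbT.
elim: s f g => [|u s IH] f g sf sg fg.
  have Ef : f = (f@_mone)%:MP by apply: constE => v; apply/negP => /sf.
  have Eg : g = (g@_mone)%:MP by apply: constE => v; apply/negP => /sg.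
  move: fg; rewrite Ef Eg; move: (f@_mone) (g@_mone) => a c.
  rewrite -!moC => fg; have : a * c = 0.
    have := congr1 (mcoeff mone) fg; rewrite moM mcoeff_mo mcoeff0.
    have -> : mulcm mone mone = mone :> cmonom (der n) by apply: mul1m.
    by rewrite eqxx mulr1n.
  by move/eqP; rewrite mulf_eq0 => /orP[] /eqP ->; rewrite mo0; [left|right].
pose l h : P := coefv u (degv u h) h.
have ls h : {subset vars h <= u :: s} -> {subset vars (l h) <= s}.
  move=> H v vl; have := H v (vars_coefv vl); rewrite inE => /orP[/eqP E|//].
  by move: vl; rewrite E (negbTE (coefv_free _ _ _)).
have [|E|E] := IH (l f) (l g) (ls _ sf) (ls _ sg).
- by rewrite /l -!lead_coef_upoly mul_lead_coef -upolyM fg upoly0 coef0.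
- by left; apply/eqP; have := @coefv_deg_neq0 _ _ u f; rewrite -/(l f) E eqxx; case: eqP => // _ /(_ isT).
- by right; apply/eqP; have := @coefv_deg_neq0 _ _ u g; rewrite -/(l g) E eqxx; case: eqP => // _ /(_ isT).
Qed.

Lemma dpoly_mulf_neq0 f g : f != 0 -> g != 0 -> f * g != 0.
Proof. by move=> f0 g0; apply/eqP => /dpoly_mulf_eq0 [] /eqP; apply/negP. Qed.

Lemma degvM u f g : f != 0 -> g != 0 -> degv u (f * g) = (degv u f + degv u g)%N.
Proof.
move=> f0 g0; rewrite [LHS]degvE upolyM size_proper_mul.
  by rewrite !size_upoly ?addnS.
by rewrite !lead_coef_upoly; apply: dpoly_mulf_neq0; apply: coefv_deg_neq0.
Qed.

Lemma upart_degv u f e : (degv u f <= e)%N = (size (upoly u f) <= e.+1)%N.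
Proof. by rewrite degvE; case: (size _). Qed.

Lemma degvN u f : degv u (- f) = degv u f.
Proof. by rewrite !degvE upolyN size_polyN. Qed.

Lemma degv_free u f : u \notin vars f -> degv u f = 0%N.
Proof. by rewrite -degv_gt0 -leqNgt leqn0 => /eqP. Qed.

Lemma notin_varsMn u f e : u \notin vars f -> u \notin vars (f *+ e).
Proof.
move=> H; elim: e => [|e IH]; first by rewrite mulr0n notin_vars0.
by rewrite mulrS notin_varsD.
Qed.

Lemma upoly_pderiv u f : upoly u (pderiv u f) = (upoly u f)^`().
Proof.
rewrite pderiv_upoly hornerK // => i; rewrite coef_deriv notin_varsMn //.
by rewrite coef_upoly coefv_free.
Qed.

Lemma dpoly_mulrn_eq0 f e : [pchar k] =i pred0 -> f *+ e.+1 = 0 -> f = 0.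
Proof.
move=> /pcharf0P ch /malgP H; apply/malgP => m; have := H m.
rewrite mcoeffMn mcoeff0 -mulr_natr => /eqP; rewrite mulf_eq0 ch orbF.
by move/eqP.
Qed.

Lemma pderiv_neq0 u f : [pchar k] =i pred0 -> u \in vars f -> pderiv u f != 0.
Proof.
move=> ch uf; apply/eqP => E.
have f0 : f != 0 by apply/eqP => f0; move: uf; rewrite f0 (negbTE (notin_vars0 _ _)).
have := uf; rewrite -degv_gt0; case D: (degv u f) => [//|e] _.
have := congr1 (fun p : {poly P} => p`_e) (upoly_pderiv u f).
rewrite E upoly0 coef0 coef_deriv coef_upoly -D => /esym.
rewrite D => /(dpoly_mulrn_eq0 ch); rewrite -D => /eqP.
by rewrite (negbTE (coefv_deg_neq0 _ f0)).
Qed.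

Lemma degv_pderiv_lt u f : u \in vars f -> (degv u (pderiv u f) < degv u f)%N.
Proof.
rewrite -degv_gt0 => d0; have f0 : f != 0.
  by apply/eqP => E; move: d0; rewrite E degv0.
have [->|p0] := eqVneq (pderiv u f) 0; first by rewrite degv0.
rewrite -size_upoly // upoly_pderiv.
rewrite -ltnS -(size_upoly u f0).
by apply: lt_size_deriv; rewrite upoly_eq0.
Qed.

Lemma coefvMr u e g f : u \notin vars g -> coefv u e (f * g) = coefv u e f * g.
Proof. by move=> H; rewrite -!coef_upoly upolyM (upoly_const H) coefMC. Qed.

Lemma pseudo_division u b f : (0 < degv u b)%N ->
  exists e q r, coefv u (degv u b) b ^+ e * f = q * b + r /\ (degv u r < degv u b)%N.
Proof.
move=> b0; have bn0 : b != 0 by apply/eqP => E; move: b0; rewrite E degv0.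
pose S (x : P) := u \notin vars x.
have Sc f' i : S (upoly u f')`_i by rewrite /S coef_upoly; apply: coefv_free.
have [|e [q [r [E sr cr]]]] := poly_pseudo_division (S := S) (notin_vars0 k u) (@notin_varsD _ _ u)
  (@notin_varsN _ _ u) (@notin_varsM _ _ u) (Sc b) (Sc f).
  by rewrite upoly_eq0.
exists e, q.[dvar u], r.[dvar u]; split.
  have := poly_horner_eq (dvar u) E; rewrite lead_coef_upoly !upoly_horner.
  by apply.
move: sr; rewrite size_upoly // [degv u r.[_]]degvE hornerK //.
by move: b0; case: (degv u b) => // d _; case: (size r).
Qed.

(** Compare the coefficients of [v^j] for [j] above the degree of [f]: [Q * b + R = 0] with [R] of
    lower degree in [u] than [b], which forces [Q * b = 0], hence [R = 0]. The argument covers every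
    admissible [q] and [r], as the relational [pdiv_step] requires. *)
Lemma pseudo_division_degv u v b f e q r : v \notin vars b ->
  coefv u (degv u b) b ^+ e * f = q * b + r -> (degv u r < degv u b)%N ->
  (degv v r <= degv v f)%N.
Proof.
move=> vb E lt.
have vi : v \notin vars (coefv u (degv u b) b ^+ e).
  by apply: notin_varsX; apply: contra vb; apply: vars_coefv.
rewrite upart_degv; apply/leq_sizeP => j jf; rewrite coef_upoly.
have E2 : coefv v j q * b + coefv v j r = 0.
  apply: etrans (congr1 (fun x => x + coefv v j r) (esym (coefvMr j q vb))) _.
  apply: etrans (esym (coefvD v j (q * b) r)) _.
  apply: etrans (congr1 (coefv v j) (esym E)) _.
  apply: etrans (coefvMl j f vi) _.
  by apply: etrans (congr1 (fun x => _ * x) (coefv_gt jf)) _; apply: mulr0.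
have := leq_ltn_trans (degv_coefv u v j r) lt.
move: (coefv v j r) (coefv v j q) E2 => R Q /opp_of_add -> {}lt.
apply: contraTeq lt; rewrite oppr_eq0 degvN -leqNgt => QB.
have b0 : b != 0 by apply: contraNneq QB => ->; apply/eqP; apply: mulr0.
have Q0 : Q != 0 by apply: contraNneq QB => ->; apply/eqP; apply: mul0r.
by rewrite degvM ?leq_addl.
Qed.

End Algebra.

(** The identities behind [deltaD] and [deltaM], over an abstract ring where unification does not
    meet the monoid algebra. *)
Lemma sum_addr_mul (R : comNzRingType) T (r : seq T) (a b : R) (p q x : T -> R) :
  (a + b) + \sum_(u <- r) (p u + q u) * x u =
  (a + \sum_(u <- r) p u * x u) + (b + \sum_(u <- r) q u * x u).
Proof.
by rewrite addrACA -big_split; congr (_ + _); apply: eq_bigr => u _; rewrite mulrDl.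
Qed.

Lemma sum_leibniz_mul (R : comNzRingType) T (r : seq T) (a b f g : R) (p q x : T -> R) :
  (a * g + f * b) + \sum_(u <- r) (p u * g + f * q u) * x u =
  (a + \sum_(u <- r) p u * x u) * g + f * (b + \sum_(u <- r) q u * x u).
Proof.
rewrite mulrDl mulrDr addrACA mulr_suml mulr_sumr -big_split; congr (_ + _).
by apply: eq_bigr => u _; rewrite mulrDl -!mulrA; congr (_ * _ + _); rewrite mulrC.
Qed.

Lemma additive0 (R : zmodType) (x : R -> R) : {morph x : a b / a + b} -> x 0 = 0.
Proof. by move=> xD; apply: (addrI (x 0)); rewrite -xD !addr0. Qed.

(** * The derivation *)

Section Delta.
Context (n : nat) (k : fieldType) (d : k -> k) (dP : derivation d).
Local Notation P := (dpoly k n).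
Local Notation mo := (@dterm n k).
Local Notation dvar := (@dvar n k).
Implicit Types (c : k) (f g b : P) (u v w : der n) (m : cmonom (der n)) (V : {fset der n}).

Lemma derivation0 : d 0 = 0.
Proof.
by have [dD _] := dP; apply: additive0.
Qed.

(** The part of [delta] that differentiates the coefficients and treats the derivatives as
    constants. *)
Definition kap f : P := \sum_(m <- msupp f) mo (d f@_m) m.

Lemma mcoeff_kap f m : (kap f)@_m = d f@_m.
Proof.
rewrite /kap mcoeff_sum; case: (boolP (m \in msupp f)) => mf.
  rewrite (bigD1_seq m) ?fset_uniq //= mcoeff_mo eqxx mulr1n big1 ?addr0 // => i.
  by rewrite mcoeff_mo => /negbTE ->.
rewrite (mcoeff_outdom mf) derivation0 big1_seq // => i /andP[_ i_f].
by rewrite mcoeff_mo; case: eqP => // E; move: mf; rewrite -E i_f.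
Qed.

Lemma kapD f g : kap (f + g) = kap f + kap g.
Proof.
by apply/malgP => m; rewrite mcoeffD !mcoeff_kap mcoeffD; case: dP => ->.
Qed.

Lemma msupp_kap f : msupp (kap f) `<=` msupp f.
Proof.
apply/fsubsetP => m; rewrite -!mcoeff_neq0 mcoeff_kap; apply: contra => /eqP ->.
by rewrite derivation0.
Qed.

Lemma kapM f g : kap (f * g) = kap f * g + f * kap g.
Proof.
have [dD dM] := dP; apply/malgP => m; apply: etrans (mcoeff_kap _ _) _.
have E1 := mcoeffMlw m (msupp_kap f) (fsubset_refl (msupp g)).
have E2 := mcoeffMlw m (fsubset_refl (msupp f)) (msupp_kap g).
apply: etrans (congr1 d (mcoeffMl f g m)) _.
apply: esym; apply: etrans (mcoeffD _ _ _) _; apply: etrans (congr2 +%R E1 E2) _; apply: esym.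
rewrite (big_morph d dD derivation0) -big_split; apply: eq_bigr => i _.
rewrite (big_morph d dD derivation0) -big_split; apply: eq_bigr => j _.
rewrite /= !mcoeff_kap; case: eqP => _; first by rewrite !mulr1n dM.
by rewrite !mulr0n derivation0 addr0.
Qed.

Lemma deltaE f : delta d f = kap f + \sum_(u <- vars f) pderiv u f * dvar (dern 1 u).
Proof. by rewrite /delta /kap /dvar dterm.unlock. Qed.

(** Enlarging the index set costs nothing and lets [f], [g] and their sum or product share one set
    of derivatives. *)
Lemma delta_vars V f : vars f `<=` V ->
  delta d f = kap f + \sum_(u <- V) pderiv u f * dvar (dern 1 u).
Proof.
move=> fV; apply: etrans (deltaE f) _; apply: (congr1 (fun x => kap f + x)).
apply: big_fset_incl => // u uV uf.
by apply: etrans (congr1 (fun x => x * _) (pderiv_notin uf)) _; apply: mul0r.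
Qed.

Lemma fsub_notin (V W : {fset der n}) : (forall v, v \notin W -> v \notin V) -> V `<=` W.
Proof. by move=> H; apply/fsubsetP => v; apply: contraLR; apply: H. Qed.

Lemma deltaD f g : delta d (f + g) = delta d f + delta d g.
Proof.
pose V := vars f `|` vars g.
have Ef := delta_vars (fsubsetUl _ _ : vars f `<=` V).
have Eg := delta_vars (fsubsetUr _ _ : vars g `<=` V).
have VP : vars (f + g) `<=` V.
  by apply: fsub_notin => v; rewrite in_fsetU negb_or => /andP[]; apply: notin_varsD.
apply: etrans (delta_vars VP) _.
apply: etrans (congr2 +%R (kapD f g) (eq_bigr _ (fun u _ =>
  congr1 (fun x => x * dvar (dern 1 u)) (pderivD u f g)))) _.
apply: etrans _ (esym (congr2 +%R Ef Eg)).
exact: sum_addr_mul.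
Qed.

Lemma deltaM f g : delta d (f * g) = delta d f * g + f * delta d g.
Proof.
pose V := vars f `|` vars g.
have Ef := delta_vars (fsubsetUl _ _ : vars f `<=` V).
have Eg := delta_vars (fsubsetUr _ _ : vars g `<=` V).
have VP : vars (f * g) `<=` V.
  by apply: fsub_notin => v; rewrite in_fsetU negb_or => /andP[]; apply: notin_varsM.
apply: etrans (delta_vars VP) _.
apply: etrans (congr2 +%R (kapM f g) (eq_bigr _ (fun u _ =>
  congr1 (fun x => x * dvar (dern 1 u)) (pderivM u f g)))) _.
apply: etrans _ (esym (congr2 (fun x y => x * g + f * y) Ef Eg)).
exact: sum_leibniz_mul.
Qed.

Lemma delta0 : delta d (0 : P) = 0.
Proof. exact: additive0 deltaD. Qed.

Lemma vars_kap f v : v \in vars (kap f) -> v \in vars f.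
Proof.
case/mem_vars => m /(fsubsetP (msupp_kap f)) mf mv.
by apply/mem_vars; exists m.
Qed.

Lemma vars_delta f v : v \in vars (delta d f) ->
  v \in vars f \/ exists2 u, u \in vars f & v = dern 1 u.
Proof.
move=> vd; case: (boolP (v \in vars f)) => [|vf]; [by left|right].
case: (boolP (has (fun u => v == dern 1 u) (vars f))) => [/hasP [u uf /eqP E]|/hasPn H].
  by exists u.
suff : v \notin vars (delta d f) by rewrite vd.
rewrite (deltaE f); apply: notin_varsD.
  by apply: contra vf; apply: vars_kap.
rewrite big_seq; elim/big_ind: _ => [|g h|u uf]; [exact: notin_vars0|exact: notin_varsD|].
apply: notin_varsM; first by apply: contra vf; apply: vars_pderiv.
by rewrite vars_dvar; apply: H.
Qed.

End Delta.

Lemma ex_least (T : eqType) (r : rel T) (s : seq T) :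
  reflexive r -> transitive r -> total r -> s != [::] ->
  exists2 x, x \in s & forall y, y \in s -> r x y.
Proof.
move=> rr rt tot; elim: s => // a s IH _.
have [->|/IH [x xs H]] := eqVneq s [::].
  by exists a; rewrite ?mem_head // => y; rewrite inE => /eqP ->.
case/orP: (tot a x) => [ax|xa].
  exists a; rewrite ?mem_head // => y; rewrite inE => /orP[/eqP ->//|/H].
  exact: rt.
exists x; first by rewrite inE xs orbT.
by move=> y; rewrite inE => /orP[/eqP ->//|/H].
Qed.

Lemma addr_add_comm (R : nmodType) (x y z : R) : x + (y + z) = x + z + y.
Proof. by rewrite -addrA (addrC z). Qed.

Lemma linear_poly (R : nzRingType) (p : {poly R}) a s : p = a%:P + s%:P * 'X -> s != 0 ->
  [/\ size p = 2%N, p`_1 = s & p^`() = s%:P].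
Proof.
move=> -> s0; split.
- have S : size (s%:P * 'X) = 2%N by rewrite size_mulX ?polyC_eq0 // size_polyC s0.
  by rewrite addrC size_polyDl S // size_polyC; case: (a != 0).
- by rewrite coefD coefC coefMX coefC add0r.
- by rewrite derivD derivC derivM derivC derivX mul0r !add0r mulr1.
Qed.

(** * Rankings, leaders and pseudo-division *)

Section Ranking.
Context (n : nat) (le : rel (der n)) (leP : ranking le).
Implicit Types (u v w : der n).

Definition dlt u v := le u v && (u != v).

Lemma dle_refl : reflexive le. Proof. by case: leP => [[]]. Qed.
Lemma dle_anti : antisymmetric le. Proof. by case: leP => [[]]. Qed.
Lemma dle_trans : transitive le. Proof. by case: leP => [[]]. Qed.
Lemma dle_total : total le. Proof. by case: leP => [[]]. Qed.

Lemma dltNle u v : dlt u v = ~~ le v u.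
Proof.
rewrite /dlt; have /orP[H|H] := dle_total u v; rewrite H.
  case: (eqVneq u v) => [->|ne]; first by rewrite dle_refl.
  by apply/esym/negP => H'; case/eqP: ne; apply: dle_anti; rewrite H H'.
case: (boolP (le u v)) => //= H'.
by have -> : u = v by [apply: dle_anti; rewrite H H']; rewrite eqxx.
Qed.

Lemma dleNlt u v : le u v = ~~ dlt v u.
Proof. by rewrite dltNle negbK. Qed.

Lemma dltW u v : dlt u v -> le u v. Proof. by case/andP. Qed.
Lemma dltxx u : dlt u u = false. Proof. by rewrite /dlt eqxx andbF. Qed.

Lemma dle_lt_trans v u w : le u v -> dlt v w -> dlt u w.
Proof. by rewrite !dltNle => uv; apply: contra => wu; apply: dle_trans wu uv. Qed.

Lemma dlt_le_trans v u w : dlt u v -> le v w -> dlt u w.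
Proof. by rewrite !dltNle => + vw; apply: contra; apply: dle_trans. Qed.

Lemma dlt_trans v u w : dlt u v -> dlt v w -> dlt u w.
Proof. by move=> uv /dltW; apply: dlt_le_trans. Qed.

Lemma dlt_neq u v : dlt u v -> u != v. Proof. by case/andP. Qed.

Lemma dle_eqVlt u v : le u v = (u == v) || dlt u v.
Proof. by rewrite /dlt; case: eqVneq => [->|_]; rewrite ?dle_refl ?andbT. Qed.

Lemma dern_add i j u : dern i (dern j u) = dern (j + i) u.
Proof. by rewrite /dern /= addnA. Qed.

Lemma dern0 u : dern 0 u = u.
Proof. by rewrite /dern addn0; case: u. Qed.

Lemma dern_inj j u v : dern j u = dern j v -> u = v.
Proof. by case: u v => [a b] [c e] [-> /addIn ->]. Qed.

Lemma dle_dern j u : le u (dern j u).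
Proof.
elim: j => [|j IH]; first by rewrite dern0 dle_refl.
by apply: dle_trans IH _; rewrite -addn1 -dern_add; case: leP => _ [].
Qed.

Lemma dlt_dern j u : dlt u (dern j.+1 u).
Proof.
rewrite /dlt dle_dern; apply/eqP => /(congr1 snd) /=; lia.
Qed.

Lemma dern_mono j u v : le u v -> le (dern j u) (dern j v).
Proof.
move=> uv; elim: j => [|j IH]; first by rewrite !dern0.
by rewrite -addn1 -!dern_add; case: leP => _ [_]; apply.
Qed.

Lemma dern_smono j u v : dlt u v -> dlt (dern j u) (dern j v).
Proof.
case/andP => uv ne; rewrite /dlt dern_mono //; apply: contra ne => /eqP E.
by apply/eqP; apply: dern_inj E.
Qed.

Lemma dle_same u v : u.1 = v.1 -> le u v = (u.2 <= v.2)%N.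
Proof.
have H w z : w.1 = z.1 -> (w.2 <= z.2)%N -> le w z.
  case: w z => [a b] [c e] /= -> be; have -> : (c, e) = dern (e - b) (c, b).
    by rewrite /dern /= subnKC.
  exact: dle_dern.
move=> E; apply/idP/idP; last exact: H.
case: (leqP u.2 v.2) => // lt uv; have vu := H v u (esym E) (ltnW lt).
by have Euv : u = v by [apply: dle_anti; rewrite uv vu]; rewrite Euv ltnn in lt.
Qed.

Lemma dlt_same u v : u.1 = v.1 -> dlt u v = (u.2 < v.2)%N.
Proof. by move=> E; rewrite dltNle dle_same // ltnNge. Qed.

(** For a fixed variable the ranking is the order of the naturals, so a nonempty set of derivatives
    has a least element in each variable; the least of these finitely many is the minimum. *)
Lemma dlt_wf : well_founded (fun u v => is_true (dlt u v)).
Proof.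
suff min (Q : der n -> Prop) : (exists u, Q u) -> exists2 u, Q u & forall v, Q v -> le u v.
  move=> u; apply: NNPP => Hu.
  have [w Hw wmin] := min (fun u => ~ Acc (fun u v => is_true (dlt u v)) u) (ex_intro _ u Hu).
  apply: Hw; constructor => v vw; apply: NNPP => /wmin; rewrite dleNlt => /negP; exact.
have nmin (S : nat -> Prop) : (exists i, S i) -> exists2 i, S i & forall j, S j -> (i <= j)%N.
  case=> i; have [N] := ubnP i; elim: N i => // N IH i; rewrite ltnS => iN Si.
  case: (classic (exists2 j, S j & (j < i)%N)) => [[j Sj ji]|H].
    by apply: (IH j) => //; apply: leq_trans iN.
  by exists i => // j Sj; rewrite leqNgt; apply/negP => ji; apply: H; exists j.
case=> u0 Q0.
suff [u Qu H] : exists2 u, Q u & forall v, v.1 \in enum 'I_n -> Q v -> le u v.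
  by exists u => // v; apply: H; rewrite mem_enum.
elim: (enum 'I_n) => [|i s [u Qu H]]; first by exists u0.
case: (classic (exists j, Q (i, j))) => [/(nmin (fun j => Q (i, j))) [j Qj jmin]|H0].
  have Hi v : v.1 = i -> Q v -> le (i, j) v.
    by case: v => a b /= -> /jmin lt; rewrite dle_same.
  case/orP: (dle_total u (i, j)) => C.
    exists u => // v; rewrite inE => /orP[/eqP E Qv|]; last exact: H.
    by apply: dle_trans C (Hi _ E Qv).
  exists (i, j) => // v; rewrite inE => /orP[/eqP E Qv|vs Qv]; first exact: Hi.
  by apply: dle_trans C (H _ vs Qv).
exists u => // v; rewrite inE => /orP[/eqP E Qv|]; last exact: H.
by case: H0; exists v.2; rewrite -E; case: v Qv {E}.
Qed.

End Ranking.

Section Leaders.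
Context (n : nat) (k : fieldType) (d : k -> k) (le : rel (der n)).
Context (dP : derivation d) (ch : [pchar k] =i pred0) (leP : ranking le).
Local Notation P := (dpoly k n).
Local Notation dvar := (@dvar n k).
Local Notation ld := (@ld n k le).
Local Notation init := (@init n k le).
Local Notation sep := (@sep n k le).
Implicit Types (f g b : P) (u v w : der n) (S F : {fset P}).

Lemma ldP f u : ld f = Some u <-> u \in vars f /\ forall v, v \in vars f -> le v u.
Proof.
rewrite /ld; case: pickP => [x /forallP H|H] /=; split.
- by case=> <-; split=> [|v vf]; [apply: valP|apply: (H [` vf])].
- case=> uf umax; congr Some; apply: (dle_anti leP).
  by rewrite umax ?(valP x) //= (H [` uf]).
- by [].
- case=> uf umax; have := H [` uf]; move/negbT/negP; case; apply/forallP => v.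
  exact/umax/valP.
Qed.

Lemma ld_ex f : ~~ isconst f -> exists u, ld f = Some u.
Proof.
move=> /fset0Pn [x xf]; have [||||u uf H] := @ex_least _ (fun u v => le v u) (vars f).
- by move=> a; apply: dle_refl leP _.
- by move=> a b c ab bc; apply: dle_trans bc ab.
- by move=> a b; apply: dle_total.
- by apply/eqP => E; have : x \in enum_fset (vars f) by []; rewrite E.
by exists u; apply/ldP.
Qed.

Lemma ld_const f : isconst f -> ld f = None.
Proof.
move=> /eqP E; case L: (ld f) => [u|//].
by have [] := (ldP f u).1 L; rewrite E in_fset0.
Qed.

Lemma ld_nconst f u : ld f = Some u -> ~~ isconst f.
Proof. by move=> L; apply/negP => /ld_const; rewrite L. Qed.

Lemma ld_degv f u : ld f = Some u -> (0 < degv u f)%N.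
Proof. by rewrite degv_gt0 => /ldP []. Qed.

Lemma ld_neq0 f u : ld f = Some u -> f != 0.
Proof. by move=> /ld_degv; apply: contraTneq => ->; rewrite degv0. Qed.

Lemma initE f u : ld f = Some u -> init f = coefv u (degv u f) f.
Proof. by rewrite /init => ->. Qed.

Lemma sepE f u : ld f = Some u -> sep f = pderiv u f.
Proof. by rewrite /sep => ->. Qed.

Lemma init_neq0 f u : ld f = Some u -> init f != 0.
Proof. by move=> L; rewrite (initE L); apply: coefv_deg_neq0; apply: ld_neq0 L. Qed.

Lemma sep_neq0 f u : ld f = Some u -> sep f != 0.
Proof. by move=> L; rewrite (sepE L); apply: pderiv_neq0 => //; case/ldP: L. Qed.

Lemma vars_init f v : v \in vars (init f) -> v \in vars f.
Proof.
rewrite /init; case: (ld f) => [u|]; first exact: vars_coefv.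
by rewrite (negbTE (notin_vars0 _ _)).
Qed.

Lemma vars_sep f v : v \in vars (sep f) -> v \in vars f.
Proof.
rewrite /sep; case: (ld f) => [u|]; first exact: vars_pderiv.
by rewrite (negbTE (notin_vars0 _ _)).
Qed.

Lemma degv_init v f : (degv v (init f) <= degv v f)%N.
Proof. by rewrite /init; case: (ld f) => [u|]; rewrite ?degv_coefv ?degv0. Qed.

Lemma degv_sep v f : (degv v (sep f) <= degv v f)%N.
Proof. by rewrite /sep; case: (ld f) => [u|]; rewrite ?degv_pderiv ?degv0. Qed.

Lemma linear_upoly w f (a s : P) : upoly w f = a%:P + s%:P * 'X -> s != 0 ->
  [/\ degv w f = 1%N, coefv w 1 f = s & pderiv w f = s].
Proof.
move=> /linear_poly H /H [S C D]; split; first by rewrite degvE S.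
  by rewrite -coef_upoly C.
by rewrite pderiv_upoly D hornerC.
Qed.

(** The chain rule yields the derivative of the leader in a single term, multiplied by the separant;
    the ranking is compatible with differentiation, so all else is lower. Hence derivatives are
    linear in their leaders, with [sep g] as both initial and separant. *)
Lemma delta_ld_split g u : ld g = Some u ->
  exists2 X, delta d g = X + sep g * dvar (dern 1 u) &
    forall v, v \in vars X -> dlt le v (dern 1 u).
Proof.
move=> L; have [ug umax] := (ldP g u).1 L.
exists (kap d g + \sum_(v <- vars g `\ u) pderiv v g * dvar (dern 1 v)).
  apply: etrans (deltaE d g) _; rewrite (sepE L).
  apply: etrans (congr1 (fun x => kap d g + x) (big_fsetD1 u ug)) _.
  exact: addr_add_comm.
move=> v; apply: contraTT => nlt.
have umax' w : w \in vars g -> dlt le w (dern 1 u).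
  by move=> /umax H; apply: dle_lt_trans H _ => //; apply: dlt_dern.
apply: notin_varsD.
  by apply: contra nlt => /(vars_kap dP) /umax'.
rewrite big_seq; elim/big_ind: _ => [|x y|w]; [exact: notin_vars0|exact: notin_varsD|].
rewrite in_fsetD1 => /andP[wu wg]; apply: notin_varsM.
  by apply: contra nlt => /vars_pderiv /umax'.
rewrite vars_dvar; apply: contra nlt => /eqP ->; apply: dern_smono => //.
by rewrite /dlt umax.
Qed.

Lemma ld_delta g u : ld g = Some u ->
  [/\ ld (delta d g) = Some (dern 1 u), degv (dern 1 u) (delta d g) = 1%N,
      init (delta d g) = sep g & sep (delta d g) = sep g].
Proof.
move=> L; have [X E HX] := delta_ld_split L; set w := dern 1 u in E HX *.
have Xw : w \notin vars X by apply/negP => /HX; rewrite dltxx.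
have sw : w \notin vars (sep g).
  apply/negP => /vars_sep ws; have [_ /(_ _ ws)] := (ldP g u).1 L.
  by rewrite dleNlt // dlt_dern.
have Eu : upoly w (delta d g) = X%:P + (sep g)%:P * 'X.
  by rewrite E upolyD upolyM upoly_dvar (upoly_const Xw) (upoly_const sw).
have [D C Pd] := linear_upoly Eu (sep_neq0 L).
have Lw : ld (delta d g) = Some w.
  apply/ldP; split; first by rewrite -degv_gt0 D.
  move=> v; apply: contraTT; rewrite -dltNle // => lt; rewrite E; apply: notin_varsD.
    by apply: contraL lt => /HX lt; rewrite -dleNlt //; apply: dltW.
  apply: notin_varsM.
    apply: contraL lt => /vars_sep vg; rewrite -dleNlt //.
    have [_ /(_ _ vg) vu] := (ldP g u).1 L; apply: dle_trans vu _ => //.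
    exact: dle_dern.
  by rewrite vars_dvar; apply: contraL lt => /eqP ->; rewrite dltxx.
split; [exact: Lw|exact: D| |].
  by apply: etrans (initE Lw) _; rewrite D; apply: C.
by apply: etrans (sepE Lw) _; apply: Pd.
Qed.

End Leaders.

(** * Ideals and elements regular modulo them *)

Section Ideals.
Context (R : comNzRingType).
Implicit Types (I : R -> Prop) (a b x y h i q r s f : R).

Definition is_ideal I : Prop :=
  [/\ I 0, forall a b, I a -> I b -> I (a + b) & forall a b, I b -> I (a * b)].

(** The unit ideal is allowed, and there every element is regular. Conversely an element of [I] is
    regular only there ([nzd_in]), which is how inconsistent branches are closed. *)
Definition nzd I h : Prop := forall a, I (h * a) -> I a.

Lemma idealB I a b : is_ideal I -> I a -> I b -> I (a - b).
Proof. by case=> _ iD iM Ia Ib; apply: iD => //; rewrite -mulN1r; apply: iM. Qed.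

Lemma nzd1 I : nzd I 1.
Proof. by move=> a; rewrite mul1r. Qed.

Lemma nzdM I a b : nzd I a -> nzd I b -> nzd I (a * b).
Proof. by move=> na nb x; rewrite -mulrA => /na /nb. Qed.

Lemma nzdX I a e : nzd I a -> nzd I (a ^+ e).
Proof.
by move=> na; elim: e => [|e IH]; rewrite ?expr0 ?exprS; [apply: nzd1|apply: nzdM].
Qed.

Lemma nzd_mull I a b : is_ideal I -> nzd I (a * b) -> nzd I b.
Proof. by case=> _ _ iM nab x Ix; apply: nab; rewrite -mulrA; apply: iM. Qed.

Lemma nzd_congr I a b : is_ideal I -> I (a - b) -> nzd I a -> nzd I b.
Proof.
move=> iI; have [_ iD iM] := iI => Iab na x Ix; apply: na.
have -> : a * x = x * (a - b) + b * x by rewrite mulrBr (mulrC b) (mulrC a) subrK.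
by apply: iD => //; apply: iM.
Qed.

Lemma ideal_congr I a b : is_ideal I -> I (a - b) -> (I a <-> I b).
Proof.
move=> iI Iab; have [_ iD iM] := iI; split=> H.
  have -> : b = a - (a - b) by rewrite opprB addrC subrK.
  exact: idealB.
have -> : a = (a - b) + b by rewrite subrK.
exact: iD.
Qed.

Lemma ideal_pdiv_trans I h i q b r s f : is_ideal I -> I b ->
  i * f = q * b + r -> I (h * r - s) -> I (h * i * f - s).
Proof.
move=> iI Ib E Ir; have [_ iD iM] := iI.
by rewrite -mulrA E mulrDr mulrA -addrA; apply: iD => //; apply: iM.
Qed.

Lemma nzd0 I a : nzd I 0 -> is_ideal I -> I a.
Proof. by move=> n0 [I0 _ _]; apply: n0; rewrite mul0r. Qed.

Lemma nzd_in I h a : is_ideal I -> nzd I h -> I h -> I a.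
Proof. by case=> _ _ iM nh Ih; apply: nh; rewrite mulrC; apply: iM. Qed.

Lemma ideal1 I a : is_ideal I -> I 1 -> I a.
Proof. by case=> _ _ iM I1; rewrite -[a]mulr1; apply: iM. Qed.

Lemma nzd_congr_iff I h f g : is_ideal I -> nzd I h -> I (h * f - g) -> (nzd I f <-> nzd I g).
Proof.
move=> iI nh Ifg; split=> H; first by apply: nzd_congr Ifg _ => //; apply: nzdM.
apply: (@nzd_mull I h) => //; apply: nzd_congr H => //.
by rewrite -opprB -mulN1r; case: iI => _ _; apply.
Qed.

Lemma ideal_congr_iff I h f g : is_ideal I -> nzd I h -> I (h * f - g) -> (I f <-> I g).
Proof.
move=> iI nh Ifg; have [_ _ iM] := iI.
by rewrite -(ideal_congr iI Ifg); split=> [/iM //|/nh].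
Qed.

End Ideals.

Lemma addr_mul0 (R : pzRingType) (a f z : R) : z = 0 -> a + f * z = a.
Proof. by move=> ->; rewrite mulr0 addr0. Qed.

Section Reduction.
Context (n : nat) (k : fieldType) (d : k -> k) (le : rel (der n)).
Context (dP : derivation d) (ch : [pchar k] =i pred0) (leP : ranking le).
Local Notation P := (dpoly k n).
Local Notation ld := (@ld n k le).
Local Notation rk := (@rk n k le).
Local Notation init := (@init n k le).
Implicit Types (f g b : P) (u v w : der n) (S F : {fset P}).

Lemma pderivMr u g f : u \notin vars g -> pderiv u (f * g) = pderiv u f * g.
Proof. by move=> H; apply: etrans (pderivM u f g) (addr_mul0 _ _ (pderiv_notin H)). Qed.

Lemma rk_le_refl : reflexive (rk_le le).
Proof. by case=> [[u e]|] //=; rewrite eqxx. Qed.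

Lemma rk_le_trans : transitive (rk_le le).
Proof.
case=> [[v e]|] [[u e']|] [[w e'']|] //=.
case: (eqVneq u v) => [?|uv]; case: (eqVneq v w) => [?|vw]; subst; rewrite ?eqxx //.
- exact: leq_trans.
- by rewrite (negbTE vw).
- by rewrite (negbTE uv).
move=> H H'; case: (eqVneq u w) => E; last exact: dle_trans H H'.
by case/eqP: uv; rewrite E in H *; apply: (dle_anti leP); rewrite H H'.
Qed.

Lemma rk_le_total : total (rk_le le).
Proof.
case=> [[u e]|] [[v e']|] //=; rewrite (eq_sym v u).
by case: eqP => _; [apply: leq_total|apply: dle_total].
Qed.

Lemma least_ex F : F != fset0 -> exists f, least le F f.
Proof.
move=> F0; have [||||f fF H] := @ex_least _ (fun f g => rk_le le (rk f) (rk g)) F.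
- by move=> f; apply: rk_le_refl.
- by move=> f g h; apply: rk_le_trans.
- by move=> f g; apply: rk_le_total.
- by apply: contra F0 => /eqP E; apply/eqP/fsetP => x; rewrite -[x \in F]/(x \in enum_fset F) E.
by exists f.
Qed.

Lemma rkE f u : ld f = Some u -> rk f = Some (u, degv u f).
Proof. by rewrite /rk => ->. Qed.

Lemma rk_ld f g : rk f = rk g -> ld f = ld g.
Proof. by rewrite /rk; case: (ld f) (ld g) => [u|] [v|] //= [->]. Qed.

Lemma rk_degv f g u : rk g = rk f -> ld f = Some u -> degv u g = degv u f.
Proof. by move=> E L; move: E; rewrite (rkE L) /rk; case: (ld g) => //= v [-> ->]. Qed.

Lemma alg_reducedE f b u : ld b = Some u -> alg_reduced le f b = (degv u f < degv u b)%N.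
Proof. by rewrite /alg_reduced => ->. Qed.

Lemma pdiv_stepP S f r : pdiv_step le S f r -> exists b u e q,
  [/\ b \in S, ld b = Some u, init b ^+ e * f = q * b + r,
      (degv u r < degv u b <= degv u f)%N &
      forall v, v \notin vars b -> (degv v r <= degv v f)%N].
Proof.
case=> b [e [q [bS nr E rr]]]; move: nr rr; rewrite /alg_reduced.
case L: (ld b) => [u|//]; rewrite -leqNgt => nr rr; exists b, u, e, q; split=> //.
  by rewrite rr.
by move=> v vb; apply: (pseudo_division_degv (u := u) (e := e) vb _ rr); rewrite -(initE L); apply: E.
Qed.

Lemma pdiv_step_ex S f b : b \in S -> ~~ alg_reduced le f b -> exists r, pdiv_step le S f r.
Proof.
move=> bS nr; move: (nr); rewrite /alg_reduced; case L: (ld b) => [u|//] _.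
have [e [q [r [E rr]]]] := pseudo_division f (ld_degv leP L).
exists r, b, e, q; split; [exact: bS|exact: nr| |by rewrite (alg_reducedE _ L)].
by rewrite (initE L); apply: E.
Qed.

(** What one pseudo-division in [u] guarantees: derivatives below [u] are unconstrained, since
    multiplying by the initial may raise their degrees. *)
Definition drop_step (L : seq (der n)) (f r : P) : Prop :=
  exists2 u, u \in L & (degv u r < degv u f)%N /\
    forall v, dlt le u v -> (degv v r <= degv v f)%N.

(** The degrees along [L] decrease lexicographically. [L] is decreasing, so its head is the most
    significant coordinate, and a drop at a later entry never raises the degree in the head. *)
Lemma drop_step_acc (L : seq (der n)) f : pairwise (fun u v => dlt le v u) L ->
  Acc (fun r f => drop_step L f r) f.
Proof.
elim: L f => [|u L IH] f /=; first by move=> _; constructor => r [].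
case/andP => uL pL; have [N] := ubnP (degv u f).
elim: N f => [|N IHN] f; first by rewrite ltn0.
rewrite ltnS.
elim: {f}(IH f pL) => f _ IHf fN; constructor => r [v].
rewrite inE => /orP[/eqP -> [lt _]|vL [lt H]].
  by apply: IHN; apply: leq_trans fN.
apply: IHf; first by exists v.
by apply: leq_trans fN; apply: H; have /allP /(_ _ vL) := uL.
Qed.

Lemma pdiv_acc S f : Acc (fun r f => pdiv_step le S f r) f.
Proof.
pose L := sort (fun u v => le v u) (undup (pmap ld (enum_fset S))).
have pL : pairwise (fun u v => dlt le v u) L.
  have tr : transitive (fun u v => le v u) by move=> a b c ab bc; apply: dle_trans bc ab.
  have : pairwise (fun u v => le v u) L.
    rewrite -sorted_pairwise //; apply: sort_sorted => a b; exact: dle_total.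
  have : uniq L by rewrite sort_uniq undup_uniq.
  rewrite uniq_pairwise => p1 p2.
  have : pairwise [rel u v | le v u && (u != v)] L.
    by rewrite (pairwise_relI (fun u v => le v u) (fun u v => u != v)) p1 p2.
  by apply: sub_pairwise => x y /=; rewrite /dlt eq_sym.
elim: (drop_step_acc f pL) => {}f _ IH; constructor => r H; apply: IH.
have [b [u [e [q [bS Lb E /andP[l1 l2] H']]]]] := pdiv_stepP H.
exists u; first by rewrite mem_sort mem_undup mem_pmap -Lb; apply: map_f.
split=> [|v uv]; first exact: leq_trans l2.
by apply: H'; apply: contraL uv => vb; rewrite -dleNlt //; case/ldP: Lb => // _; apply.
Qed.

Lemma algrem_ex S f : exists r, algrem le S f r.
Proof.
elim: (pdiv_acc S f) => {}f _ IH.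
case: (classic (alg_reduced_set le S f)) => [H|H].
  by exists f; split=> //; apply: rt_refl.
have [b Hb] := not_all_ex_not _ _ H; have {}Hb := imply_to_and _ _ Hb.
have [r Hr] : exists r, pdiv_step le S f r.
  by case: Hb => bS /negP; apply: pdiv_step_ex.
have [r' [H1 H2]] := IH _ Hr; exists r'; split=> //.
by apply: rt_trans H1; apply: rt_step.
Qed.

Lemma crt_degv S f r v : clos_refl_trans _ (pdiv_step le S) f r ->
  (forall b, b \in S -> v \notin vars b) -> (degv v r <= degv v f)%N.
Proof.
move=> H HS; elim: H => {f r} [f r H|f|f g h _ IH1 _ IH2] //.
  by have [b [u [e [q [bS _ _ _]]]]] := pdiv_stepP H; apply; apply: HS.
exact: leq_trans IH2 IH1.
Qed.

Lemma crt_vars S f r v : clos_refl_trans _ (pdiv_step le S) f r -> v \in vars r ->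
  v \in vars f \/ exists2 b, b \in S & v \in vars b.
Proof.
move=> H vr; case: (classic (exists2 b, b \in S & v \in vars b)) => [|H']; [by right|left].
rewrite -degv_gt0; apply: leq_trans (crt_degv H _); first by rewrite degv_gt0.
by move=> b bS; apply/negP => vb; apply: H'; exists b.
Qed.

(** The multiplier collects the powers of initials used along the way. *)
Lemma crt_ideal (I : P -> Prop) S f r : is_ideal I -> (forall b, b \in S -> I b) ->
  (forall b, b \in S -> ~~ isconst b -> nzd I (init b)) ->
  clos_refl_trans _ (pdiv_step le S) f r -> exists2 h, nzd I h & I (h * f - r).
Proof.
move=> iI SI Sn H; elim: (clos_rt_rt1n _ _ _ _ H) => {f r H} [f|f g r H _ [h nh Ih]].
  exists 1; first exact: nzd1.
  by rewrite mul1r subrr; case: iI.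
have [b [u [e [q [bS Lb E _ _]]]]] := pdiv_stepP H.
exists (h * init b ^+ e).
  apply: nzdM nh _; apply: nzdX; apply: Sn => //; exact: ld_nconst Lb.
exact: ideal_pdiv_trans iI (SI _ bS) E Ih.
Qed.

(** A divisor acts only if its leader occurs in the current polynomial. That leader is at most [u]
    and differs from it, so the divisor lies entirely below [u]. *)
Lemma crt_top S f r u : (forall b w, b \in S -> ld b = Some w -> w != u) ->
  (forall v, v \in vars f -> le v u) -> clos_refl_trans _ (pdiv_step le S) f r ->
  (forall v, v \in vars r -> le v u) /\ (degv u r <= degv u f)%N.
Proof.
move=> HS + H; elim: H => {f r} [f r H|f|f g h _ IH1 _ IH2] fu //.
  have [b [w [e [q [bS Lb E /andP[l1 l2] Hd]]]]] := pdiv_stepP H.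
  have wf : w \in vars f by rewrite -degv_gt0; apply: leq_trans l2; apply: leq_ltn_trans l1.
  have wu : dlt le w u by rewrite /dlt fu // (HS _ _ bS Lb).
  have bw v : v \in vars b -> dlt le v u.
    by case/ldP: Lb => // _ Hb vb; apply: dle_lt_trans wu => //; apply: Hb.
  split=> [v vr|]; last by apply: Hd; apply/negP => /bw; rewrite dltxx.
  case: (boolP (v \in vars b)) => [/bw /dltW //|vb]; apply: fu.
  by rewrite -degv_gt0; apply: leq_trans (Hd _ vb); rewrite degv_gt0.
have [gu dg] := IH1 fu; have [hu dh] := IH2 gu; split=> //; exact: leq_trans dh dg.
Qed.

(** The divisors that act are free of [u], so the reduction works coefficientwise in [u] with a
    common multiplier. This carries the initial and the separant along with the polynomial. *)
Lemma crt_ideal_top (I : P -> Prop) S f r u : is_ideal I -> (forall b, b \in S -> I b) ->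
  (forall b, b \in S -> ~~ isconst b -> nzd I (init b)) ->
  (forall b w, b \in S -> ld b = Some w -> w != u) ->
  (forall v, v \in vars f -> le v u) -> clos_refl_trans _ (pdiv_step le S) f r ->
  exists2 h, nzd I h & [/\ I (h * f - r), forall e, I (h * coefv u e f - coefv u e r)
    & I (h * pderiv u f - pderiv u r)].
Proof.
move=> iI SI Sn HS + H; elim: (clos_rt_rt1n _ _ _ _ H) => {f r H} [f|f g r H _ IH] fu.
  exists 1; first exact: nzd1.
  by have [I0 _ _] := iI; split=> [|e|]; rewrite mul1r subrr.
have [gu _] := crt_top HS fu (rt_step _ _ _ _ H).
have [h nh [Ih Ic Id]] := IH gu.
have [b [w [e [q [bS Lb E /andP[l1 l2] _]]]]] := pdiv_stepP H.
have wf : w \in vars f by rewrite -degv_gt0; apply: leq_trans l2; apply: leq_ltn_trans l1.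
have wu : dlt le w u by rewrite /dlt fu // (HS _ _ bS Lb).
have bu : u \notin vars b.
  apply/negP => ub; case/ldP: Lb => // _ /(_ _ ub) uw.
  by have := dle_lt_trans leP uw wu; rewrite dltxx.
have iu : u \notin vars (init b ^+ e) by apply: notin_varsX; apply: contra bu; apply: vars_init.
exists (h * init b ^+ e).
  apply: nzdM nh _; apply: nzdX; apply: Sn => //; exact: ld_nconst Lb.
split; first exact: ideal_pdiv_trans iI (SI _ bS) E Ih.
  move=> j; apply: ideal_pdiv_trans iI (SI _ bS) _ (Ic j).
  apply: etrans (esym (coefvMl j f iu)) _; apply: etrans (congr1 (coefv u j) E) _.
  by apply: etrans (coefvD _ _ _ _) _; apply: (congr1 (fun x => x + _)); apply: coefvMr.
apply: ideal_pdiv_trans iI (SI _ bS) _ Id.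
apply: etrans (esym (pderivMl f iu)) _; apply: etrans (congr1 (pderiv u) E) _.
apply: etrans (pderivD _ _ _) _; apply: (congr1 (fun x => x + _)).
exact: pderivMr.
Qed.

End Reduction.

(** * Saturated ideals of triangular sets *)

Section PolyFactor.
Context (L : fieldType).
Implicit Types (p q g A B F : {poly L}).

Lemma irreducible_divisor p : (1 < size p)%N -> exists2 g, irreducible_poly g & g %| p.
Proof.
have [N] := ubnP (size p); elim: N p => // N IH p; rewrite ltnS => pN p1.
case: (classic (irreducible_poly p)) => [H|H]; first by exists p.
have [q Hq] : exists q, ~ (size q != 1%N -> q %| p -> q %= p).
  by apply: not_all_ex_not => H'; apply: H; split.
have [q1 Hq'] := imply_to_and _ _ Hq; have [qp qnp] := imply_to_and _ _ Hq'.
have p0 : p != 0 by rewrite -size_poly_gt0; apply: ltn_trans p1.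
have q0 : q != 0 by apply: contraTneq qp => ->; rewrite dvd0p.
have lt : (size q < size p)%N.
  rewrite ltn_neqAle dvdp_leq // andbT; apply/negP => E; apply: qnp.
  by rewrite -dvdp_size_eqp.
have q2 : (1 < size q)%N by move: q1 q0; rewrite -size_poly_gt0; case: (size q) => [|[]].
have [g ig gq] := IH q (leq_trans lt pN) q2.
by exists g => //; apply: dvdp_trans gq qp.
Qed.

(** Strip [gcdp F B] from [F] until nothing is left. Each round lowers the degree, so the degree of
    [F] bounds the number of rounds and hence the exponent of [B]. *)
Lemma coprime_split F B : F != 0 ->
  exists F1 F2, [/\ F = F1 * F2, coprimep F1 B & F2 %| B ^+ (size F).-1].
Proof.
have [N] := ubnP (size F); elim: N F => // N IH F; rewrite ltnS => FN F0.
case: (boolP (coprimep F B)) => [c|nc].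
  by exists F, 1; rewrite mulr1 dvd1p.
have gF := dvdp_gcdl F B; set g := gcdp F B in gF.
have g0 : g != 0 by rewrite gcdp_eq0 (negbTE F0).
have sg : (1 < size g)%N.
  by move: nc g0; rewrite coprimep_def -/g -size_poly_gt0; case: (size g) => [|[]].
have EF : F = (F %/ g) * g by rewrite divpK.
move: EF; set q := F %/ g => EF.
have q0 : q != 0 by apply: contraNneq F0 => E; rewrite EF E mul0r.
have SF : size F = (size q + size g).-1 by rewrite {1}EF size_mul.
have sF : (size q < size F)%N by rewrite SF; move: sg; lia.
have [F1 [F2 [E c D]]] := IH _ (leq_trans sF FN) q0.
exists F1, (F2 * g); split=> //; first by rewrite mulrA -E.
(* One factor [B] absorbs the gcd just removed, [(size q).-1] factors serve the induction
   hypothesis, and the rest is slack. *)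
have -> : (size F).-1 = ((size F).-2 - (size q).-1 + (size q).-1).+1.
  by move: q0 sF; rewrite -size_poly_gt0; lia.
rewrite exprSr; apply: dvdp_mul; last exact: dvdp_gcdr.
by rewrite exprD dvdp_mull.
Qed.

(** Let [F1] be the part of [F] coprime to its derivative. The hypothesis says that [F1] does not
    divide [A], so some irreducible [g] divides [F1 / gcd(F1, A)]. If [g] divided [A], then [g^2]
    would divide [F], and [g] its derivative. *)
Lemma simple_factor F A : F != 0 -> ~~ (F %| F^`() ^+ (size F).-1 * A) ->
  exists g, [/\ irreducible_poly g, g %| F, ~~ (g %| F^`()) & ~~ (g %| A)].
Proof.
move=> F0 nd; have [F1 [F2 [E c D]]] := coprime_split F^`() F0.
have F10 : F1 != 0 by apply: contraNneq F0 => E1; rewrite E E1 mul0r.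
have nA : ~~ (F1 %| A).
  by apply: contra nd => FA; rewrite {1}E mulrC dvdp_mul.
have EF1 := divpK (dvdp_gcdl F1 A); set h := F1 %/ gcdp F1 A in EF1.
have h1 : (1 < size h)%N.
  rewrite ltnNge; apply/negP => h1; case/negP: nA.
  rewrite -EF1; apply: dvdp_trans (dvdp_gcdr F1 A).
  rewrite (size1_polyC h1) mul_polyC dvdpZl //.
  by apply: contraNneq F10 => h0; rewrite -EF1 (size1_polyC h1) h0 mul0r.
have [g ig gh] := irreducible_divisor h1; exists g.
have gF1 : g %| F1 by rewrite -EF1 dvdp_mulr.
have ngF : ~~ (g %| F^`()).
  apply/negP => gF; have := coprimep_dvdr gF1 (coprimep_dvdl gF c).
  by rewrite coprimepp => /eqP s1; case: ig; rewrite s1.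
split=> //; first by rewrite E dvdp_mulr.
apply: contra ngF => gA.
have : g * g %| F by rewrite E -EF1 dvdp_mulr // dvdp_mul // dvdp_gcd gF1 gA.
case/dvdpP => x ->; rewrite mulrA derivM; apply: dvdp_add.
  exact: dvdp_mull.
by rewrite -mulrA mulrCA dvdp_mulr.
Qed.

End PolyFactor.

(** * Zeros over extension fields *)

Section Evaluation.
Context (n : nat) (k : fieldType) (L : fieldType) (sg : {rmorphism k -> L}) (v : der n -> L).
Local Notation P := (dpoly k n).
Implicit Types (m : cmonom (der n)) (f g : P).

Definition mev m : L := \prod_(u <- finsupp (cmonom_val m)) v u ^+ m u.

Lemma mevEw (D : {fset der n}) m : finsupp (cmonom_val m) `<=` D ->
  mev m = \prod_(u <- D) v u ^+ m u.
Proof.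
move=> le; rewrite /mev (big_fset_incl _ le) // => u uD.
by rewrite -cmE_neq0 negbK => /eqP ->; rewrite expr0.
Qed.

Lemma mev_morph : mmorphism mev.
Proof.
split=> [x y|]; last by rewrite /mev mdom1 big_seq_fset0.
pose D := finsupp (cmonom_val x) `|` finsupp (cmonom_val y).
rewrite (@mevEw D x) ?fsubsetUl // (@mevEw D y) ?fsubsetUr // (@mevEw D) ?mdomD //.
by rewrite -big_split; apply: eq_bigr => u _; rewrite cmM exprD.
Qed.
HB.instance Definition _ := monalg.isMultiplicative.Build _ _ mev mev_morph.

Definition ev_def : P -> L := mmap sg mev.
HB.instance Definition _ := GRing.RMorphism.on ev_def.
End Evaluation.

HB.lock Definition ev (n : nat) (k L : fieldType) (sg : {rmorphism k -> L}) (v : der n -> L)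
  (f : dpoly k n) : L := ev_def sg v f.

Section EvaluationTheory.
Context (n : nat) (k : fieldType).
Local Notation P := (dpoly k n).
Local Notation dvar := (@dvar n k).
Implicit Types (L : fieldType) (m : cmonom (der n)) (f g : P) (u : der n).

Lemma ev_zmod L (sg : {rmorphism k -> L}) v : zmod_morphism (@ev n k L sg v).
Proof. by move=> f g; rewrite ev.unlock rmorphB. Qed.
HB.instance Definition _ L (sg : {rmorphism k -> L}) v :=
  GRing.isZmodMorphism.Build P L (@ev n k L sg v) (ev_zmod sg v).
Lemma ev_monoid L (sg : {rmorphism k -> L}) v : monoid_morphism (@ev n k L sg v).
Proof. by split=> [|f g]; rewrite ev.unlock ?rmorph1 // rmorphM. Qed.
HB.instance Definition _ L (sg : {rmorphism k -> L}) v :=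
  GRing.isMonoidMorphism.Build P L (@ev n k L sg v) (ev_monoid sg v).

Lemma evE L (sg : {rmorphism k -> L}) v f :
  ev sg v f = \sum_(m <- msupp f) sg f@_m * mev v m.
Proof. by rewrite ev.unlock. Qed.

Lemma ev_dvar L (sg : {rmorphism k -> L}) v u : ev sg v (dvar u) = v u.
Proof.
rewrite evE /dvar dterm.unlock msuppU oner_eq0 big_seq_fset1 mcoeffUU rmorph1 mul1r.
by rewrite /mev mdomU big_seq_fset1 ucmE eqxx expr1.
Qed.

Lemma ev_comp L L' (sg : {rmorphism k -> L}) (sg' : {rmorphism k -> L'}) v v'
    (phi : {rmorphism L -> L'}) f :
  (forall c, sg' c = phi (sg c)) -> (forall u, u \in vars f -> v' u = phi (v u)) ->
  ev sg' v' f = phi (ev sg v f).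
Proof.
move=> Hs Hv; rewrite !evE rmorph_sum; apply: eq_big_seq => m mf.
rewrite rmorphM Hs; congr (_ * _); rewrite /mev rmorph_prod; apply: eq_big_seq => u um.
rewrite rmorphXn Hv //; apply/mem_vars; exists m => //.
by rewrite lt0n cmE_neq0.
Qed.

Definition evp L (sg : {rmorphism k -> L}) v u f : {poly L} := map_poly (ev sg v) (upoly u f).

(** Extends a point by one coordinate: the old values move along [phi] and [u] goes to [z], so a
    root [z] of the partially evaluated [f] gives a zero of [f]. *)
Lemma ev_upd L L' (sg : {rmorphism k -> L}) (sg' : {rmorphism k -> L'}) v
    (phi : {rmorphism L -> L'}) u z f :
  (forall c, sg' c = phi (sg c)) ->
  ev sg' (fun w => if w == u then z else phi (v w)) f = (map_poly phi (evp sg v u f)).[z].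
Proof.
move=> Hs; set v' := fun w => _; rewrite -{1}(upoly_horner u f) horner_coef rmorph_sum.
have -> : map_poly phi (evp sg v u f) = \poly_(i < size (upoly u f)) ev sg' v' (coefv u i f).
  apply/polyP => i; rewrite coef_map coef_map coef_poly coef_upoly.
  case: ltnP => [_|le].
    apply: esym; apply: ev_comp => // w wf; rewrite /v'; case: eqP => // E.
    by move: wf; rewrite E (negbTE (coefv_free _ _ _)).
  have -> : coefv u i f = 0 by rewrite -coef_upoly; apply: nth_default.
  by apply: etrans (congr1 phi (rmorph0 (ev sg v))) _; apply: rmorph0.
rewrite horner_poly; apply: eq_bigr => i _.
by rewrite rmorphM rmorphXn /= ev_dvar /v' eqxx coef_upoly.
Qed.

Lemma ex_nonroot (p : {poly k}) : [pchar k] =i pred0 -> p != 0 -> exists z, p.[z] != 0.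
Proof.
move=> /pcharf0P ch p0; pose rs := [seq (i%:R : k) | i <- iota 0 (size p)].
have urs : uniq rs.
  rewrite map_inj_in_uniq ?iota_uniq // => i j _ _.
  wlog le : i j / (i <= j)%N.
    by move=> H E; case/orP: (leq_total i j) => l; [apply: H|apply/esym/H].
  move=> /esym /eqP; rewrite -subr_eq0 -natrB // ch => /eqP; lia.
case: (boolP (all (root p) rs)) => [H|/allPn [z _ H]]; last by exists z.
by have := max_poly_roots p0 H urs; rewrite size_map size_iota ltnn.
Qed.

(** Characteristic 0 makes [k] infinite, so the coordinates can be chosen one by one inside [k]:
    keep the leading coefficient nonzero, then avoid the roots. *)
Lemma ex_eval f : [pchar k] =i pred0 -> f != 0 -> exists v : der n -> k, ev idfun v f != 0.
Proof.
move=> ch; have [s] : exists s : seq (der n), {subset vars f <= s} by exists (vars f).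
elim: s f => [|u s IH] f sf f0.
  exists (fun _ => 0); have E : f = (f@_mone)%:MP by apply: constE => v; apply/negP => /sf.
  have c0 : f@_mone != 0 by apply: contraNneq f0 => c0; rewrite E c0; apply/eqP; apply: malgC0E.
  move: (f@_mone) c0 E => c c0 ->; rewrite evE msuppC (negbTE c0) big_seq_fset1.
  by rewrite mcoeffUU mmorph1 mulr1.
have [|v Hv] := IH (coefv u (degv u f) f) _ (coefv_deg_neq0 u f0).
  move=> w wl; have := sf w (vars_coefv wl); rewrite inE => /orP[/eqP E|//].
  by move: wl; rewrite E (negbTE (coefv_free _ _ _)).
have p0 : evp idfun v u f != 0.
  apply: contraNneq Hv => E; have := congr1 (fun p : {poly k} => p`_(degv u f)) E.
  by rewrite coef_map coef_upoly coef0 => ->.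
have [z Hz] := ex_nonroot ch p0.
exists (fun w => if w == u then z else idfun (v w)).
rewrite (@ev_upd _ _ idfun idfun v idfun) //.
by rewrite (_ : map_poly idfun _ = evp idfun v u f) // map_poly_id.
Qed.

End EvaluationTheory.

Section AbstractIdeals.
Context (R : comNzRingType).
Implicit Types (I M : R -> Prop) (a b c i q r s t f x : R).

(** Source of the multiplier in the first case of [triangular_hom]: modulo [f],
    [i ^+ e * (s ^+ m * a)] is [r], and [t * i] sends [r] into [I]. *)
Lemma ideal_resolve I t i e s m a q f r : is_ideal I -> I f ->
  i ^+ e * (s ^+ m * a) = q * f + r -> I (t * (i * r)) -> I (t * i * i ^+ e * s ^+ m * a).
Proof.
case=> _ iD iM If E Ir.
have -> : t * i * i ^+ e * s ^+ m * a = (t * i * q) * f + t * (i * r).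
  have -> : t * i * i ^+ e * s ^+ m * a = t * i * (i ^+ e * (s ^+ m * a)) by rewrite !mulrA.
  by rewrite E; ring.
by apply: iD => //; apply: iM.
Qed.

Lemma ideal_sum_coef I t i N (c : nat -> R) x : is_ideal I ->
  (forall j, (j < N)%N -> I (t * (i * c j))) -> I (t * (i * \sum_(j < N) c j * x ^+ j)).
Proof.
case=> I0 iD iM H; rewrite !mulr_sumr; elim/big_ind: _ => // j _.
have -> : t * (i * (c j * x ^+ j)) = x ^+ j * (t * (i * c j)) by ring.
by apply: iM; apply: H.
Qed.

Lemma common_multiplier I M N (c : nat -> R) : is_ideal I ->
  M 1 -> (forall a b, M a -> M b -> M (a * b)) ->
  (forall j, (j < N)%N -> exists2 s, M s & I (s * c j)) ->
  exists2 t, M t & forall j, (j < N)%N -> I (t * c j).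
Proof.
case=> _ _ iM M1 MM; elim: N => [|N IH] H; first by exists 1.
have [|t Mt Ht] := IH; first by move=> j jN; apply: H; apply: ltnW.
have [s Ms Is] := H N (ltnSn N); exists (t * s); first exact: MM.
move=> j; rewrite ltnS leq_eqVlt => /orP[/eqP ->|jN].
  by rewrite -mulrA; apply: iM.
by rewrite [t * s]mulrC -mulrA; apply/iM/Ht.
Qed.

(** With exponent [e] in place of [e.+1] the claim would fail for [e = 0]. *)
Lemma ideal_pow_mult I s a e : is_ideal I -> I (s * a ^+ e) -> I ((s * a) ^+ e.+1).
Proof.
case=> _ _ iM H.
have -> : (s * a) ^+ e.+1 = (s ^+ e * a) * (s * a ^+ e).
  by rewrite exprMn !exprS; ring.
exact: iM.
Qed.

Lemma ideal_assoc I a b c : I (a * (b * c)) -> I (a * b * c).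
Proof. by rewrite mulrA. Qed.

Lemma ideal_mulCA I a b c : is_ideal I -> I (a * b) -> I (a * (c * b)).
Proof. by case=> _ _ iM H; rewrite mulrCA; apply: iM. Qed.

Lemma ideal_mul_add I a b s t : is_ideal I -> I (s * a) -> I (t * b) -> I (s * t * (a + b)).
Proof.
case=> _ iD iM Ha Hb; rewrite mulrDr; apply: iD.
  by rewrite [s * t]mulrC -mulrA; apply: iM.
by rewrite -mulrA; apply: iM.
Qed.

(* From [s a \in I] one gets [s (s' a + s a') \in I], hence [s^2 a' \in I]. *)
Lemma ideal_deriv_mult I (D : R -> R) s a : is_ideal I ->
  (forall x y, D (x * y) = D x * y + x * D y) ->
  (forall x, I x -> I (D x)) -> I (s * a) -> I (s * s * D a).
Proof.
move=> iI DM ID H; have [_ iD iM] := iI; have := ID _ H; rewrite DM => H2.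
have -> : s * s * D a = s * (D s * a + s * D a) - D s * (s * a).
  by ring.
exact: (idealB iI (iM _ _ H2) (iM _ _ H)).
Qed.

End AbstractIdeals.

Section TriangularPoly.
Context (n : nat) (k : fieldType).
Local Notation P := (dpoly k n).
Context (L : fieldType) (sg : {rmorphism k -> L}) (v : der n -> L) (u : der n).
Implicit Types (f g : P).

Lemma evpM f g : evp sg v u (f * g) = evp sg v u f * evp sg v u g.
Proof. by rewrite /evp upolyM rmorphM. Qed.
Lemma evpX f e : evp sg v u (f ^+ e) = evp sg v u f ^+ e.
Proof. by rewrite /evp upolyX rmorphXn. Qed.
Lemma evpD f g : evp sg v u (f + g) = evp sg v u f + evp sg v u g.
Proof. by rewrite /evp upolyD rmorphD. Qed.
Lemma evp_pdiv x y a q f r : x * (y * a) = q * f + r ->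
  evp sg v u x * (evp sg v u y * evp sg v u a) =
  evp sg v u q * evp sg v u f + evp sg v u r.
Proof.
move=> E; apply: etrans (congr1 (fun t => evp sg v u x * t) (esym (evpM y a))) _.
apply: etrans (esym (evpM _ _)) _; apply: etrans (congr1 (evp sg v u) E) _.
by apply: etrans (evpD _ _) _; apply: (congr1 (fun t => t + _)); apply: evpM.
Qed.
Lemma evp_free f : u \notin vars f -> evp sg v u f = (ev sg v f)%:P.
Proof. by move=> H; rewrite /evp (upoly_const H) map_polyC. Qed.
Lemma evp_pderiv f : evp sg v u (pderiv u f) = (evp sg v u f)^`().
Proof. by rewrite /evp upoly_pderiv deriv_map. Qed.
Lemma coef_evp f j : (evp sg v u f)`_j = ev sg v (coefv u j f).
Proof. by rewrite /evp coef_map coef_upoly. Qed.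
Lemma size_evp f : (size (evp sg v u f) <= (degv u f).+1)%N.
Proof. by rewrite /evp; apply: leq_trans (size_poly _ _) _; rewrite -upart_degv. Qed.

End TriangularPoly.

Section Triangular.
Context (n : nat) (k : fieldType) (d : k -> k) (le : rel (der n)).
Context (dP : derivation d) (ch : [pchar k] =i pred0) (leP : ranking le).
Local Notation P := (dpoly k n).
Local Notation dvar := (@dvar n k).
Local Notation ld := (@ld n k le).
Local Notation init := (@init n k le).
Local Notation sep := (@sep n k le).
Implicit Types (f g b a : P) (u v w : der n) (A H : {fset P}) (D : seq P) (I M : P -> Prop).

Fixpoint triangular D : Prop :=
  if D is f :: D' then
    (exists2 u, ld f = Some u & forall g, g \in D' -> forall w, w \in vars g -> dlt le w u)
    /\ triangular D'
  else True.

(* For the top element f, let r be the remainder of [sep f ^+ deg f * a] by f.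
   If every coefficient of r is killed by M modulo I, then so is a.  Otherwise
   some coefficient is nonzero at a zero of D, and there f has a simple
   irreducible factor that does not divide a: adjoin one of its roots. *)
Lemma triangular_hom D I M a : is_ideal I -> M 1 -> (forall a b, M a -> M b -> M (a * b)) ->
  triangular D -> (forall f, f \in D -> [/\ I f, M (init f) & M (sep f)]) ->
  (exists2 s, M s & I (s * a)) \/
  exists (L : fieldType) (sg : {rmorphism k -> L}) (v : der n -> L),
    (forall f, f \in D -> [/\ ev sg v f = 0, ev sg v (init f) != 0 & ev sg v (sep f) != 0])
    /\ ev sg v a != 0.
Proof.
move=> iI M1 MM; elim: D a => [|f D IH] a.
  move=> _ _; have [->|a0] := eqVneq a 0.
    by left; exists 1; [exact: M1|rewrite mulr0; case: iI].
  by right; have [v Hv] := ex_eval ch a0; exists k, idfun, v.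
move=> [[u Lu uD] tD] HD; have [If Mi Ms] := HD f (mem_head _ _).
have HD' g : g \in D -> [/\ I g, M (init g) & M (sep g)].
  by move=> gD; apply: HD; rewrite inE gD orbT.
have dd := ld_degv leP Lu; have f0 := ld_neq0 leP Lu.
have MX x e : M x -> M (x ^+ e).
  by move=> Mx; elim: e => [|e IHe]; rewrite ?expr0 // exprS; apply: MM.
(* The exponent of the separant is the degree of [f] in [u], as [simple_factor] demands for the
   evaluated polynomial [F]. *)
have [e [q [r [E rr]]]] := pseudo_division (sep f ^+ degv u f * a) dd.
rewrite -(initE Lu) in E.
case: (classic (forall j, (j < degv u f)%N ->
    exists2 s, M s & I (s * (init f * coefv u j r)))) => [Hj|Hj].
  have [t Mt It] := common_multiplier iI M1 MM Hj.
  left; exists (t * init f * init f ^+ e * sep f ^+ degv u f).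
    by apply: (MM _ _ (MM _ _ (MM _ _ Mt Mi) (MX _ _ Mi)) (MX _ _ Ms)).
  apply: (ideal_resolve iI If E).
  have <- : \sum_(j < degv u f) coefv u j r * dvar u ^+ j = r.
    rewrite -[RHS](upoly_horner u r) (@horner_coef_wide _ (degv u f)) -?upart_degv.
      by apply: eq_bigr => j _; rewrite coef_upoly.
    by move: rr dd; rewrite degvE; case: (degv u f) (size _) => // m [].
  exact: (ideal_sum_coef (c := fun j => coefv u j r) (dvar u) iI It).
have [j {}Hj] := not_all_ex_not _ _ Hj; have [jd {}Hj] := imply_to_and _ _ Hj.
(* The factor [init f] makes the zero avoid the initial, so that evaluation preserves the degree of
   [f] in [u]. *)
have [//|[L [sg [v [Hv /eqP ar0]]]]] := IH (init f * coefv u j r) tD HD'.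
have i0 : ev sg v (init f) != 0.
  by apply/eqP => i0; apply: ar0; rewrite rmorphM /= i0 mul0r.
have r0 : ev sg v (coefv u j r) != 0.
  by apply/eqP => r0; apply: ar0; rewrite rmorphM /= r0 mulr0.
have iu : u \notin vars (init f) by rewrite (initE Lu); apply: coefv_free.
pose F := evp sg v u f.
have sF : size F = (degv u f).+1.
  rewrite /F /evp size_map_poly_id0 ?size_upoly // lead_coef_upoly -(initE Lu).
  exact: i0.
have F0 : F != 0 by rewrite -size_poly_gt0 sF.
have EF : evp sg v u (sep f) = F^`() by rewrite (sepE Lu) evp_pderiv.
have [g [ig gF gF' gA]] : exists g : {poly L}, [/\ irreducible_poly g, g %| F, ~~ (g %| F^`())
    & ~~ (g %| evp sg v u a)].
  apply: simple_factor => //; rewrite sF /= -EF -evpX; apply/negP => dv.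
  have EE := evp_pdiv sg v u E.
  have : F %| evp sg v u r.
    rewrite -(dvdp_addr _ (dvdp_mull (evp sg v u q) (dvdpp F))) -[_ + _]EE.
    exact: dvdp_mull.
  move/dvdp_leq; rewrite sF => /(_ _) H; move: r0; rewrite -coef_evp.
  have [->|R0] := eqVneq (evp sg v u r) 0; first by rewrite coef0 eqxx.
  have := leq_trans (H R0) (size_evp sg v u r); rewrite ltnS => H'.
  by have := leq_ltn_trans H' rr; rewrite ltnn.
have [L' _ [z zg _]] := irredp_FAdjoin ig.
pose phi := in_alg L'; pose sg' : {rmorphism k -> L'} := phi \o sg.
have Hs c : sg' c = phi (sg c) by [].
have root_dvd (p : {poly L}) : g %| p -> (map_poly phi p).[z] = 0.
  by case/dvdpP => x ->; rewrite rmorphM hornerM (eqP zg) mulr0.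
have root_ndvd (p : {poly L}) : ~~ (g %| p) -> (map_poly phi p).[z] != 0.
  move=> nd; have cp : coprimep g p.
    rewrite coprimep_def; case: (eqVneq (size (gcdp g p)) 1%N) => // ne.
    have [_ /(_ _ ne (dvdp_gcdl g p)) /eqp_dvdl Eg] := ig.
    by move: nd; rewrite -Eg dvdp_gcdr.
  have := coprimep_map phi g p; rewrite cp => cp'.
  by apply: (coprimep_root cp').
right; exists L', sg', (fun w => if w == u then z else phi (v w)); split.
  move=> h; rewrite inE => /orP[/eqP ->|hD].
    split.
    - by apply: etrans (ev_upd v u z f Hs) _; apply: root_dvd.
    - by rewrite (ev_upd v u z (init f) Hs) (evp_free sg v iu) map_polyC hornerC fmorph_eq0.
    - by rewrite (ev_upd v u z (sep f) Hs) EF; apply: root_ndvd.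
  have Eh x : (forall w, w \in vars x -> w \in vars h) ->
      ev sg' (fun w => if w == u then z else phi (v w)) x = phi (ev sg v x).
    move=> xh; apply: (ev_comp Hs) => w wx; case: eqP => // Ew.
    by have := uD _ hD _ (xh _ wx); rewrite Ew dltxx.
  have [h1 h2 h3] := Hv _ hD; split.
  - by apply: etrans (Eh h (fun _ => id)) _; rewrite h1; apply: rmorph0.
  - by rewrite (Eh (init h) (@vars_init _ _ _ h)) fmorph_eq0.
  - by rewrite (Eh (sep h) (@vars_sep _ _ _ h)) fmorph_eq0.
by rewrite (ev_upd v u z a Hs); apply: root_ndvd.
Qed.

End Triangular.

(** * Radicality of saturated differential ideals *)

Section Saturation.
Context (n : nat) (k : fieldType) (d : k -> k) (le : rel (der n)).
Context (dP : derivation d) (ch : [pchar k] =i pred0) (leP : ranking le).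
Local Notation P := (dpoly k n).
Local Notation ld := (@ld n k le).
Local Notation init := (@init n k le).
Local Notation sep := (@sep n k le).
Local Notation lv := (@lv n k le).
Implicit Types (f g b a : P) (u v w : der n) (A F H S : {fset P}) (D : seq P) (I M : P -> Prop).

Lemma diff_ideal_is_ideal I : diff_ideal d I -> is_ideal I.
Proof. by case. Qed.

Lemma mult_gen1 S : mult_gen S 1.
Proof. by exists [::]; rewrite ?big_nil. Qed.

Lemma mult_genM S a b : mult_gen S a -> mult_gen S b -> mult_gen S (a * b).
Proof.
move=> [l ls ->] [l' ls' ->]; exists (l ++ l'); last by rewrite big_cat.
by move=> x; rewrite mem_cat => /orP[/ls|/ls'].
Qed.

Lemma mult_gen_mem S a : a \in S -> mult_gen S a.
Proof. by move=> aS; exists [:: a]; rewrite ?big_seq1 // => x; rewrite inE => /eqP ->. Qed.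

Lemma mult_gen_nzd I S s : (forall h, h \in S -> nzd I h) -> mult_gen S s -> nzd I s.
Proof.
move=> HS [l lS ->]; elim: l lS => [|x l IH] lS; first by rewrite big_nil; apply: nzd1.
rewrite big_cons; apply: nzdM; first by apply/HS/lS/mem_head.
by apply: IH => y yl; apply: lS; rewrite inE yl orbT.
Qed.

Lemma colon_diff_ideal I S : diff_ideal d I -> diff_ideal d (colon I S).
Proof.
move=> iI; have ii := diff_ideal_is_ideal iI; case: (iI) => I0 iD iM ID; split.
- by exists 1; [apply: mult_gen1|rewrite mulr0].
- move=> a b [s Ms Hs] [t Mt Ht]; exists (s * t); first exact: mult_genM.
  exact: (ideal_mul_add ii Hs Ht).
- move=> a b [s Ms Hs]; exists s; [exact: Ms|exact: (ideal_mulCA a ii Hs)].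
- move=> a [s Ms Hs]; exists (s * s); first exact: mult_genM.
  exact: (ideal_deriv_mult ii (deltaM dP) ID Hs).
Qed.

Lemma colon_nzd I S h : diff_ideal d I -> h \in S -> nzd (colon I S) h.
Proof.
move=> iI hS a [s Ms Hs]; exists (s * h); first exact: (mult_genM Ms (mult_gen_mem hS)).
exact: (ideal_assoc Hs).
Qed.

Lemma colon_sub I S a : I a -> colon I S a.
Proof. by move=> Ia; exists 1; [apply: mult_gen1|rewrite mul1r]. Qed.

Lemma colon_pow I S a e : diff_ideal d I -> colon I S (a ^+ e) ->
  exists2 s, mult_gen S s & I ((s * a) ^+ e.+1).
Proof.
move=> iI [s Ms Hs]; exists s; first exact: Ms.
exact: (ideal_pow_mult (diff_ideal_is_ideal iI) Hs).
Qed.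

Lemma diff_ideal_gen_ideal F : diff_ideal d (diff_ideal_gen d F).
Proof.
split=> [I [] //|a b Ha Hb I iI HI|a b Hb I iI HI|a Ha I iI HI].
- by case: (iI) => _ iD _ _; apply: (iD _ _ (Ha _ iI HI) (Hb _ iI HI)).
- by case: (iI) => _ _ iM _; apply: (iM _ _ (Hb _ iI HI)).
- by case: (iI) => _ _ _ ID; apply: (ID _ (Ha _ iI HI)).
Qed.

Lemma rad_diff_ideal_gen_ideal F : diff_ideal d (rad_diff_ideal_gen d F).
Proof.
split=> [I [] //|a b Ha Hb I iI rI HI|a b Hb I iI rI HI|a Ha I iI rI HI].
- by case: (iI) => _ iD _ _; apply: (iD _ _ (Ha _ iI rI HI) (Hb _ iI rI HI)).
- by case: (iI) => _ _ iM _; apply: (iM _ _ (Hb _ iI rI HI)).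
- by case: (iI) => _ _ _ ID; apply: (ID _ (Ha _ iI rI HI)).
Qed.

Lemma rad_diff_ideal_gen_radical F : radical (rad_diff_ideal_gen d F).
Proof. by move=> a e Ha I iI rI HI; apply: (rI _ e); apply: Ha. Qed.

Lemma colon_radical_of_radical I S : diff_ideal d I -> radical I -> radical (colon I S).
Proof. by move=> iI rI a e /(colon_pow iI) [s Ms /rI Hs]; exists s. Qed.

Definition sat F S a : Prop := forall I, diff_ideal d I -> radical I ->
  (forall f, f \in F -> I f) -> (forall h, h \in S -> nzd I h) -> I a.

(** For the converse, the saturation is itself one of the ideals over which [sat] quantifies. *)
Lemma sat_colon F S a : colon (rad_diff_ideal_gen d F) S a <-> sat F S a.
Proof.
split=> [[s Ms Hs] I iI rI HF HS|H].
  by apply: (mult_gen_nzd HS Ms); apply: Hs.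
have iR := rad_diff_ideal_gen_ideal F.
apply: H.
- exact: colon_diff_ideal.
- exact: (colon_radical_of_radical iR (@rad_diff_ideal_gen_radical F)).
- by move=> f fF; apply: colon_sub => I iI rI HI; apply: HI.
- by move=> h hS; apply: colon_nzd.
Qed.

Definition idgen D a : Prop := forall I, is_ideal I -> (forall f, f \in D -> I f) -> I a.

Lemma idgen_ideal D : is_ideal (idgen D).
Proof.
split=> [I [] //|a b Ha Hb I iI HI|a b Hb I iI HI].
- by case: (iI) => _ iD _; apply: (iD _ _ (Ha _ iI HI) (Hb _ iI HI)).
- by case: (iI) => _ _ iM; apply: (iM _ _ (Hb _ iI HI)).
Qed.

Lemma idgen_mono D D' a : {subset D <= D'} -> idgen D a -> idgen D' a.
Proof. by move=> sub Ha I iI HI; apply: Ha => // f /sub; apply: HI. Qed.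

Definition mgen D s : Prop := forall M, M 1 -> (forall a b, M a -> M b -> M (a * b)) ->
  (forall f, f \in D -> M (init f) /\ M (sep f)) -> M s.

Lemma kernel_ideal (L : fieldType) (phi : {rmorphism P -> L}) : is_ideal (fun x => phi x = 0).
Proof.
split; first exact: rmorph0.
- by move=> a b Ha Hb; rewrite rmorphD Ha Hb addr0.
- by move=> a b Hb; rewrite rmorphM Hb mulr0.
Qed.

(** If no multiplier brings [a] into the ideal, [triangular_hom] provides a zero of [D] where [a]
    does not vanish; but [a ^+ e] vanishes there. *)
Lemma triangular_radical D a e : triangular le D -> idgen D (a ^+ e) ->
  exists2 s, mgen D s & idgen D (s * a).
Proof.
move=> tD Ha.
have m1 : mgen D 1 by move=> M.
have mM x y : mgen D x -> mgen D y -> mgen D (x * y).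
  by move=> Hx Hy M M1 MM MD; exact: (MM _ _ (Hx _ M1 MM MD) (Hy _ M1 MM MD)).
have HD f : f \in D -> [/\ idgen D f, mgen D (init f) & mgen D (sep f)].
  by move=> fD; split=> [I _|M _ _|M _ _] /(_ _ fD) // [].
have [H|[L [sg [v [Hv a0]]]]] := triangular_hom ch leP a (idgen_ideal D) m1 mM tD HD.
  exact: H.
exfalso; have : ev sg v (a ^+ e) = 0.
  by apply: (Ha _ (kernel_ideal (ev sg v))) => f /Hv [].
by rewrite rmorphXn => /eqP; rewrite expf_eq0 (negbTE a0) andbF.
Qed.

Lemma triangular_sort S : (forall f, f \in S -> ~~ isconst f) ->
  (forall f g, f \in S -> g \in S -> ld f = ld g -> f = g) ->
  exists2 D, triangular le D & D =i S.
Proof.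
have [N] := ubnP #|` S|; elim: N S => [|N IH] S; first by rewrite ltn0.
rewrite ltnS => SN nc inj; have [S0|S0] := eqVneq S fset0.
  by exists [::] => // f; rewrite S0 in_fset0.
(* The order is reversed, so that the element found has the greatest leader; the clauses for
   constants only make the relation total. *)
have [||||f fS fmax] := @ex_least _ (fun f g => if ld f is Some u then
    if ld g is Some v then le v u else true else ~~ (ld g : bool)) (enum_fset S).
- by move=> f; case: (ld f) => // u; apply: dle_refl leP u.
- move=> g f h; case: (ld f) (ld g) (ld h) => [u|] [v|] [w|] //= ? ?; exact: (dle_trans leP) (v) _ _ _ _.
- move=> f g; case: (ld f) (ld g) => [u|] [v|] //=; exact: dle_total leP v u.
- by apply: contra S0 => /eqP E; apply/eqP/fsetP => x; rewrite -[x \in S]/(x \in enum_fset S) E.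
have [|||D tD DS] := IH (S `\ f).
- by apply: leq_trans SN; rewrite (cardfsD1 f S) fS.
- by move=> g; rewrite in_fsetD1 => /andP[_]; apply: nc.
- move=> g h; rewrite !in_fsetD1 => /andP[_ gS] /andP[_ hS]; exact: inj.
have [u Lu] := ld_ex leP (nc _ fS); exists (f :: D); last first.
  by move=> g; rewrite inE DS in_fsetD1; case: eqP => // ->; rewrite fS.
split=> //; exists u => // g; rewrite DS in_fsetD1 => /andP[gf gS] w wg.
have [v Lv] := ld_ex leP (nc _ gS); have := fmax g gS; rewrite Lu Lv => vu.
have [_ /(_ _ wg) wv] := (ldP leP g v).1 Lv; apply: dle_lt_trans wv _ => //.
by rewrite /dlt vu; apply: contraNneq gf => E; apply/eqP/inj => //; rewrite Lu Lv E.
Qed.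

Definition iterd j f := iter j (delta d) f.

Lemma iterdS j f : iterd j.+1 f = delta d (iterd j f).
Proof. by rewrite /iterd iterS. Qed.

Lemma ld_iterd j f u : ld f = Some u -> ld (iterd j f) = Some (dern j u).
Proof.
move=> L; elim: j => [|j IH]; first by rewrite dern0.
have [E _ _ _] := ld_delta dP ch leP IH.
by rewrite iterdS E dern_add addn1.
Qed.

Lemma init_sep_iterd j f u : ld f = Some u ->
  sep (iterd j f) = sep f /\ (init (iterd j f) = init f \/ init (iterd j f) = sep f).
Proof.
move=> L; elim: j => [|j [IH1 IH2]]; first by split; [|left].
have [_ _ E1 E2] := ld_delta dP ch leP (ld_iterd j L).
rewrite iterdS.
split.
  exact: (etrans E2 IH1).
right.
exact: (etrans E1 IH1).
Qed.

Definition prolong A N : {fset P} := [fset iterd j f | f in A, j in iota 0 N].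

Lemma prolongP A N f : reflect (exists g j, [/\ g \in A, (j < N)%N & f = iterd j g])
  (f \in prolong A N).
Proof.
apply: (iffP idP) => [/imfset2P [g /= gA [j]]|[g [j [gA jN ->]]]].
  by rewrite mem_iota /= add0n => jN ->; exists g, j.
by apply/imfset2P; exists g => //; exists j; rewrite ?inE ?mem_iota.
Qed.

(** The union of these algebraic ideals over [N] is a differential ideal, since differentiation maps
    level [N] into level [N.+1]. *)
Lemma diff_ideal_gen_prolong A a : diff_ideal_gen d A a ->
  exists N, idgen (enum_fset (prolong A N)) a.
Proof.
have mono N N' b : (N <= N')%N -> idgen (enum_fset (prolong A N)) b ->
    idgen (enum_fset (prolong A N')) b.
  move=> NN; apply: idgen_mono => f /prolongP [g [j [gA jN ->]]].
  by apply/prolongP; exists g, j; split=> //; apply: leq_trans NN.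
move=> Ha; apply: (Ha (fun x => exists N, idgen (enum_fset (prolong A N)) x)); last first.
  by move=> f fA; exists 1%N => I _; apply; apply/prolongP; exists f, 0%N.
split.
- by exists 0%N; have [] := idgen_ideal (enum_fset (prolong A 0)).
- move=> x y [N Hx] [N' Hy]; exists (maxn N N').
  have [_ iD _] := idgen_ideal (enum_fset (prolong A (maxn N N'))).
  by apply: iD; [apply: mono Hx|apply: mono Hy]; rewrite ?leq_maxl ?leq_maxr.
- move=> x y [N Hy]; exists N; have [_ _ iM] := idgen_ideal (enum_fset (prolong A N)).
  exact: iM.
move=> x [N Hx]; exists N.+1; set J := idgen _.
have iJ : is_ideal J := idgen_ideal _; have [J0 iD iM] := iJ.
(* Membership of [y] and of its derivative are proved together: the Leibniz rule for a multiple of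
   [y] needs both. *)
suff [] : J x /\ J (delta d x) by [].
apply: (Hx (fun y => J y /\ J (delta d y))); last first.
  move=> f /prolongP [g [j [gA jN ->]]]; split=> I _; apply; apply/prolongP.
    by exists g, j; split=> //; apply: ltnW.
  by exists g, j.+1; split; [exact: gA|exact: jN|rewrite iterdS].
split.
- by split; [exact: J0|rewrite (delta0 n dP); exact: J0].
- by move=> y z [Jy Jy'] [Jz Jz']; split; [exact: (iD _ _ Jy Jz)|rewrite (deltaD dP); exact: (iD _ _ Jy' Jz')].
move=> y z [Jz Jz']; split; first exact: (iM _ _ Jz).
rewrite (deltaM dP); apply: iD; [exact: (iM _ _ Jz)|exact: (iM _ _ Jz')].
Qed.

Lemma diff_ideal_prolong I A f N : diff_ideal d I -> (forall f, f \in A -> I f) ->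
  f \in prolong A N -> I f.
Proof.
move=> [_ _ _ ID] HA /prolongP [g [j [gA _ ->]]].
by elim: j => [|j IH]; [exact: HA|rewrite iterdS; exact: ID].
Qed.

(** The variable of a leader identifies the element of [A], and its order the number of
    differentiations. This is the place where a single derivation matters. *)
Lemma prolong_ld_inj A N : (forall f, f \in A -> ~~ isconst f) ->
  (forall f g, f \in A -> g \in A -> lv f = lv g -> f = g) ->
  forall f g, f \in prolong A N -> g \in prolong A N -> ld f = ld g -> f = g.
Proof.
move=> nc inj f f' /prolongP [g [j [gA _ ->]]] /prolongP [g' [j' [gA' _ ->]]].
have [u Lu] := ld_ex leP (nc _ gA); have [u' Lu'] := ld_ex leP (nc _ gA').
rewrite (ld_iterd j Lu) (ld_iterd j' Lu') => -[E1 E2].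
have E : g = g' by apply: inj => //; rewrite /lv Lu Lu' /= E1.
move: Lu'; rewrite -E Lu => -[Eu]; move: E2; rewrite Eu => /addnI ->.
by rewrite E.
Qed.

(** Membership in [[A]] involves finitely many derivatives of [A]. They form a triangular set whose
    initials and separants are those of [A], so the multiplier of [triangular_radical] lies in the
    multiplicative set of [H]. *)
Lemma colon_radical A H : (forall f, f \in A -> ~~ isconst f) ->
  (forall f g, f \in A -> g \in A -> lv f = lv g -> f = g) ->
  Hset le A `<=` H -> radical (colon (diff_ideal_gen d A) H).
Proof.
move=> nc inj /fsubsetP AH a e.
case/(colon_pow (diff_ideal_gen_ideal A)) => s Ms /diff_ideal_gen_prolong [N HN].
have pnc f : f \in prolong A N -> ~~ isconst f.
  case/prolongP => [g [j [gA _ ->]]]; have [u Lu] := ld_ex leP (nc _ gA).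
  exact: (ld_nconst leP (ld_iterd j Lu)).
have [D tD DP] := triangular_sort pnc (prolong_ld_inj nc inj).
have HD : idgen D ((s * a) ^+ e.+1) by apply: idgen_mono HN => f; rewrite DP.
have [t Mt Ht] := triangular_radical tD HD; exists (t * s).
  apply: mult_genM Ms; apply: Mt; [exact: mult_gen1|exact: mult_genM|].
  move=> f; rewrite DP => /prolongP [g [j [gA _ ->]]].
  have [u Lu] := ld_ex leP (nc _ gA); have [-> Ei] := init_sep_iterd j Lu.
  have gi : mult_gen H (init g).
    by apply/mult_gen_mem/AH; rewrite in_fsetU; apply/orP; left; apply/imfsetP; exists g.
  have gs : mult_gen H (sep g).
    by apply/mult_gen_mem/AH; rewrite in_fsetU; apply/orP; right; apply/imfsetP; exists g.
  by split; [case: Ei => ->|].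
apply: (ideal_assoc (I := diff_ideal_gen d A)); apply: (Ht _ (diff_ideal_is_ideal (diff_ideal_gen_ideal A))) => f.
rewrite DP; apply: diff_ideal_prolong; first exact: diff_ideal_gen_ideal.
by move=> g gA I iI; apply.
Qed.

Lemma sat_regular A H a : (forall f, f \in A -> ~~ isconst f) ->
  (forall f g, f \in A -> g \in A -> lv f = lv g -> f = g) ->
  Hset le A `<=` H -> (sat A H a <-> colon (diff_ideal_gen d A) H a).
Proof.
move=> nc inj AH; split=> [Hs|[s Ms Hs] I iI rI HA HH].
  have iA := diff_ideal_gen_ideal A; apply: Hs.
  - exact: colon_diff_ideal.
  - exact: colon_radical.
  - by move=> f fA; apply: colon_sub => I iI; apply.
  - by move=> h hH; apply: colon_nzd.
by apply: (mult_gen_nzd HH Ms); apply: Hs.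
Qed.

End Saturation.

(** * Differentiate&Autoreduce *)

Section DiffAutoreduce.
Context (n : nat) (k : fieldType) (d : k -> k) (le : rel (der n)).
Context (dP : derivation d) (ch : [pchar k] =i pred0) (leP : ranking le).
Local Notation P := (dpoly k n).
Local Notation ld := (@ld n k le).
Local Notation rk := (@rk n k le).
Local Notation lv := (@lv n k le).
Local Notation minrk := (@minrk n k le).
Local Notation maxrk := (@maxrk n k le).
Implicit Types (f g b c : P) (u v w : der n) (B C D S : {fset P}) (I : P -> Prop) (m : 'I_n -> nat).

Lemma lvE f u : ld f = Some u -> lv f = Some u.1.
Proof. by rewrite /lv => ->. Qed.

Lemma ld_lv f i : lv f = Some i -> exists j, ld f = Some (i, j).
Proof. by rewrite /lv; case: (ld f) => //= -[a j] [<-]; exists j. Qed.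

Lemma rk_le_ld f g u w : ld f = Some u -> ld g = Some w -> rk_le le (rk f) (rk g) -> le u w.
Proof.
move=> Lf Lg; rewrite (rkE Lf) (rkE Lg) /=; case: eqP => [-> _|//].
exact: dle_refl leP w.
Qed.

Lemma minrkP B b : reflect (b \in B /\ forall g, g \in B -> lv g = lv b -> rk_le le (rk b) (rk g))
  (b \in minrk B).
Proof.
rewrite !inE /=; apply: (iffP andP) => [[bB /forallP H]|[bB H]]; split=> //.
  by move=> g gB E; have := H [` gB]; rewrite /= E eqxx.
by apply/forallP => g; apply/implyP => /eqP; apply: H; apply: valP.
Qed.

Lemma maxrkP B b : reflect (b \in B /\ forall g, g \in B -> lv g = lv b -> rk_le le (rk g) (rk b))
  (b \in maxrk B).
Proof.
rewrite !inE /=; apply: (iffP andP) => [[bB /forallP H]|[bB H]]; split=> //.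
  by move=> g gB E; have := H [` gB]; rewrite /= E eqxx.
by apply/forallP => g; apply/implyP => /eqP; apply: H; apply: valP.
Qed.

Lemma deltasP B f : reflect (exists2 b, b \in B & f = delta d b) (f \in deltas d B).
Proof. exact: imfsetP. Qed.

Lemma ordv_le (i : 'I_n) f e : (forall v, v \in vars f -> v.1 = i -> (v.2 <= e)%N) -> (ordv i f <= e)%N.
Proof. by move=> H; apply/bigmax_leqP_seq => v vf /eqP; apply: H. Qed.

Lemma ordv_ge f v : v \in vars f -> (v.2 <= ordv v.1 f)%N.
Proof.
move=> vf; rewrite /ordv.
exact: (@leq_bigmax_seq _ _ (fun u : der n => u.1 == v.1) (fun u : der n => u.2) v vf (eqxx _)).
Qed.

Lemma ordv_ld f u : ld f = Some u -> ordv u.1 f = u.2.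
Proof.
move=> /(ldP leP) [uf umax]; apply/eqP; rewrite eqn_leq ordv_ge // andbT.
by apply: ordv_le => v vf E; rewrite -(dle_same leP) // umax.
Qed.

Lemma workP m D B f : (forall b, b \in B -> ~~ isconst b) ->
  f \in da_work d le m D B <-> f \in D \/ exists b u,
    [/\ b \in maxrk B, f = delta d b, ld b = Some u & (u.2 < m u.1)%N].
Proof.
move=> nc; rewrite /da_work in_fsetU; split.
  case/orP => [fD|]; [by left|rewrite !inE /= => /andP [/deltasP [b bB ->]]].
  have [u Lu] := ld_ex leP (nc _ (proj1 (maxrkP _ _ bB))).
  have [Ld _ _ _] := ld_delta dP ch leP Lu.
  rewrite (lvE Ld) (ordv_ld Ld) /= addn1 => H; right; exists b, u; split=> //.
case=> [->//|[b [u [bB -> Lu H]]]]; apply/orP; right; rewrite !inE /=; apply/andP; split.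
  by apply/deltasP; exists b.
have [Ld _ _ _] := ld_delta dP ch leP Lu.
by rewrite (lvE Ld) (ordv_ld Ld) /= addn1.
Qed.

(* [inv_chain]: the leaders in B with a given leading variable are consecutive
   derivatives.  [inv_free]: in the variables that lead no element of C, the
   order grows by at most one with each differentiation, which adds an element
   to B. *)
Record da_inv C m D B : Prop := DaInv {
  inv_sub : D `<=` C;
  inv_mem : forall b, b \in B -> exists u c w, [/\ ld b = Some u, c \in C, c \notin D,
    ld c = Some w & u.1 = w.1 /\ ((w.2 < u.2)%N -> degv u b = 1%N)];
  inv_ld_inj : forall b b', b \in B -> b' \in B -> ld b = ld b' -> b = b';
  inv_chain : forall c w, c \in C -> c \notin D -> ld c = Some w ->
    exists e, (w.2 <= e <= m w.1)%N /\
      forall j, (exists2 b, b \in B & ld b = Some (w.1, j)) <-> (w.2 <= j <= e)%N;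
  inv_vars : forall b v c w, b \in B -> v \in vars b -> c \in C -> ld c = Some w ->
    w.1 = v.1 -> ld b <> Some v -> (v.2 <= w.2)%N;
  inv_red : forall b b', b \in B -> b' \in B -> b != b' -> alg_reduced le b b';
  inv_ord : forall b f u w, b \in B -> f \in D -> ld b = Some u -> ld f = Some w -> le u w;
  inv_free : forall b v, b \in B -> v \in vars b -> (forall c, c \in C -> lv c <> Some v.1) ->
    (v.2 + #|` C| <= m v.1 + #|` B| + #|` D|)%N;
  inv_rk : forall b c, b \in B -> c \in C -> ld b = ld c -> rk b = rk c;
  inv_card : (#|` C| <= #|` B| + #|` D|)%N
}.

Record da_input C m : Prop := DaInput {
  input_nc : forall f, f \in C -> ~~ isconst f;
  input_lv : forall f g, f \in C -> g \in C -> lv f = lv g -> f = g;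
  input_ord : forall f v, f \in C -> v \in vars f -> (v.2 <= m v.1)%N
}.

Lemma da_inv0 C m : da_input C m -> da_inv C m C fset0.
Proof.
move=> inp; split=> //.
by move=> c w cC; rewrite cC.
Qed.

Section Step.
Context (C : {fset P}) (m : 'I_n -> nat) (inp : da_input C m).

(** The leaders in this variable are distinct and fill an interval of orders starting at [w.2], so
    minimal rank amounts to leader [w]; [chain_max] is the same at the other end. *)
Lemma chain_min D B c w b : da_inv C m D B -> c \in C -> c \notin D -> ld c = Some w ->
  b \in B -> lv b = Some w.1 -> (b \in minrk B) = (ld b == Some w).
Proof.
move=> inv cC cD Lc bB lb; have [e [/andP[we em] ch']] := inv_chain inv cC cD Lc.
have [j Lb] := ld_lv lb; have [/(_ (ex_intro2 _ _ b bB Lb)) /andP[wj je] _] := ch' j.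
have [_ /(_ _)] := ch' w.2; rewrite leqnn we => /(_ isT) [b1 b1B].
rewrite -surjective_pairing => L1.
apply/minrkP/eqP => [[_ H]|E].
  have := rk_le_ld Lb L1 (H _ b1B _); rewrite (lvE L1) lb => /(_ erefl).
  rewrite dle_same //= => jw; rewrite Lb; congr Some; case: w {Lc ch' L1 we em lb H} wj jw Lb => a x /= wj jw _.
  by congr pair; apply/eqP; rewrite eqn_leq wj jw.
split=> // g gB; rewrite lb => lg; have [j' Lg] := ld_lv lg.
have [/(_ (ex_intro2 _ _ g gB Lg)) /andP[wj' _] _] := ch' j'.
have [E'|ne] := eqVneq (ld b) (ld g).
  by rewrite (inv_ld_inj inv bB gB E') rk_le_refl.
rewrite (rkE Lg) (rkE E) /=; case: eqP => [Ew|_].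
  by case/eqP: ne; rewrite E Lg Ew.
by rewrite dle_same.
Qed.

Lemma chain_max D B c w e b : da_inv C m D B -> c \in C -> c \notin D -> ld c = Some w ->
  (w.2 <= e)%N ->
  (forall j, (exists2 b, b \in B & ld b = Some (w.1, j)) <-> (w.2 <= j <= e)%N) ->
  b \in B -> lv b = Some w.1 -> (b \in maxrk B) = (ld b == Some (w.1, e)).
Proof.
move=> inv cC cD Lc we ch' bB lb.
have [j Lb] := ld_lv lb; have [/(_ (ex_intro2 _ _ b bB Lb)) /andP[wj je] _] := ch' j.
have [_ /(_ _)] := ch' e; rewrite leqnn we => /(_ isT) [b1 b1B L1].
apply/maxrkP/eqP => [[_ H]|E].
  have := rk_le_ld L1 Lb (H _ b1B _); rewrite (lvE L1) lb => /(_ erefl).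
  rewrite dle_same //= => ej; rewrite Lb; congr (Some (_, _)).
  by apply/eqP; rewrite eqn_leq je.
split=> // g gB; rewrite lb => lg; have [j' Lg] := ld_lv lg.
have [/(_ (ex_intro2 _ _ g gB Lg)) /andP[_ je'] _] := ch' j'.
have [E'|ne] := eqVneq (ld b) (ld g).
  by rewrite (inv_ld_inj inv bB gB E') rk_le_refl.
rewrite (rkE Lg) (rkE E) /=; case: eqP => [Ew|_].
  by case/eqP: ne; rewrite E Lg Ew.
by rewrite dle_same.
Qed.

(** In the second case [f] prolongs the chain of [c] from order [e] to [e.+1], still within the
    bound. *)
Variant step_case D B f u : Prop :=
| CaseInput of f \in D & da_divisors d le D B f = B
| CaseDelta b0 u0 c w e of f \notin D & b0 \in maxrk B & f = delta d b0 & ld b0 = Some u0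
    & u = dern 1 u0 & (e < m w.1)%N & c \in C & c \notin D & ld c = Some w
    & u0 = (w.1, e) & (w.2 <= e)%N
    & (forall j, (exists2 b, b \in B & ld b = Some (w.1, j)) <-> (w.2 <= j <= e)%N).

Lemma inv_nc D B b : da_inv C m D B -> b \in B -> ~~ isconst b.
Proof. by move=> inv /(inv_mem inv) [u [c [w [Lb _ _ _ _]]]]; apply: ld_nconst Lb. Qed.

Lemma step_caseP D B f : da_inv C m D B -> f \in da_work d le m D B ->
  exists2 u, ld f = Some u & step_case D B f u.
Proof.
move=> inv /(workP _ _ _ (fun b => inv_nc inv)); case: (boolP (f \in D)) => [fD _|fD [//|]].
  have [u Lu] := ld_ex leP (input_nc inp (fsubsetP (inv_sub inv) _ fD)).
  by exists u => //; apply: CaseInput => //; rewrite /da_divisors fD.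
case=> [b0 [u0 [bB Ef Lb um]]]; have [b0B _] := maxrkP _ _ bB.
have [Ld _ _ _] := ld_delta dP ch leP Lb; exists (dern 1 u0); first by rewrite Ef.
have [u1 [c [w [Lb' cC cD Lc [E1 _]]]]] := inv_mem inv b0B.
move: Lb'; rewrite Lb => -[E]; subst u1.
have [e [/andP[we em] Ch]] := inv_chain inv cC cD Lc.
have lb : lv b0 = Some w.1 by rewrite (lvE Lb) E1.
have := chain_max inv cC cD Lc we Ch b0B lb; rewrite bB Lb => /esym /eqP [E].
apply: (CaseDelta (e := e) fD bB Ef Lb erefl _ cC cD Lc E we Ch).
by move: um; rewrite E.
Qed.

Lemma divisorsP D B f s : s \in da_divisors d le D B f ->
  s \in B \/ [/\ f \notin D, s != f & exists2 b, b \in minrk B & s = delta d b].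
Proof.
rewrite /da_divisors; case: ifP => fD; first by left.
rewrite in_fsetU in_fsetD1 => /orP[|/andP[sf /deltasP H]]; [by left|right].
by split=> //.
Qed.

Lemma divisors_sub D B f s : s \in B -> s \in da_divisors d le D B f.
Proof. by rewrite /da_divisors; case: ifP => // _ sB; rewrite in_fsetU sB. Qed.

Lemma divisors_delta D B f b : f \notin D -> b \in minrk B -> delta d b != f ->
  delta d b \in da_divisors d le D B f.
Proof.
move=> fD bB ne; rewrite /da_divisors (negbTE fD) in_fsetU in_fsetD1 ne.
by apply/orP; right; apply/deltasP; exists b.
Qed.

(** Thus [f] is never divided in its own leader, which is the hypothesis of [crt_top] and
    [crt_ideal_top]. An input opens a new leading variable; the leader of a derivative lies just
    beyond its chain, and among the differentiated minima only [f] itself could have it, which is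
    excluded. *)
Lemma step_leader D B f u s w : da_inv C m D B -> ld f = Some u -> step_case D B f u ->
  s \in da_divisors d le D B f -> ld s = Some w -> w != u.
Proof.
move=> inv Lf cs sS Ls; apply/eqP => E; subst w.
case: cs => [fD ES|b0 u0 c w e fD bM Ef Lb0 Eu em cC cD Lc Eu0 we Ch].
  rewrite ES in sS; have [u1 [c [w [Ls' cC cD Lc [E1 _]]]]] := inv_mem inv sS.
  move: Ls'; rewrite Ls => -[E]; subst u1.
  have E2 : c = f.
    apply: (input_lv inp cC (fsubsetP (inv_sub inv) _ fD)).
    by rewrite (lvE Lc) (lvE Lf) E1.
  by move: cD; rewrite E2 fD.
case: (divisorsP sS) => [sB|[_ sf [b bM' Es]]].
  have [/(_ (ex_intro2 _ _ s sB _)) H _] := Ch e.+1.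
  by have := H; rewrite Ls Eu Eu0 /dern /= addn1 ltnn andbF => /(_ erefl).
have [bB _] := minrkP _ _ bM'; have [b0B _] := maxrkP _ _ bM.
have [u1 Lb] := ld_ex leP (inv_nc inv bB).
have [Ld _ _ _] := ld_delta dP ch leP Lb.
have /(congr1 (odflt u)) /= E2 : Some (dern 1 u1) = Some (dern 1 u0) by rewrite -Ld -Es Ls Eu.
case/eqP: sf; rewrite Es Ef; congr (delta d _); apply: (inv_ld_inj inv bB b0B).
by rewrite Lb Lb0 (dern_inj E2).
Qed.

(** Suppose [v], above [w] in the same variable, occurs in [g] without being its leader. It leads no
    element of [B], because such an element would be linear in [v] and [g] is reduced; so [v] lies
    beyond the end [e] of the chain and occurs nowhere in [B]. Trace [v] back through the reduction.
    If it occurs in an input [f], the next derivative of the chain is within the bound and has lower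
    rank than [f], against the choice of [f]. Otherwise it arose by differentiating an occurrence of
    [w]. *)
Lemma step_keep_vars D B f g u : da_inv C m D B -> least le (da_work d le m D B) f ->
  ld f = Some u -> step_case D B f u -> algrem le (da_divisors d le D B f) f g -> rk g = rk f ->
  forall v c w, v \in vars g -> c \in C -> ld c = Some w -> w.1 = v.1 -> v <> u ->
  (v.2 <= w.2)%N.
Proof.
move=> inv [fW fmin] Lf cs [gS gred] rkg v c w vg cC Lc E1 vu.
rewrite leqNgt; apply/negP => wv.
have Lg : ld g = Some u by rewrite (rk_ld rkg).
have [_ gmax] := (ldP leP g u).1 Lg.
have vltu : dlt le v u by rewrite /dlt gmax //; apply/eqP.
have wltv : dlt le w v by rewrite dlt_same.
have min_le f' u' : f' \in da_work d le m D B -> ld f' = Some u' -> le u u'.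
  by move=> f'W Lf'; exact: (rk_le_ld Lf Lf' (fmin _ f'W)).
have cD : c \notin D.
  apply/negP => cD; have := min_le c w; rewrite /da_work in_fsetU cD => /(_ isT Lc).
  by rewrite (dleNlt leP) (dlt_trans leP wltv vltu).
have [e [/andP[we em] Ch]] := inv_chain inv cC cD Lc.
have Ev : v = (w.1, v.2) by rewrite E1; case: (v).
have nolead b : b \in B -> ld b = Some v -> False.
  move=> bB Lb; have [u1 [c1 [w1 [Lb' cC1 cD1 Lc1 [E2 deg1]]]]] := inv_mem inv bB.
  move: Lb'; rewrite Lb => -[E]; subst u1.
  have Ec : c1 = c by apply: (input_lv inp cC1 cC); rewrite (lvE Lc1) (lvE Lc) E1 E2.
  subst c1; move: Lc1; rewrite Lc => -[E]; subst w1.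
  have := gred b (divisors_sub _ _ bB); rewrite (alg_reducedE _ Lb) (deg1 wv).
  by rewrite ltnNge degv_gt0 vg.
have ve : (e < v.2)%N.
  rewrite ltnNge; apply/negP => ve; have [_ H] := Ch v.2.
  have [|b bB] := H _; first by rewrite ve (ltnW wv).
  by rewrite -Ev; apply: nolead.
have varsB b : b \in B -> v \notin vars b.
  move=> bB; apply/negP => vb.
  case: (eqVneq (ld b) (Some v)) => [/nolead H|/eqP nl]; first exact: H.
  by have := inv_vars inv bB vb cC Lc E1 nl; rewrite leqNgt wv.
(* Here the chain consists of its bottom element alone, whose derivative is among the divisors and
   is linear with leader [v]; so [v] cannot survive in [g]. This is the use of the divisors
   [deltas (minrk B)]. *)
have succ : v.2 = w.2.+1 -> f \notin D -> False.
  move=> Ew fD; have ew : e = w.2 by move: ve; rewrite Ew ltnS => ?; apply/eqP; rewrite eqn_leq we andbT.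
  have [_ H] := Ch w.2; have [|b bB] := H _; first by rewrite leqnn we.
  rewrite -surjective_pairing => Lb.
  have bM : b \in minrk B by rewrite (chain_min inv cC cD Lc bB) ?Lb ?(lvE Lb).
  have [Ld deg1 _ _] := ld_delta dP ch leP Lb.
  have Ewv : dern 1 w = v by rewrite Ev Ew /dern addn1.
  rewrite Ewv in Ld deg1.
  have ne : delta d b != f by apply/eqP => E; move: Ld; rewrite E Lf => -[] /esym.
  have := gred _ (divisors_delta fD bM ne); rewrite (alg_reducedE _ Ld) deg1.
  by rewrite ltnNge degv_gt0 vg.
case: (crt_vars gS vg) => [vf|[s sS vs]]; last first.
  case: (divisorsP sS) => [sB|[fD sf [b bM Es]]]; first by have := varsB _ sB; rewrite vs.
  have [bB _] := minrkP _ _ bM; rewrite Es in vs.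
  case: (vars_delta dP vs) => [vb|[v' vb Ev']]; first by have := varsB _ bB; rewrite vb.
  have E1' : w.1 = v'.1 by rewrite E1 Ev'.
  apply: succ fD; rewrite Ev' /= addn1; congr S; apply/eqP.
  have le1 : (w.2 <= v'.2)%N by move: wv; rewrite Ev' /= addn1 ltnS.
  rewrite eqn_leq le1 andbT.
  case: (eqVneq (ld b) (Some v')) => [Lb|/eqP nl]; last exact: (inv_vars inv bB vb cC Lc E1' nl).
  have := chain_min inv cC cD Lc bB; rewrite (lvE Lb) -E1' bM Lb => /(_ erefl) /esym /eqP [->].
  exact: leqnn.
case: cs => [fD ES|b0 u0 c1 w1 e1 fD bM Ef Lb0 Eu em1 cC1 cD1 Lc1 Eu0 we1 Ch1].
  have vm := input_ord inp (fsubsetP (inv_sub inv) _ fD) vf.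
  have [_ H] := Ch e; have [|b bB Lb] := H _; first by rewrite leqnn we.
  have bM : b \in maxrk B by rewrite (chain_max inv cC cD Lc we Ch bB) ?Lb ?(lvE Lb).
  have [Ld _ _ _] := ld_delta dP ch leP Lb.
  have bW : delta d b \in da_work d le m D B.
    apply/(workP _ _ _ (fun b => inv_nc inv)); right; exists b, (w.1, e); split=> //=.
    by rewrite E1; apply: leq_trans ve vm.
  have := min_le _ _ bW Ld; rewrite (dleNlt leP) => /negP; apply.
  apply: dle_lt_trans vltu => //; rewrite Ev dle_same //= addn1; exact: ve.
have [b0B _] := maxrkP _ _ bM; rewrite Ef in vf.
case: (vars_delta dP vf) => [vb|[v' vb Ev']]; first by have := varsB _ b0B; rewrite vb.
have E1' : w.1 = v'.1 by rewrite E1 Ev'.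
apply: succ fD; rewrite Ev' /= addn1; congr S; apply/eqP.
have le1 : (w.2 <= v'.2)%N by move: wv; rewrite Ev' /= addn1 ltnS.
rewrite eqn_leq le1 andbT; apply: (inv_vars inv b0B vb cC Lc E1').
by rewrite Lb0 => -[E]; apply: vu; rewrite Ev' Eu E.
Qed.

End Step.
End DiffAutoreduce.

Section DiffAutoreduceStep.
Context (n : nat) (k : fieldType) (d : k -> k) (le : rel (der n)).
Context (dP : derivation d) (ch : [pchar k] =i pred0) (leP : ranking le).
Local Notation P := (dpoly k n).
Local Notation ld := (@ld n k le).
Local Notation rk := (@rk n k le).
Local Notation lv := (@lv n k le).
Implicit Types (f g b c : P) (u v w : der n) (B C D S : {fset P}) (I : P -> Prop) (m : 'I_n -> nat).

Context (C : {fset P}) (m : 'I_n -> nat) (inp : da_input le C m).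

Section OneStep.
Context (D B : {fset P}) (f g : P) (u : der n).
Context (inv : da_inv le C m D B) (lst : least le (da_work d le m D B) f).
Context (Lf : ld f = Some u) (cs : step_case d le C m D B f u).
Context (rem : algrem le (da_divisors d le D B f) f g) (rkg : rk g = rk f).

Lemma step_ld : ld g = Some u. Proof. by rewrite (rk_ld rkg). Qed.

Lemma step_new b : b \in B -> ld b <> Some u.
Proof.
move=> bB Lb; have := step_leader dP ch leP inp inv Lf cs (divisors_sub _ _ _ _ bB) Lb.
by rewrite eqxx.
Qed.

Lemma step_notin : g \notin B.
Proof. by apply/negP => /step_new; apply; apply: step_ld. Qed.

Lemma step_leads x : (exists2 b, b \in g |` B & ld b = Some x) <->
  x = u \/ exists2 b, b \in B & ld b = Some x.
Proof.
split=> [[b]|[->|[b bB Lb]]].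
- rewrite in_fset1U => /orP[/eqP -> |bB Lb]; last by right; exists b.
  by rewrite step_ld => -[]; left.
- by exists g; [rewrite in_fset1U eqxx|apply: step_ld].
- by exists b => //; rewrite in_fset1U bB orbT.
Qed.

(** An input opens the chain of its leading variable, a derivative lengthens its chain by one, and
    all other chains are untouched. *)
Lemma step_inv_chain c w : c \in C -> c \notin D `\ f -> ld c = Some w ->
  exists e, (w.2 <= e <= m w.1)%N /\
    forall j, (exists2 b, b \in g |` B & ld b = Some (w.1, j)) <-> (w.2 <= j <= e)%N.
Proof.
move=> cC; rewrite in_fsetD1 negb_and negbK => H Lc.
have other c' w' : c' \in C -> ld c' = Some w' -> u.1 = w'.1 -> c' != c -> c \notin D ->
  exists e, (w.2 <= e <= m w.1)%N /\
    forall j, (exists2 b, b \in g |` B & ld b = Some (w.1, j)) <-> (w.2 <= j <= e)%N.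
  move=> cC' Lc' E' ne cD; have [e [em Ch]] := inv_chain inv cC cD Lc.
  exists e; split=> // j; rewrite -Ch step_leads; split=> [[E|//]|]; last by right.
  case/eqP: ne; apply: (input_lv inp cC' cC).
  by rewrite (lvE Lc') (lvE Lc) -E' -E.
case: cs => [fD _|b0 u0 c0 w0 e fD bM Ef Lb0 Eu em cC0 cD0 Lc0 Eu0 we Ch].
  have fC := fsubsetP (inv_sub inv) _ fD.
  have [cf|cf] := eqVneq c f; last first.
    by apply: (other f u) => //; [rewrite eq_sym|move: H; rewrite (negbTE cf)].
  move: Lc; rewrite cf Lf => -[E]; subst w; exists u.2.
  rewrite leqnn (input_ord inp fC) ?(proj1 ((ldP leP f u).1 Lf)) //; split=> // j.
  rewrite step_leads; split=> [[E|[b bB Lb]]|].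
  - by rewrite -[j]/((u.1, j).2) E leqnn.
  - have [u1 [c1 [w1 [Lb' cC1 cD1 Lc1 [E1 _]]]]] := inv_mem inv bB.
    move: Lb'; rewrite Lb => -[E]; subst u1.
    have Ec : c1 = f by apply: (input_lv inp cC1 fC); rewrite (lvE Lc1) (lvE Lf) -E1.
    by move: cD1; rewrite Ec fD.
  - by move=> /anti_leq <-; left; case: (u).
have cD : c \notin D.
  by case/orP: H => // /eqP E; rewrite E.
have Eu1 : u.1 = w0.1 by rewrite Eu Eu0.
have [E|ne] := eqVneq c0 c; last exact: (other c0 w0).
subst c0; move: Lc0; rewrite Lc => -[E]; subst w0.
exists e.+1; rewrite em (leq_trans we) //; split=> // j; rewrite step_leads Ch Eu Eu0 /dern /= addn1.
split=> [[[->]|/andP[-> /leqW]]|/andP[wj]] //; first by rewrite leqnn (leq_trans we).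
by rewrite leq_eqVlt => /orP[/eqP ->|]; [left|rewrite ltnS wj => ->; right].
Qed.

(** Keeps the old elements of [B] reduced with respect to [g]. For an input this holds because
    inputs and derivatives are processed by increasing rank ([inv_ord]), for a derivative because of
    [inv_vars]. *)
Lemma step_not_var b : b \in B -> u \notin vars b.
Proof.
move=> bB; apply/negP => ub; have nl := step_new bB.
case: cs => [fD _|b0 u0 c0 w0 e fD bM Ef Lb0 Eu em cC0 cD0 Lc0 Eu0 we Ch].
  have [u1 [c1 [w1 [Lb cC1 cD1 Lc1 _]]]] := inv_mem inv bB.
  have le1 := inv_ord inv bB fD Lb Lf; have [_ /(_ _ ub) le2] := (ldP leP b u1).1 Lb.
  by apply: nl; rewrite Lb; congr Some; apply: (dle_anti leP); rewrite le1 le2.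
have Eu1 : w0.1 = u.1 by rewrite Eu Eu0.
have := inv_vars inv bB ub cC0 Lc0 Eu1 nl.
by rewrite Eu Eu0 /= addn1 leqNgt ltnS we.
Qed.

Lemma step_card : #|` g |` B| = #|` B|.+1 /\
  (#|` D| <= #|` D `\ f|.+1)%N /\ (f \notin D -> #|` D `\ f| = #|` D|).
Proof.
rewrite cardfsU1 step_notin add1n; split=> //; split.
  by rewrite (cardfsD1 f D); case: (f \in D) => /=; lia.
by move=> fD; rewrite (cardfsD1 f D) (negbTE fD).
Qed.

(** The number [#|B| + #|D| - #|C|] counts the differentiations made so far: an input leaves it
    unchanged, a derivative raises it by one together with the order. *)
Lemma step_inv_free v : v \in vars g -> (forall c, c \in C -> lv c <> Some v.1) ->
  (v.2 + #|` C| <= m v.1 + #|` B|.+1 + #|` D `\ f|)%N.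
Proof.
move=> vg nv; have [_ [c1 c2]] := step_card; have cc := inv_card inv.
have oldB b : b \in B -> v \in vars b -> (v.2 + #|` C| <= m v.1 + #|` B| + #|` D|)%N.
  by move=> bB vb; apply: (inv_free inv bB vb).
have dB b : b \in B -> f \notin D -> v \in vars (delta d b) ->
    (v.2 + #|` C| <= m v.1 + #|` B|.+1 + #|` D `\ f|)%N.
  move=> bB /c2 E vb; case: (vars_delta dP vb) => [vb'|[v' vb' Ev]].
    by have := oldB _ bB vb'; lia.
  have E1 : v.1 = v'.1 by rewrite Ev.
  have E2 : v.2 = v'.2.+1 by rewrite Ev /= addn1.
  have := inv_free inv bB vb'; rewrite -E1 => /(_ nv) H.
  by rewrite E2 E addSn addnS addSn ltnS.
case: (crt_vars (proj1 rem) vg) => [vf|[s sS vs]].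
  case: cs => [fD _|b0 u0 c0 w0 e fD bM Ef Lb0 Eu em cC0 cD0 Lc0 Eu0 we Ch].
    by have := input_ord inp (fsubsetP (inv_sub inv) _ fD) vf; lia.
  have [b0B _] := maxrkP _ _ _ bM; apply: (dB b0) => //; by rewrite -Ef.
case: (divisorsP sS) => [sB|[fD _ [b bM Es]]].
  by have := oldB _ sB vs; lia.
have [bB _] := minrkP _ _ _ bM; apply: (dB b) => //; by rewrite -Es.
Qed.

Lemma inv_step : da_inv le C m (D `\ f) (g |` B).
Proof.
have gred := rem.2; have [cB [c1 c2]] := step_card.
have subD : D `\ f `<=` D by apply: fsubD1set.
have notD c : c \notin D -> c \notin D `\ f by apply: contra; apply: (fsubsetP subD).
have ld_new b : b \in B -> ld b = ld g -> False by move=> bB; rewrite step_ld; apply: step_new.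
split.
- exact: fsubset_trans subD (inv_sub inv).
- move=> b; rewrite in_fset1U => /orP[/eqP ->|bB]; last first.
    have [u1 [c [w [Lb cC cD Lc H]]]] := inv_mem inv bB.
    by exists u1, c, w; split=> //; apply: notD.
  case: cs => [fD _|b0 u0 c w e fD bM Ef Lb0 Eu em cC cD Lc Eu0 we Ch].
    exists u, f, u; split=> //; [exact: step_ld|exact: (fsubsetP (inv_sub inv))|
      by rewrite in_fsetD1 eqxx|by rewrite ltnn].
  exists u, c, w; split=> //; [exact: step_ld|exact: notD|split; first by rewrite Eu Eu0].
  have [_ deg1 _ _] := ld_delta dP ch leP Lb0.
  by rewrite (rk_degv rkg Lf) Ef Eu deg1.
- move=> b b'; rewrite !in_fset1U => /orP[/eqP ->|bB] /orP[/eqP ->|bB'] //.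
  + by move/esym => /ld_new []; apply: bB'.
  + by move=> /ld_new [].
  + exact: (inv_ld_inj inv).
- exact: step_inv_chain.
- move=> b v c w; rewrite in_fset1U => /orP[/eqP ->|bB] vb cC Lc E nl; last first.
    exact: (inv_vars inv bB vb cC Lc E nl).
  apply: (step_keep_vars dP ch leP inp inv lst Lf cs rem rkg vb cC Lc E) => Ev.
  by apply: nl; rewrite Ev step_ld.
- move=> b b'; rewrite !in_fset1U => /orP[/eqP ->|bB] /orP[/eqP ->|bB'].
  + by rewrite eqxx.
  + by move=> _; apply: gred; apply: divisors_sub.
  + move=> _; rewrite (alg_reducedE _ step_ld) (degv_free (step_not_var bB)).
    exact: (ld_degv leP step_ld).
  + exact: (inv_red inv bB bB').
- move=> b f' u' w; rewrite in_fset1U in_fsetD1 => /orP[/eqP ->|bB] /andP[_ fD'] L1 L2.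
    move: L1; rewrite step_ld => -[<-]; case: lst => _ /(_ f') H.
    by apply: (rk_le_ld leP Lf L2); apply: H; rewrite /da_work in_fsetU fD'.
  exact: (inv_ord inv bB fD' L1 L2).
- move=> b v; rewrite in_fset1U cB => /orP[/eqP ->|bB] vb nv; first exact: step_inv_free.
  by have := inv_free inv bB vb nv; lia.
- move=> b c; rewrite in_fset1U => /orP[/eqP ->|bB] cC; last exact: (inv_rk inv).
  rewrite step_ld rkg => /esym Lc.
  case: cs => [fD _|b0 u0 c0 w e fD bM Ef Lb0 Eu em cC0 cD Lc0 Eu0 we Ch].
    have fC := fsubsetP (inv_sub inv) _ fD.
    by rewrite (input_lv inp cC fC) // (lvE Lc) (lvE Lf).
  have E : c = c0 by apply: (input_lv inp cC cC0); rewrite (lvE Lc) (lvE Lc0) Eu Eu0.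
  move: we; move: Lc; rewrite E Lc0 => -[->]; rewrite Eu Eu0 /= addn1.
  by rewrite ltnn.
- by rewrite cB; have := inv_card inv; lia.
Qed.

End OneStep.
End DiffAutoreduceStep.

(** * Differentiate&Autoreduce: effect on ideals and final state *)

Lemma ideal_pdiv_in (R : comNzRingType) (I : R -> Prop) (i f q b r : R) : is_ideal I ->
  i * f = q * b + r -> I f -> I b -> I r.
Proof.
move=> iI E If Ib; have [_ _ iM] := iI; have -> : r = i * f - q * b by rewrite E addrC addKr.
by apply: (idealB iI); apply: iM.
Qed.

Lemma ideal_sub0 (R : comNzRingType) (I : R -> Prop) (x y : R) : y = 0 -> I (x - y) -> I x.
Proof. by move=> ->; rewrite subr0. Qed.

Lemma and3_iff (A1 A2 A3 B1 B2 B3 : Prop) : A1 <-> B1 -> A2 <-> B2 -> A3 <-> B3 ->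
  [/\ A1, A2 & A3] <-> [/\ B1, B2 & B3].
Proof. by move=> [? ?] [? ?] [? ?]; split=> -[]; split; auto. Qed.

Section DiffAutoreduceResult.
Context (n : nat) (k : fieldType) (d : k -> k) (le : rel (der n)).
Context (dP : derivation d) (ch : [pchar k] =i pred0) (leP : ranking le).
Local Notation P := (dpoly k n).
Local Notation ld := (@ld n k le).
Local Notation rk := (@rk n k le).
Local Notation init := (@init n k le).
Local Notation sep := (@sep n k le).
Local Notation minrk := (@minrk n k le).
Implicit Types (f g b c : P) (u v w : der n) (B C D S : {fset P}) (I : P -> Prop) (m : 'I_n -> nat).

Definition good1 I f : Prop := [/\ I f, nzd I (init f) & nzd I (sep f)].
Definition good I C : Prop := forall f, f \in C -> good1 I f.

Lemma crt_in I S f r : is_ideal I -> (forall b, b \in S -> I b) -> I f ->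
  clos_refl_trans _ (pdiv_step le S) f r -> I r.
Proof.
move=> iI SI If H; elim: (clos_rt_rt1n _ _ _ _ H) If => {f r H} [f|f g r H _ IH] If //.
apply: IH; have [b [u [e [q [bS _ E _ _]]]]] := pdiv_stepP H.
exact: (ideal_pdiv_in iI E If (SI _ bS)).
Qed.

Context (C : {fset P}) (m : 'I_n -> nat) (inp : da_input le C m).

Section OneStep.
Context (D B : {fset P}) (f g : P) (u : der n).
Context (inv : da_inv le C m D B) (lst : least le (da_work d le m D B) f).
Context (Lf : ld f = Some u) (cs : step_case d le C m D B f u).
Context (rem : algrem le (da_divisors d le D B f) f g).
Context (I : P -> Prop) (iI : diff_ideal d I) (gB : good I B).

Lemma divisors_good s : s \in da_divisors d le D B f -> I s /\ (~~ isconst s -> nzd I (init s)).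
Proof.
move=> sS; case: (divisorsP sS) => [sB|[_ _ [b bM ->]]]; first by have [Is ns _] := gB sB; exact: (conj Is (fun _ => ns)).
have [bB _] := minrkP _ _ _ bM; have [Ib _ sb] := gB bB; split.
  by have [_ _ _ ID] := iI; exact: (ID _ Ib).
have [v Lv] := ld_ex leP (inv_nc leP inv bB).
by have [_ _ -> _] := ld_delta dP ch leP Lv.
Qed.

Lemma step_congr : exists2 h, nzd I h & [/\ I (h * f - g),
  forall e, I (h * coefv u e f - coefv u e g) & I (h * pderiv u f - pderiv u g)].
Proof.
apply: (crt_ideal_top leP (diff_ideal_is_ideal iI) _ _ _ _ (proj1 rem)).
- by move=> s /divisors_good [Is _]; exact: Is.
- by move=> s /divisors_good [_ ns]; exact: ns.
- by move=> s w sS; apply: (step_leader dP ch leP inp inv Lf cs sS).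
- by have [_ H] := (ldP leP f u).1 Lf.
Qed.

Lemma step_good : rk g = rk f -> good1 I f <-> good1 I g.
Proof.
move=> rkg; have [h nh [H1 H2 H3]] := step_congr; have ii := diff_ideal_is_ideal iI.
have Lg : ld g = Some u by rewrite (rk_ld rkg).
rewrite /good1 (initE Lf) (initE Lg) (sepE Lf) (sepE Lg) (rk_degv rkg Lf).
have E1 := ideal_congr_iff ii nh H1; have E2 := nzd_congr_iff ii nh (H2 (degv u f)).
have E3 := nzd_congr_iff ii nh H3.
exact: (and3_iff E1 E2 E3).
Qed.

Lemma step_good_delta : f \notin D -> good1 I f.
Proof.
case: cs => [-> //|b0 u0 c w e _ bM Ef Lb0 Eu em cC cD Lc Eu0 we Ch _].
have [b0B _] := maxrkP _ _ _ bM; have [Ib _ sb] := gB b0B.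
have [_ _ E1 E2] := ld_delta dP ch leP Lb0; rewrite /good1 Ef E1 E2.
by have [_ _ _ ID] := iI; split; [exact: (ID _ Ib)|exact: sb|exact: sb].
Qed.

(** If the rank drops, the coefficient of [g] at the top power of [u] is 0, so [init f] lies in [I]
    up to a regular factor; being regular as well, it makes [I] the unit ideal. *)
Lemma step_fail : rk g <> rk f -> good1 I f -> I 1.
Proof.
move=> rkg [If nf _]; have [h nh [_ H2 _]] := step_congr; have ii := diff_ideal_is_ideal iI.
have [gu dg] : (forall v, v \in vars g -> le v u) /\ (degv u g <= degv u f)%N.
  apply: (crt_top leP _ _ (proj1 rem)).
    by move=> s w sS; apply: (step_leader dP ch leP inp inv Lf cs sS).
  by have [_ H] := (ldP leP f u).1 Lf.
have lt : (degv u g < degv u f)%N.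
  rewrite ltn_neqAle dg andbT; apply/eqP => E; apply: rkg.
  have Lg : ld g = Some u.
    by apply/(ldP leP); split=> //; rewrite -degv_gt0 E (ld_degv leP Lf).
  by rewrite (rkE Lf) (rkE Lg) E.
have := ideal_sub0 (coefv_gt lt) (H2 (degv u f)); rewrite -(initE Lf) => /nh Hi.
exact: (nzd_in 1 ii nf Hi).
Qed.

End OneStep.

(** The second half is needed because RGBound keeps only [minrk B]: inside a differential ideal
    these elements bring along the rest of [B]. *)
Definition da_sem D B : Prop := forall I, diff_ideal d I ->
  (good I C <-> good I D /\ good I B) /\
  ((forall b, b \in minrk B -> I b) -> forall b, b \in B -> I b).

Lemma da_sem0 : da_sem C fset0.
Proof. by move=> I iI; split=> //; split=> [H|[]]. Qed.

Lemma sem_step D B f g u : da_inv le C m D B -> least le (da_work d le m D B) f ->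
  ld f = Some u -> step_case d le C m D B f u ->
  algrem le (da_divisors d le D B f) f g -> rk g = rk f ->
  da_sem D B -> da_sem (D `\ f) (g |` B).
Proof.
move=> inv lst Lf cs rem rkg sem I iI; have [sem1 sem2] := sem I iI; split.
  rewrite sem1; split=> [[gD gB]|[gD gB']].
    have gf : good1 I f.
      case: (boolP (f \in D)) => [/gD //|fD]; exact: (step_good_delta cs iI gB fD).
    split=> [x|x]; first by rewrite in_fsetD1 => /andP[_ /gD].
    rewrite in_fset1U => /orP[/eqP ->|/gB //].
    exact: (proj1 (step_good inv Lf cs rem iI gB rkg) gf).
  have gB : good I B by move=> x xB; apply: gB'; rewrite in_fset1U xB orbT.
  split=> // x xD; have [->|ne] := eqVneq x f; last by apply: gD; rewrite in_fsetD1 ne.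
  apply: (proj2 (step_good inv Lf cs rem iI gB rkg)); apply: gB'.
  by rewrite in_fset1U eqxx.
have inv' := inv_step dP ch leP inp inv lst Lf cs rem rkg.
have Lg : ld g = Some u by rewrite (rk_ld rkg).
(* Old minima stay minimal: an input has a leading variable new to [B], and a derivative has its
   leader above the bottom of its chain. *)
move=> HM; have BI : forall b, b \in B -> I b.
  apply: sem2 => b bM; apply: HM; have [bB bmin] := minrkP _ _ _ bM.
  apply/minrkP; split; first by rewrite in_fset1U bB orbT.
  move=> x; rewrite in_fset1U => /orP[/eqP ->|]; last exact: bmin.
  move=> lg; have [u1 [c1 [w1 [Lb cC1 cD1 Lc1 [E1 _]]]]] := inv_mem inv bB.
  have Euw : u.1 = w1.1 by move: lg; rewrite (lvE Lg) (lvE Lb) -E1 => -[].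
  case: cs => [fD _|b0 u0 c0 w e fD bM0 Ef Lb0 Eu em cC0 cD0 Lc0 Eu0 we Ch].
    have fC := fsubsetP (inv_sub inv) _ fD.
    have E : c1 = f by apply: (input_lv inp cC1 fC); rewrite (lvE Lc1) (lvE Lf) Euw.
    by move: cD1; rewrite E fD.
  have [b0B _] := maxrkP _ _ _ bM0.
  have := bmin _ b0B; rewrite (lvE Lb) (lvE Lb0) => H.
  have /(rk_le_ld leP Lb Lb0) le1 : rk_le le (rk b) (rk b0).
    by apply: H; rewrite E1 -Euw Eu.
  rewrite (rkE Lb) (rkE Lg) /=.
  have lt : dlt le u1 u by rewrite Eu; apply: dle_lt_trans le1 _ => //; apply: dlt_dern.
  by rewrite (negbTE (dlt_neq lt)) (dltW lt).
move=> b; rewrite in_fset1U => /orP[/eqP ->|/BI //].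
(* For an input, [g] is the bottom of a new chain and so a minimum. Otherwise [f] is the derivative
   of an element already known to be in [I], and the divisors are in [I] too. *)
case: (boolP (f \in D)) => fD.
  apply: HM; have fC := fsubsetP (inv_sub inv) _ fD.
  rewrite (chain_min leP inv' fC _ Lf) ?in_fset1U ?in_fsetD1 ?eqxx ?Lg ?(lvE Lg) //.
have If : I f.
  case: cs => [fD'|b0 u0 c0 w e _ bM0 -> Lb0 Eu em cC0 cD0 Lc0 Eu0 we Ch].
    by rewrite fD' in fD.
  by have [_ _ _] := iI; apply; apply: BI; case: (maxrkP _ _ _ bM0).
apply: (crt_in (diff_ideal_is_ideal iI) _ If (proj1 rem)) => s sS.
case: (divisorsP sS) => [/BI //|[_ _ [b1 bM ->]]].
by have [_ _ _] := iI; apply; apply: BI; case: (minrkP _ _ _ bM).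
Qed.

Definition da_final B : Prop := [/\ da_inv le C m fset0 B, da_work d le m fset0 B = fset0
  & da_sem fset0 B].

Definition da_ok s : Prop := match s with
  | DALoop D B => da_inv le C m D B /\ da_sem D B
  | DAReturn B => da_final B \/ B = [fset 1] /\ forall I, diff_ideal d I -> good I C -> I 1
  end.

Lemma work_fset0 D B : da_work d le m D B = fset0 -> D = fset0.
Proof. by move/eqP; rewrite /da_work fsetU_eq0 => /andP[/eqP]. Qed.

Lemma da_step_ok s t : da_ok s -> da_step d le m s t -> da_ok t.
Proof.
move=> + H; case: H => {s t} [D B W [inv sem]|D B f g lst rem rkg [inv sem]|
    D B f g lst rem rkg [inv sem]].
- by have E := work_fset0 W; subst D; left.
- right; split=> // I iI gC; have [sem1 _] := sem I iI; have [gD gB] := sem1.1 gC.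
  have [u Lf cs] := step_caseP dP ch leP inp inv (proj1 lst).
  apply: (step_fail inv Lf cs rem iI gB rkg).
  case: (boolP (f \in D)) => [/gD //|fD]; exact: (step_good_delta cs iI gB fD).
have [u Lf cs] := step_caseP dP ch leP inp inv (proj1 lst); split.
  exact: (inv_step dP ch leP inp inv lst Lf cs rem rkg).
exact: (sem_step inv lst Lf cs rem rkg sem).
Qed.

Lemma da_steps_ok s t : da_ok s -> clos_refl_trans _ (da_step d le m) s t -> da_ok t.
Proof.
move=> + H; elim: H => {s t} // [s t H Hs|s t r _ IH1 _ IH2 Hs]; first exact: da_step_ok H.
exact/IH2/IH1.
Qed.

Lemma da_result B : diff_autoreduce d le C m B ->
  da_final B \/ B = [fset 1] /\ forall I, diff_ideal d I -> good I C -> I 1.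
Proof.
move=> H; apply: (da_steps_ok _ H); split; [exact: da_inv0|exact: da_sem0].
Qed.

Lemma da_final_neq1 B : da_final B -> B <> [fset 1].
Proof.
case=> inv _ _ E; have /(inv_nc leP inv) : (1 : P) \in B by rewrite E in_fset1.
by move/negP; apply; apply/isconstP; exists 1.
Qed.

Definition slots c : seq (der n) :=
  if ld c is Some w then [seq (w.1, j) | j <- iota w.2 (m w.1 - w.2).+1] else [::].

(** Bounds the final size of [B], which gives termination and, after subtracting [#|C|], the total
    number of differentiations. *)
Definition capacity : nat := \sum_(c <- C) size (slots c).

Lemma inv_capacity D B : da_inv le C m D B -> (#|` B| <= capacity)%N.
Proof.
move=> inv; pose Sl := flatten [seq slots c | c <- C].
have -> : capacity = size (map some Sl).
  by rewrite size_map /Sl size_flatten /shape -map_comp sumnE big_map.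
rewrite -(size_map ld); apply: uniq_leq_size.
  rewrite map_inj_in_uniq ?fset_uniq // => b b' bB bB'; exact: (inv_ld_inj inv).
move=> o /mapP [b bB ->]; have [u [c [w [Lb cC cD Lc [E1 _]]]]] := inv_mem inv bB.
rewrite Lb mem_map => [|? ? [//]]; apply/flatten_mapP; exists c => //.
have [e [/andP[we em] Ch]] := inv_chain inv cC cD Lc; rewrite /slots Lc.
have [/(_ _)] := Ch u.2; rewrite -E1 -surjective_pairing => H _.
have /andP[wu ue] := H (ex_intro2 _ _ b bB Lb).
apply/mapP; exists u.2; last by case: (u).
rewrite -E1 in em.
by rewrite mem_iota wu /= addnS ltnS (subnKC (leq_trans we em)) (leq_trans ue em).
Qed.

End DiffAutoreduceResult.

Section DiffAutoreduceFinal.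
Context (n : nat) (k : fieldType) (d : k -> k) (le : rel (der n)).
Context (dP : derivation d) (ch : [pchar k] =i pred0) (leP : ranking le).
Local Notation P := (dpoly k n).
Local Notation ld := (@ld n k le).
Local Notation rk := (@rk n k le).
Local Notation lv := (@lv n k le).
Local Notation minrk := (@minrk n k le).
Local Notation maxrk := (@maxrk n k le).
Implicit Types (f g b c r : P) (u v w : der n) (B C D S : {fset P}) (I : P -> Prop) (m : 'I_n -> nat).

Section Final.
Context (C : {fset P}) (m : 'I_n -> nat) (inp : da_input le C m) (B : {fset P}).
Context (fin : da_final d le C m B).

Let inv : da_inv le C m fset0 B. Proof. by case: fin. Qed.

(** At exit every chain reaches its bound, since otherwise the derivative of its top would still be
    pending. *)
Lemma final_chain c w j : c \in C -> ld c = Some w ->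
  (exists2 b, b \in B & ld b = Some (w.1, j)) <-> (w.2 <= j <= m w.1)%N.
Proof.
move=> cC Lc; have cD : c \notin (fset0 : {fset P}) by rewrite in_fset0.
have [e [/andP[we em] Ch]] := inv_chain inv cC cD Lc.
suff <- : e = m w.1 by apply: Ch.
apply/eqP; rewrite eqn_leq em leqNgt; apply/negP => lt.
have [_ /(_ _)] := Ch e; rewrite leqnn we => /(_ isT) [b bB Lb].
have bM : b \in maxrk B by rewrite (chain_max leP inv cC cD Lc we Ch bB) ?Lb ?(lvE Lb).
have : delta d b \in da_work d le m fset0 B.
  apply/(workP dP ch leP _ _ _ (fun b => inv_nc leP inv)); right; exists b, (w.1, e); split=> //.
by case: fin => _ -> _; rewrite in_fset0.
Qed.

Lemma min_ld b : b \in minrk B -> exists c w, [/\ c \in C, ld c = Some w, ld b = Some w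
  & rk b = rk c].
Proof.
move=> bM; have [bB _] := minrkP _ _ _ bM.
have [u [c [w [Lb cC cD Lc [E _]]]]] := inv_mem inv bB.
have lb : lv b = Some w.1 by rewrite (lvE Lb) E.
have := chain_min leP inv cC cD Lc bB lb; rewrite bM => /esym /eqP Lb'.
by exists c, w; split=> //; apply: (inv_rk inv bB cC); rewrite Lb' Lc.
Qed.

Lemma min_ex c : c \in C -> exists2 b, b \in minrk B & rk b = rk c.
Proof.
move=> cC; have [w Lc] := ld_ex leP (input_nc inp cC).
have [_ H] := final_chain w.2 cC Lc; have [|b bB] := H _.
  by rewrite leqnn (input_ord inp cC) //; case: ((ldP leP c w).1 Lc).
rewrite -surjective_pairing => Lb; exists b; last by apply: (inv_rk inv bB cC); rewrite Lb Lc.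
by rewrite (chain_min leP inv cC _ Lc bB) ?in_fset0 ?Lb ?(lvE Lb).
Qed.

Lemma min_sub b : b \in minrk B -> b \in B.
Proof. by case/minrkP. Qed.

Lemma min_lv_inj b b' : b \in minrk B -> b' \in minrk B -> lv b = lv b' -> b = b'.
Proof.
move=> bM bM'; have [c [w [cC Lc Lb _]]] := min_ld bM.
have [c' [w' [cC' Lc' Lb' _]]] := min_ld bM'.
rewrite (lvE Lb) (lvE Lb') => -[E]; apply: (inv_ld_inj inv (min_sub bM) (min_sub bM')).
have Ec : c = c' by apply: (input_lv inp cC cC'); rewrite (lvE Lc) (lvE Lc') E.
by rewrite Lb Lb' -Lc -Lc' Ec.
Qed.

Lemma min_vars b v c w : b \in minrk B -> v \in vars b -> c \in C -> ld c = Some w ->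
  w.1 = v.1 -> (v.2 <= w.2)%N.
Proof.
move=> bM vb cC Lc E; have bB := min_sub bM.
case: (classic (ld b = Some v)) => [Lb|nl]; last exact: (inv_vars inv bB vb cC Lc E nl).
have [c' [w' [cC' Lc' Lb' _]]] := min_ld bM.
move: Lb'; rewrite Lb => -[E']; subst w'.
have Ec : c = c' by apply: (input_lv inp cC cC'); rewrite (lvE Lc) (lvE Lc') E.
by move: Lc; rewrite Ec Lc' => -[->].
Qed.

(** The only higher derivative of a leading variable that an element of [B] may contain is its own
    leader. It is then linear in that leader, which disappears from the initial and the separant. *)
Lemma Hset_vars h v c w : h \in Hset le B -> v \in vars h -> c \in C -> ld c = Some w ->
  w.1 = v.1 -> (v.2 <= w.2)%N.
Proof.
move=> hH vh cC Lc E.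
have [b bB [vb nb]] : exists2 b, b \in B & v \in vars b /\
    (ld b = Some v -> (1 < degv v b)%N).
  move: hH vh; rewrite /Hset in_fsetU => /orP[] /imfsetP [b /= bB ->] vh; exists b => //.
    split=> [|Lb]; first exact: vars_init vh.
    by move: vh; rewrite (initE Lb) (negbTE (coefv_free _ _ _)).
  split=> [|Lb]; first exact: vars_sep vh.
  move: vh; rewrite (sepE Lb) -degv_gt0 => H; apply: leq_ltn_trans H _.
  by apply: degv_pderiv_lt; rewrite -degv_gt0 (ld_degv leP Lb).
case: (classic (ld b = Some v)) => [Lb|nl]; last exact: (inv_vars inv bB vb cC Lc E nl).
have [u [c' [w' [Lb' cC' _ Lc' [E1 E2]]]]] := inv_mem inv bB.
move: Lb'; rewrite Lb => -[E']; subst u.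
have Ec : c = c' by apply: (input_lv inp cC cC'); rewrite (lvE Lc) (lvE Lc') E E1.
subst c'; move: Lc'; rewrite Lc => -[E3]; subst w'.
by rewrite leqNgt; apply/negP => /E2 E4; have := nb Lb; rewrite E4.
Qed.

(** Above [w] every order up to the bound is the leader of an element of [B] linear in it, so an
    algebraically reduced polynomial contains none of these derivatives. This turns algebraic into
    partial reduction. *)
Lemma red_vars r v c w : alg_reduced_set le B r -> v \in vars r -> c \in C ->
  ld c = Some w -> w.1 = v.1 -> (v.2 <= m v.1)%N -> (v.2 <= w.2)%N.
Proof.
move=> rr vr cC Lc E vm; rewrite leqNgt; apply/negP => wv.
have [_ H] := final_chain v.2 cC Lc; have [|b bB] := H _.
  by rewrite (ltnW wv) E vm.
rewrite E -surjective_pairing => Lb.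
have [u [c' [w' [Lb' cC' _ Lc' [E1 E2]]]]] := inv_mem inv bB.
move: Lb'; rewrite Lb => -[E']; subst u.
have Ec : c = c' by apply: (input_lv inp cC cC'); rewrite (lvE Lc) (lvE Lc') E E1.
subst c'; move: Lc'; rewrite Lc => -[E3]; subst w'.
have := rr b bB; rewrite (alg_reducedE _ Lb) (E2 wv).
by rewrite ltnNge degv_gt0 vr.
Qed.

Lemma min_autoreduced : autoreduced le (minrk B).
Proof.
split=> [f fM|f g fM gM ne]; first exact: (inv_nc leP inv (min_sub fM)).
split; last exact: (inv_red inv (min_sub fM) (min_sub gM) ne).
rewrite /partially_reduced; have [c [w [cC Lc Lg _]]] := min_ld gM; rewrite Lg => j.
apply/negP => vf; have := min_vars fM vf cC Lc erefl.
by rewrite /= addnS ltnNge leq_addr.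
Qed.

Definition gap c : nat := if ld c is Some w then (m w.1 - w.2)%N else 0%N.

(** [capacity] is the sum of the gaps plus [#|C|], so [inv_free] bounds the excess over [m] by the
    sum of the gaps. *)
Lemma final_free b v : b \in B -> v \in vars b -> (forall c, c \in C -> lv c <> Some v.1) ->
  (v.2 <= m v.1 + \sum_(c <- C) gap c)%N.
Proof.
move=> bB vb nv; have H := inv_free inv bB vb nv; rewrite cardfs0 addn0 in H.
have cap := inv_capacity inv.
have E : capacity le C m = (\sum_(c <- C) gap c + #|` C|)%N.
  have -> : #|` C| = (\sum_(c <- C) 1)%N by rewrite sum1_size.
  rewrite /capacity -big_split /=; apply: eq_big_seq => c cC.
  have [w Lc] := ld_ex leP (input_nc inp cC).
  by rewrite /slots /gap Lc size_map size_iota addn1.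
rewrite E in cap; rewrite -(leq_add2r #|` C|); apply: leq_trans H _.
by rewrite -addnA leq_add2l.
Qed.

End Final.

Definition inv_state m (s : da_state n k) : Prop :=
  if s is DALoop D B then exists2 C, da_input le C m & da_inv le C m D B else True.

Lemma inv_state_step m s t : inv_state m s -> da_step d le m s t -> inv_state m t.
Proof.
move=> + H; case: H => {s t} // D B f g lst rem rkg [C inp inv]; exists C => //.
have [u Lf cs] := step_caseP dP ch leP inp inv (proj1 lst).
exact: (inv_step dP ch leP inp inv lst Lf cs rem rkg).
Qed.

Lemma rem_acc S f : Acc (fun c2 c1 : config n k => exec d le c1 c2) (CRem S f).
Proof.
elim: (pdiv_acc leP S f) => {}f _ IH; constructor => c' [H|H]; inversion H; subst.
exact: IH.
Qed.

Lemma da_acc m s : inv_state m s -> Acc (fun c2 c1 : config n k => exec d le c1 c2) (CDA m s).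
Proof.
have ret B : Acc (fun c2 c1 : config n k => exec d le c1 c2) (CDA m (DAReturn B)).
  constructor => c' [H|H]; inversion H; subst.
  by match goal with K : da_step _ _ _ _ _ |- _ => inversion K end.
case: s => [D B|B _]; last exact: ret.
(* Each iteration that stays in the loop enlarges [B], whose size [capacity] bounds. *)
case=> C inp; have [N] := ubnP (capacity le C m - #|` B|); elim: N D B => [|N IH] D B.
  by rewrite ltn0.
rewrite ltnS => lt inv; constructor => c' [H|H]; inversion H; subst; last exact: rem_acc.
match goal with K : da_step _ _ _ _ _ |- _ => inversion K; subst end; [exact: ret|exact: ret|].
match goal with K : least _ _ ?f |- _ => rename K into lst end.
match goal with K : algrem _ _ _ _ |- _ => rename K into rem end.
match goal with K : rk _ = rk _ |- _ => rename K into rkg end.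
have [u Lf cs] := step_caseP dP ch leP inp inv (proj1 lst).
have inv' := inv_step dP ch leP inp inv lst Lf cs rem rkg.
apply: IH => //; have := inv_capacity inv'.
have [-> _] := step_card dP ch leP inp inv Lf cs rkg; lia.
Qed.

Lemma da_progress m s : inv_state m s -> final le (CDA m s) \/ exists t, da_step d le m s t.
Proof.
case: s => [D B inv|B _]; [right|by left].
have [W|W] := eqVneq (da_work d le m D B) fset0; first by exists (DAReturn B); apply: da_exit.
have [f lst] := least_ex leP W; have [g rem] := algrem_ex leP (da_divisors d le D B f) f.
case: (classic (rk g = rk f)) => E.
  by exists (DALoop (D `\ f) (g |` B)); apply: da_keep lst rem E.
by exists (DAReturn [fset 1]); apply: da_fail lst rem E.
Qed.

Lemma inv_state0 C m : da_input le C m -> inv_state m (DALoop C fset0).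
Proof. by move=> inp; exists C => //; apply: da_inv0. Qed.

Lemma da_exists C m : da_input le C m -> exists B, diff_autoreduce d le C m B.
Proof.
move=> /inv_state0 H0.
suff [B HB] : exists B, clos_refl_trans _ (da_step d le m) (DALoop C fset0) (DAReturn B).
  by exists B.
have : Acc (fun c2 c1 : config n k => exec d le c1 c2) (CDA m (DALoop C fset0)) by apply: da_acc.
move: (DALoop C fset0) H0 => s Hs Ha; move Ec : (CDA m s) Ha => z Ha.
elim: Ha s Hs Ec => {}z _ IH s Hs Ec; case: (da_progress Hs) => [|[t Ht]].
  by case: s {Hs Ec} => // B _; exists B; apply: rt_refl.
have [||B HB] := IH (CDA m t) _ t _ erefl.
- by left; rewrite -Ec; apply: adv_da.
- exact: inv_state_step Ht.
by exists B; apply: rt_trans HB; apply: rt_step.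
Qed.

End DiffAutoreduceFinal.

(** * RGBound: orders *)

Section RGInvariant.
Context (n : nat) (k : fieldType) (d : k -> k) (le : rel (der n)).
Context (dP : derivation d) (ch : [pchar k] =i pred0) (leP : ranking le).
Local Notation P := (dpoly k n).
Local Notation ld := (@ld n k le).
Local Notation lv := (@lv n k le).
Implicit Types (f g b c r x : P) (u v w : der n) (A B C D F G H S : {fset P}) (I : P -> Prop) (i : 'I_n).

Lemma mord_le i F e : (forall f v, f \in F -> v \in vars f -> v.1 = i -> (v.2 <= e)%N) ->
  (mord i F <= e)%N.
Proof.
by move=> HF; apply/bigmax_leqP_seq => f fF _; apply: ordv_le => v vf; apply: HF vf.
Qed.

Lemma mord_ge F f v : f \in F -> v \in vars f -> (v.2 <= mord v.1 F)%N.
Proof.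
move=> fF vf; apply: leq_trans (ordv_ge vf) _.
exact: (@leq_bigmax_seq _ _ xpredT (fun f : P => ordv v.1 f) f fF isT).
Qed.

Lemma mord_mono i F G : (forall f v, f \in F -> v \in vars f ->
  exists2 g, g \in G & v \in vars g) -> (mord i F <= mord i G)%N.
Proof.
move=> HF; apply: mord_le => f v fF vf <-; have [g gG vg] := HF f v fF vf.
exact: mord_ge gG vg.
Qed.

Definition vfree C i : bool := ~~ has (fun c => lv c == Some i) (enum_fset C).
Definition lorder c : nat := if ld c is Some w then w.2 else 0%N.
(** [n - #|C|] bounds the number of free variables, each of which pays for every differentiation;
    the floor 1 keeps the leaders counted when no variable is free. *)
Definition coeff C : nat := maxn 1 (n - #|` C|).
(* Differentiate&Autoreduce raises the orders in the free variables by at most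
   the total order of differentiation; [coeff] pays for this when a leader of C
   is replaced by one of lower order.  When C gets one more element, the
   potential grows at most by the factor [n - #|C| - 1] (or 1), whence the
   factorial in [rg_bound]. *)
Definition potential F C H : nat :=
  \sum_(i < n | vfree C i) mord i (F `|` C `|` H) + coeff C * \sum_(c <- C) lorder c.

Lemma vfreeP C i : reflect (forall c, c \in C -> lv c <> Some i) (vfree C i).
Proof.
apply: (iffP hasPn) => HC c cC; first by apply/eqP/HC.
exact/eqP/HC.
Qed.

Definition lv_inj C : Prop := forall c c', c \in C -> c' \in C -> lv c = lv c' -> c = c'.
Definition nonconst C : Prop := forall c, c \in C -> ~~ isconst c.

Lemma vfree_card C : nonconst C -> lv_inj C -> (#|[pred i | vfree C i]| + #|` C| <= n)%N.
Proof.
move=> nc inj; rewrite -[X in (_ <= X)%N](card_ord n) -(cardC [pred i | vfree C i]) leq_add2l.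
rewrite cardE -(size_map lv (enum_fset C)) -[X in (_ <= X)%N](size_map some); apply: uniq_leq_size.
  by rewrite map_inj_in_uniq ?fset_uniq // => c c'; apply: inj.
move=> o /mapP [c cC ->]; have [w Lc] := ld_ex leP (nc _ cC).
rewrite (lvE Lc); apply: map_f; rewrite mem_enum !inE; apply/vfreeP => H.
by apply: (H c cC); rewrite (lvE Lc).
Qed.

Lemma sum_vfree_const C e : nonconst C -> lv_inj C ->
  (\sum_(i < n | vfree C i) e <= coeff C * e)%N.
Proof.
move=> nc inj; rewrite sum_nat_const leq_mul2r; apply/orP; right.
rewrite /coeff leq_max; apply/orP; right.
by apply: leq_trans (leq_sub2r #|` C| (vfree_card nc inj)); rewrite addnK.
Qed.

Lemma Mord_potential C X : nonconst C ->
  (forall c w x v, c \in C -> ld c = Some w -> x \in X -> v \in vars x -> w.1 = v.1 ->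
    (v.2 <= w.2)%N) ->
  (Mord X <= \sum_(i < n | vfree C i) mord i X + \sum_(c <- C) lorder c)%N.
Proof.
move=> nc HX; rewrite /Mord (bigID (vfree C)) /= leq_add2l.
have step i : ~~ vfree C i -> (mord i X <= \sum_(c <- C | lv c == Some i) lorder c)%N.
  rewrite negbK => /hasP [c cC /eqP lc].
  have [w Lc] := ld_ex leP (nc _ cC); apply: (@leq_trans (lorder c)).
    apply: mord_le => x v xX vx E; rewrite /lorder Lc.
    apply: (HX c w x v) => //; move: lc; rewrite (lvE Lc) E => -[] //.
  by rewrite big_mkcond (bigD1_seq c) ?fset_uniq //= lc eqxx leq_addr.
apply: (@leq_trans (\sum_(i < n | ~~ vfree C i) \sum_(c <- C | lv c == Some i) lorder c)).
  exact: leq_sum.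
rewrite (exchange_big_dep xpredT) //=; apply: leq_sum => c _.
rewrite sum_nat_const; case L: (ld c) => [w|]; last by rewrite /lorder L muln0.
rewrite -[X in (_ <= X)%N]mul1n leq_mul2r; apply/orP; right.
apply: leq_trans (_ : (#|pred1 w.1| <= 1)%N); last by rewrite card1.
apply/subset_leq_card/subsetP => i; rewrite !inE => /andP[_].
by rewrite (lvE L) => /eqP [->].
Qed.

(** [rg_vars] says that each leader of [C] has the highest order of its variable in the whole
    triple. In [rg_bound] the factorial is the weight still to be spent: it starts at [(n-1)!] for
    empty [C] and loses the factor [coeff] of the new set when [C] grows. *)
Record rg_inv (M0 : nat) F C H : Prop := RgInv {
  rg_F0 : F != fset0;
  rg_Fnc : nonconst F;
  rg_Cnc : nonconst C;
  rg_Clv : lv_inj C;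
  rg_CH : Hset le C `<=` H;
  rg_red : forall f c, f \in F -> c \in C -> alg_reduced le f c;
  rg_vars : forall c w x v, c \in C -> ld c = Some w -> x \in F `|` C `|` H -> v \in vars x ->
    w.1 = v.1 -> (v.2 <= w.2)%N;
  rg_bound : ((n - #|` C|).-1`! * potential F C H <= (n.-1)`! * M0)%N
}.

Section Step.
Context (M0 : nat) (F C H : {fset P}) (f : P).
Context (inv : rg_inv M0 F C H) (lst : least le F f).
Local Notation G := (rg_G le F C f).
Local Notation Cb := (rg_C le C f).
Local Notation Db := (rg_D le C f).
Local Notation m := (rg_m le F C H f).

Lemma rg_DP c : c \in Db = (c \in C) && (lv c == lv f).
Proof. by rewrite !inE. Qed.

Lemma rg_CP c : (c \in Cb) = (c == f) || (c \in C) && (lv c != lv f).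
Proof.
rewrite /rg_C in_fset1U in_fsetD rg_DP; case: (c == f) => //=.
by case: (c \in C); rewrite ?andbT ?andbF //=.
Qed.

Lemma rg_GP g : (g \in G) = (g != f) && ((g \in F) || (g \in C) && (lv g == lv f)).
Proof. by rewrite /rg_G in_fsetD1 in_fsetU rg_DP. Qed.

Lemma rg_fF : f \in F. Proof. by case: lst. Qed.

(** [f] moves from [F] to [C] and the element it displaces moves back, so the bounds [m] are the
    orders of the original triple. *)
Lemma rg_union : G `|` Cb `|` H = F `|` C `|` H.
Proof.
have key (a p q e : bool) : (a -> p) ->
    (~~ a && (p || q && e)) || (a || q && ~~ e) = p || q.
  by case: a p q e => [] [] [] [] // /(_ isT).
have E x : (x \in G) || (x \in Cb) = (x \in F) || (x \in C).
  by rewrite rg_GP rg_CP; apply: key => /eqP ->; apply: rg_fF.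
apply/fsetP => x; rewrite [LHS]in_fsetU [RHS]in_fsetU; apply: (congr1 (fun e => e || _)).
by rewrite [LHS]in_fsetU [RHS]in_fsetU; apply: E.
Qed.

Lemma rg_mE i : m i = mord i (F `|` C `|` H).
Proof. by rewrite /rg_m rg_union. Qed.

Lemma rg_fnc : ~~ isconst f. Proof. by apply: (rg_Fnc inv); apply: rg_fF. Qed.

Lemma rg_Cb_sub c : c \in Cb -> c \in F `|` C `|` H.
Proof. by rewrite rg_CP !in_fsetU => /orP[/eqP ->|/andP[-> _]]; rewrite ?rg_fF ?orbT. Qed.

Lemma rg_da_input : da_input le Cb m.
Proof.
split.
- by move=> c; rewrite rg_CP => /orP[/eqP ->|/andP[cC _]]; [apply: rg_fnc|apply: (rg_Cnc inv)].
- move=> c c'; rewrite !rg_CP => /orP[/eqP ->|/andP[cC nc]] /orP[/eqP ->|/andP[cC' nc']] //.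
  + by move=> E; rewrite E eqxx in nc'.
  + by move=> E; rewrite E eqxx in nc.
  + exact: (rg_Clv inv).
move=> c v cC vc; rewrite rg_mE; exact: mord_ge (rg_Cb_sub cC) vc.
Qed.

Context (u : der n) (Lf : ld f = Some u).

Lemma rg_Cb_cases :
  (exists c0, [/\ c0 \in C, lv c0 = lv f & Cb = f |` (C `\ c0)]) \/
  ((forall c, c \in C -> lv c <> lv f) /\ Cb = f |` C).
Proof.
case: (classic (exists2 c0, c0 \in C & lv c0 = lv f)) => [[c0 cC E]|N]; [left|right].
  exists c0; split; [exact: cC|exact: E|].
  apply/fsetP => c; apply: etrans (rg_CP c) _; apply: etrans _ (esym (in_fset1U _ _ _)).
  apply: (congr1 (orb _)).
  apply: etrans _ (esym (in_fsetD1 _ _ _)); rewrite andbC; case: (boolP (c \in C)) => [cC'|_]; last by rewrite !andbF.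
  rewrite !andbT; apply: (congr1 negb); apply/eqP/eqP => [E1|->]; last exact: E.
  by apply: (rg_Clv inv cC' cC); rewrite E1 E.
split=> [c cC E|]; first by apply: N; exists c.
apply/fsetP => c; apply: etrans (rg_CP c) _; apply: etrans _ (esym (in_fset1U _ _ _)).
  apply: (congr1 (orb _)).
case: (boolP (c \in C)) => //= cC; apply/eqP => E; apply: N.
by exists c.
Qed.

(** By [rg_vars] the old leaders already have maximal order, so only the chain of [f] costs
    differentiations ([gap_sum]). *)
Lemma gap_old c : c \in C -> gap le m c = 0%N.
Proof.
move=> cC; rewrite /gap; have [w Lc] := ld_ex leP (rg_Cnc inv cC); rewrite Lc.
apply/eqP; rewrite subn_eq0 rg_mE; apply: mord_le => x v xX vx E.
by apply: (rg_vars inv cC Lc xX vx).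
Qed.

Lemma gap_sum : (\sum_(c <- Cb) gap le m c = m u.1 - u.2)%N.
Proof.
rewrite (big_fsetD1 f) ?rg_CP ?eqxx //= {1}/gap Lf big1_fset ?addn0 // => c.
by rewrite in_fsetD1 rg_CP => /andP[/negbTE ->] /andP[cC _] _; apply: gap_old.
Qed.

Lemma lead_le_m : (u.2 <= m u.1)%N.
Proof. by rewrite rg_mE; apply: (mord_ge (f := f)); [rewrite !in_fsetU rg_fF|case: ((ldP leP f u).1 Lf)]. Qed.

Lemma fact_coeff t : (0 < t)%N -> (t.-1`! = (t.-1).-1`! * maxn 1 t.-1)%N.
Proof. by case: t => [|[|t]] // _; rewrite /= (maxn_idPr _) // factS mulnC. Qed.

(** There are at most [m u.1 - u.2] differentiations, each raising the orders of at most [coeff Cb]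
    free variables by one. It remains to see who pays for [coeff Cb * (m u.1 - u.2)]. *)
Lemma potential_step F' A' H' :
  (forall i, vfree Cb i -> (mord i (F' `|` A' `|` H') <= m i + (m u.1 - u.2))%N) ->
  (forall i, vfree A' i = vfree Cb i) -> #|` A'| = #|` Cb| ->
  (\sum_(a <- A') lorder a = \sum_(c <- Cb) lorder c)%N ->
  ((n - #|` A'|).-1`! * potential F' A' H' <= (n.-1)`! * M0)%N.
Proof.
move=> Hm Hf Hc Hs; apply: leq_trans (rg_bound inv).
have inp := rg_da_input; have um := lead_le_m.
have step1 : (potential F' A' H' <= \sum_(i < n | vfree Cb i) m i + coeff Cb * (m u.1 - u.2)
    + coeff Cb * \sum_(c <- Cb) lorder c)%N.
  rewrite /potential /coeff Hc -/(coeff Cb) Hs leq_add2r (eq_bigl _ _ Hf).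
  apply: (@leq_trans (\sum_(i < n | vfree Cb i) (m i + (m u.1 - u.2)))).
    exact: leq_sum.
  rewrite big_split /= leq_add2l.
  exact: (sum_vfree_const _ (input_nc inp) (input_lv inp)).
rewrite Hc; set w := (n - #|` Cb|).-1`!.
apply: (leq_trans (leq_mul (leqnn w) step1)); rewrite {}/w.
have lof : lorder f = u.2 by rewrite /lorder Lf.
have [[c0 [cC E EC]]|[N EC]] := rg_Cb_cases.
  have [w0 Lc0] := ld_ex leP (rg_Cnc inv cC).
  have E0 : w0.1 = u.1 by move: E; rewrite (lvE Lc0) (lvE Lf) => -[].
  have fn : f \notin C `\ c0.
    rewrite in_fsetD1; apply/negP => /andP[ne fC].
    by case/eqP: ne; apply: (rg_Clv inv).
  have cardE : #|` Cb| = #|` C|.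
    by rewrite EC cardfsU1 fn (cardfsD1 c0 C) cC.
  (* When [f] replaces [c0], the old leader had order at least [m u.1]; lowering it to [u.2]
     releases [coeff C * (m u.1 - u.2)], enough to pay. *)
  have muw : (m u.1 <= w0.2)%N.
    rewrite rg_mE; apply: mord_le => x v xX vx Ev.
    by apply: (rg_vars inv cC Lc0 xX vx); rewrite Ev.
  have lo0 : lorder c0 = w0.2 by rewrite /lorder Lc0.
  rewrite cardE leq_mul2l; apply/orP; right; rewrite /potential /coeff cardE -/(coeff C).
  have -> : (\sum_(c <- Cb) lorder c = u.2 + \sum_(c <- C `\ c0) lorder c)%N.
    by rewrite EC (big_fsetU1 _ _ fn) /= lof.
  have -> : (\sum_(c <- C) lorder c = w0.2 + \sum_(c <- C `\ c0) lorder c)%N.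
    by rewrite (big_fsetD1 c0 cC) /= lo0.
  rewrite -addnA -mulnDr.
  apply: leq_add.
    rewrite (eq_bigl (vfree C)) => [|i]; first by apply: leq_sum => i _; rewrite rg_mE.
    apply/vfreeP/vfreeP => HC c.
      move=> cC'; case: (eqVneq (lv c) (lv f)) => [->|ne].
        by apply: HC; rewrite rg_CP eqxx.
      by apply: HC; rewrite rg_CP cC' ne orbT.
    rewrite rg_CP => /orP[/eqP ->|/andP[cC' _]]; last exact: HC.
    by rewrite -E; apply: HC.
  by rewrite leq_mul2l; apply/orP; right; move: muw um; lia.
(* When [C] grows, the variable of [u] was free and counted once with order [m u.1]. Its leader and
   the differentiations now cost [coeff Cb * m u.1] together, and the factor [coeff Cb] is taken
   from the factorial. *)
have fn : f \notin C by apply/negP => fC; apply: (N f fC).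
have cardE : #|` Cb| = #|` C|.+1 by rewrite EC cardfsU1 fn.
have freeu : vfree C u.1 by apply/vfreeP => c cC; rewrite -(lvE Lf); apply: N.
have tpos : (0 < n - #|` C|)%N.
  have := vfree_card (rg_Cnc inv) (rg_Clv inv).
  have : (0 < #|[pred i | vfree C i]|)%N by apply/card_gt0P; exists u.1; rewrite inE.
  by lia.
rewrite (fact_coeff tpos) -mulnA cardE subnS leq_mul2l; apply/orP; right.
have cE : coeff Cb = maxn 1 (n - #|` C|).-1 by rewrite /coeff cardE subnS.
have -> : (\sum_(c <- Cb) lorder c = u.2 + \sum_(c <- C) lorder c)%N.
  by rewrite EC (big_fsetU1 _ _ fn) /= lof.
rewrite -cE.
have c1 : (0 < coeff Cb)%N by rewrite /coeff leq_max.
have c2 : (0 < coeff C)%N by rewrite /coeff leq_max.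
rewrite /potential (bigD1 u.1 freeu) -(rg_mE u.1).
have -> : (\sum_(i < n | vfree Cb i) m i =
    \sum_(i < n | vfree C i && (i != u.1)) mord i (F `|` C `|` H))%N.
  apply: eq_big => [i|i _]; last exact: rg_mE.
  apply/vfreeP/andP => [HC|[/vfreeP HC /eqP ne] c].
    split; first by apply/vfreeP => c cC; apply: HC; rewrite EC in_fset1U cC orbT.
    apply/eqP => E; apply: (HC f); first by rewrite rg_CP eqxx.
    by rewrite (lvE Lf) E.
  rewrite EC in_fset1U => /orP[/eqP ->|]; last exact: HC.
  by rewrite (lvE Lf) => -[E]; apply: ne.
move: (\sum_(i < n | _) _)%N (\sum_(c <- C) lorder c)%N => s t.
move: (coeff Cb) (coeff C) c1 c2 (m u.1) (u.2) um => p q p0 q0 a b ba.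
have -> : (p * (a + s + q * t) = p * a + p * s + p * (q * t))%N by rewrite !mulnDr.
have -> : (s + p * (a - b) + p * (b + t) = p * a + s + p * t)%N.
  by rewrite mulnDr mulnBr; move: (leq_mul2l p b a); rewrite ba orbT; lia.
rewrite -!addnA leq_add2l; apply: leq_add; first by rewrite leq_pmull.
by rewrite leq_mul2l leq_pmull ?orbT.
Qed.

End Step.
End RGInvariant.

(** * RGBound: correctness *)

(** From [x b] in [I] one gets [x^2 b'] in [I]; multiplying by [b'] makes it a square. *)
Lemma ideal_quot_deriv (R : comNzRingType) (I : R -> Prop) (D : R -> R) x b : is_ideal I ->
  (forall a e, I (a ^+ e) -> I a) -> (forall x y, D (x * y) = D x * y + x * D y) ->
  (forall x, I x -> I (D x)) -> I (x * b) -> I (x * D b).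
Proof.
move=> iI rI DM ID H; have [_ _ iM] := iI; apply: (rI _ 2).
have -> : (x * D b) ^+ 2 = D b * (x * x * D b) by ring.
by apply: iM; apply: ideal_deriv_mult DM ID H.
Qed.

Lemma ideal_quot_pow (R : comNzRingType) (I : R -> Prop) x b e : is_ideal I ->
  (forall a e, I (a ^+ e) -> I a) -> I (x * b ^+ e) -> I (x * b).
Proof. by move=> iI rI H; apply: (rI _ e.+1); apply: ideal_pow_mult. Qed.

Lemma ideal_quot_is_ideal (R : comNzRingType) (I : R -> Prop) x : is_ideal I ->
  is_ideal (fun b => I (x * b)).
Proof.
case=> I0 iD iM; split; first by rewrite mulr0.
  by move=> a b Ha Hb; rewrite mulrDr; apply: iD.
by move=> a b Hb; rewrite mulrCA; apply: iM.
Qed.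

Lemma nzd_quot (R : comNzRingType) (I : R -> Prop) x h : nzd I h -> nzd (fun b => I (x * b)) h.
Proof. by move=> nh b; rewrite mulrCA => /nh. Qed.

(** Dividing by [x y] makes the factor [x] regular: a second division by [x] changes nothing in a
    radical ideal. This produces an ideal on which the main branch applies. *)
Lemma nzd_quot_factor (R : comNzRingType) (I : R -> Prop) (x y : R) : is_ideal I ->
  (forall a e, I (a ^+ e) -> I a) -> nzd (fun b => I (x * y * b)) x.
Proof.
case=> _ _ iM rI b H; apply: (rI _ 2).
have -> : (x * y * b) ^+ 2 = y * b * (x * y * (x * b)) by ring.
exact: iM.
Qed.

Lemma nzd_unit (R : comNzRingType) (I : R -> Prop) (x y : R) : is_ideal I -> y * x = 1 -> nzd I x.
Proof. by case=> _ _ iM E b H; rewrite -[b]mul1r -E -mulrA; apply: iM. Qed.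

Lemma radical_sqr (R : comNzRingType) (I : R -> Prop) (x : R) :
  (forall a e, I (a ^+ e) -> I a) -> I (x * x) -> I x.
Proof. by move=> rI H; apply: (rI _ 2); rewrite expr2. Qed.

(* The ideals [I : x] replace the intersection of [I : s^oo] with [I + (s)]:
   [a] lies in [I] as soon as it lies in every [I : x] that contains [x]. *)
Lemma radical_split_sep (R : comNzRingType) (I : R -> Prop) (i s a : R) : is_ideal I ->
  (forall a e, I (a ^+ e) -> I a) -> nzd I i -> I (i * s * a) ->
  (forall x, I (x * s) -> I (x * a)) -> I a.
Proof.
move=> iI rI ni; rewrite -mulrA => /ni Hs H; apply: (radical_sqr rI).
by apply: H; rewrite mulrC.
Qed.

(** Apply the initial branch with [x = a] and, to reach its premise [a * i], the separant branch
    with [x = a * i]. *)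
Lemma radical_split_init (R : comNzRingType) (I : R -> Prop) (i s a : R) : is_ideal I ->
  (forall a e, I (a ^+ e) -> I a) -> I (i * s * a) ->
  (forall x, I (x * s) -> I (x * a)) -> (forall x, I (x * i) -> I (x * a)) -> I a.
Proof.
move=> iI rI Hs H1 H2; apply: (radical_sqr rI); apply: H2.
apply: (radical_sqr rI); have [_ _ iM] := iI.
have -> : a * i * (a * i) = i * (a * i * a) by ring.
apply: iM; apply: H1.
by have -> : a * i * s = i * s * a by ring.
Qed.

Section RGMain.
Context (n : nat) (k : fieldType) (d : k -> k) (le : rel (der n)).
Context (dP : derivation d) (ch : [pchar k] =i pred0) (leP : ranking le).
Local Notation P := (dpoly k n).
Local Notation ld := (@ld n k le).
Local Notation rk := (@rk n k le).
Local Notation init := (@init n k le).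
Local Notation sep := (@sep n k le).
Local Notation lv := (@lv n k le).
Local Notation minrk := (@minrk n k le).
Implicit Types (f g b c r x a h : P) (u v w : der n) (A B C D F G H S : {fset P}) (I : P -> Prop) (i : 'I_n).

Lemma rk_lv f g : rk f = rk g -> lv f = lv g.
Proof. by move=> /rk_ld E; rewrite /lv E. Qed.

Definition system_in I S (T : {fset P}) : Prop :=
  (forall x, x \in S -> I x) /\ (forall h, h \in T -> nzd I h).

Section Main.
Context (M0 : nat) (F C H : {fset P}) (f : P).
Context (inv : rg_inv le M0 F C H) (lst : least le F f) (u : der n) (Lf : ld f = Some u).
Local Notation G := (rg_G le F C f).
Local Notation Cb := (rg_C le C f).
Local Notation m := (rg_m le F C H f).
Let X := F `|` C `|` H.
Context (B : {fset P}) (fin : da_final d le Cb m B).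

Let inp : da_input le Cb m. Proof. exact: rg_da_input inv lst. Qed.
Let binv : da_inv le Cb m fset0 B. Proof. by case: fin. Qed.

Lemma X_m x v : x \in X -> v \in vars x -> (v.2 <= m v.1)%N.
Proof. by move=> xX vx; rewrite (rg_mE C H lst); apply: (mord_ge xX). Qed.

Lemma rem_lead_vars x r v c w : x \in X -> algrem le B x r -> v \in vars r -> c \in Cb ->
  ld c = Some w -> w.1 = v.1 -> (v.2 <= w.2)%N.
Proof.
move=> xX [xr rr] vr cC Lc E.
case: (crt_vars xr vr) => [vx|[b bB vb]].
  exact: (red_vars dP ch leP inp fin rr vr cC Lc E (X_m xX vx)).
case: (classic (ld b = Some v)) => [Lb|nl]; last exact: (inv_vars binv bB vb cC Lc E nl).
apply: (red_vars dP ch leP inp fin rr vr cC Lc E).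
have [Hb _] := final_chain dP ch leP fin v.2 cC Lc; rewrite E -surjective_pairing in Hb.
by have /andP[] := Hb (ex_intro2 _ _ b bB Lb).
Qed.

Lemma B_free_vars b v : b \in B -> v \in vars b -> vfree le Cb v.1 ->
  (v.2 <= m v.1 + (m u.1 - u.2))%N.
Proof.
move=> bB vb /vfreeP nv; rewrite -(gap_sum leP inv lst Lf).
exact: (final_free leP inp fin bB vb nv).
Qed.

Lemma rem_free_vars x r v : x \in X -> algrem le B x r -> v \in vars r -> vfree le Cb v.1 ->
  (v.2 <= m v.1 + (m u.1 - u.2))%N.
Proof.
move=> xX [xr rr] vr nv; case: (crt_vars xr vr) => [vx|[b bB vb]]; last exact: B_free_vars bB vb nv.
by apply: leq_trans (X_m xX vx) _; apply: leq_addr.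
Qed.

Lemma Hset_sub_vars h v : h \in Hset le B -> v \in vars h -> exists2 b, b \in B & v \in vars b.
Proof.
rewrite /Hset in_fsetU => /orP[] /imfsetP [b /= bB ->] vh; exists b => //.
  exact: vars_init vh.
exact: vars_sep vh.
Qed.

Context (F' H' R K : {fset P}) (rhoG : algrem_set le B G R) (rhoH : algrem_set le B H K).
Context (EF : F' = R `\ 0) (EH : H' = K `|` Hset le B).

Lemma G_sub g : g \in G -> g \in X.
Proof.
by rewrite (rg_GP le F C f) !in_fsetU => /andP[_ /orP[->|/andP[-> _]]]; rewrite ?orbT.
Qed.

Lemma H_sub h : h \in H -> h \in X.
Proof. by move=> hH; rewrite /X in_fsetU hH orbT. Qed.

Lemma out_cases x : x \in F' `|` minrk B `|` H' ->
  (exists2 g, g \in X & algrem le B g x) \/ x \in minrk B \/ x \in Hset le B.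
Proof.
rewrite 2!in_fsetU EF EH => /orP[/orP[xF|xB]|].
- left; move: xF; rewrite in_fsetD1 => /andP[_]; case: rhoG => rho Hr -> /imfsetP [g /= gG ->].
  by exists g; [exact: G_sub|exact: Hr].
- by right; left.
rewrite in_fsetU => /orP[|xB]; last by right; right.
case: rhoH => rho Hr -> /imfsetP [g /= gH ->]; left.
by exists g; [exact: H_sub|exact: Hr].
Qed.

Lemma out_lead_vars c w x v : c \in minrk B -> ld c = Some w ->
  x \in F' `|` minrk B `|` H' -> v \in vars x -> w.1 = v.1 -> (v.2 <= w.2)%N.
Proof.
move=> cM Lc xO vx E; have [c' [w' [cC' Lc' Lc2 _]]] := min_ld leP fin cM.
move: Lc2; rewrite Lc => -[E']; subst w'.
case: (out_cases xO) => [[g gX gr]|[xM|xH]].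
- exact: (rem_lead_vars gX gr vx cC' Lc' E).
- exact: (min_vars leP inp fin xM vx cC' Lc' E).
- exact: (Hset_vars leP inp fin xH vx cC' Lc' E).
Qed.

Lemma out_free_vars x v : x \in F' `|` minrk B `|` H' -> v \in vars x -> vfree le Cb v.1 ->
  (v.2 <= m v.1 + (m u.1 - u.2))%N.
Proof.
move=> xO vx nv; case: (out_cases xO) => [[g gX gr]|[xM|xH]].
- exact: (rem_free_vars gX gr vx nv).
- by apply: (B_free_vars _ vx nv); apply: min_sub xM.
- by have [b bB vb] := Hset_sub_vars xH vx; apply: (B_free_vars bB vb nv).
Qed.

Lemma min_nonconst : nonconst (minrk B).
Proof. by move=> b bM; apply: (inv_nc leP binv); apply: min_sub bM. Qed.

Lemma min_lvinj : lv_inj le (minrk B).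
Proof. by move=> b b'; apply: (min_lv_inj leP inp fin). Qed.

(** The new [C] has the same ranks as [Cb], hence the same leading variables, leader orders and
    size; these are the inputs of [potential_step]. *)
Lemma min_rk_perm : perm_eq [seq rk b | b <- minrk B] [seq rk c | c <- Cb].
Proof.
apply: uniq_perm.
- rewrite map_inj_in_uniq ?fset_uniq // => b b' bM bM' /rk_lv; exact: min_lvinj.
- rewrite map_inj_in_uniq ?fset_uniq // => b b' bM bM' /rk_lv; exact: (input_lv inp).
move=> r; apply/mapP/mapP => [[b bM ->]|[c cC ->]].
  by have [c [w [cC _ _ E]]] := min_ld leP fin bM; exists c.
by have [b bM E] := min_ex dP ch leP inp fin cC; exists b.
Qed.

Lemma out_bound : ((n - #|` minrk B|).-1`! * potential le F' (minrk B) H' <= (n.-1)`! * M0)%N.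
Proof.
apply: (potential_step leP inv lst Lf).
- by move=> i Hi; apply: mord_le => x v xO vx Ev; subst i; apply: out_free_vars xO vx Hi.
- move=> i; apply/vfreeP/vfreeP => Hf c cM.
    have [b bM E] := min_ex dP ch leP inp fin cM.
    by rewrite -(rk_lv E); apply: Hf.
  have [c' [w [cC _ _ E]]] := min_ld leP fin cM.
  by rewrite (rk_lv E); apply: Hf.
- by have := perm_size min_rk_perm; rewrite !size_map.
pose lo (r : option (der n * nat)) := if r is Some (w, _) then w.2 else 0%N.
have E c : lorder le c = lo (rk c) by rewrite /lorder /rk; case: (ld c).
rewrite (eq_bigr _ (fun c _ => E c)) [RHS](eq_bigr _ (fun c _ => E c)).
by rewrite -!(big_map rk xpredT lo); apply: perm_big; exact: min_rk_perm.
Qed.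

Lemma Hset_min_sub : Hset le (minrk B) `<=` H'.
Proof.
apply/fsubsetP => h hM; rewrite EH in_fsetU; apply/orP; right; move: hM.
rewrite /Hset !in_fsetU => /orP[] /imfsetP [b /= bM ->]; apply/orP; [left|right];
  by apply/imfsetP; exists b => //; apply: min_sub bM.
Qed.

Lemma out_rg_inv : F' != fset0 -> nonconst F' -> rg_inv le M0 F' (minrk B) H'.
Proof.
move=> F0 Fnc; split=> //.
- exact: min_nonconst.
- exact: min_lvinj.
- exact: Hset_min_sub.
- move=> x c xF cM; move: xF; rewrite EF in_fsetD1 => /andP[_]; case: rhoG => rho Hr ->.
  by move=> /imfsetP [g /= gG ->]; have [_] := Hr g gG; apply; apply: min_sub cM.
- exact: out_lead_vars.
- exact: out_bound.
Qed.

Lemma out_regular : regular_system le (minrk B) H'.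
Proof.
split; [exact: (min_autoreduced leP inp fin)| |exact: Hset_min_sub].
move=> h a hH aM; rewrite /partially_reduced; have [w La] := ld_ex leP (min_nonconst aM).
rewrite La => j; apply/negP => vh.
have := out_lead_vars aM La (x := h) (v := dern j.+1 w) _ vh erefl.
rewrite in_fsetU hH orbT => /(_ isT).
by rewrite /= addnS ltnNge leq_addr.
Qed.

Lemma out_Mord : (Mord (minrk B `|` H') <= (n.-1)`! * M0)%N.
Proof.
apply: leq_trans out_bound; apply: (@leq_trans (potential le F' (minrk B) H')); last first.
  by rewrite leq_pmull // fact_gt0.
apply: (@leq_trans (Mord (F' `|` minrk B `|` H'))).
  apply: leq_sum => i _; apply: mord_mono => x v xO vx; exists x => //.
  by move: xO; rewrite !in_fsetU => /orP[->|->]; rewrite ?orbT.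
apply: leq_trans (Mord_potential leP min_nonconst out_lead_vars) _.
by rewrite /potential leq_add2l leq_pmull // /coeff leq_max.
Qed.

Section Ideal.
Context (I : P -> Prop) (iI : diff_ideal d I).

Lemma good_Cb : system_in I (F `|` C) H -> nzd I (init f) -> nzd I (sep f) -> good le I Cb.
Proof.
move=> [SI TI] ni ns c; rewrite (rg_CP le C f) => /orP[/eqP ->|/andP[cC _]].
  by split; [apply: SI; rewrite in_fsetU (rg_fF lst)|exact: ni|exact: ns].
have HC h : h \in Hset le C -> nzd I h by move=> hC; apply: TI; apply: (fsubsetP (rg_CH inv)).
split; first by apply: SI; rewrite in_fsetU cC orbT.
  by apply: HC; rewrite in_fsetU; apply/orP; left; apply/imfsetP; exists c.
by apply: HC; rewrite in_fsetU; apply/orP; right; apply/imfsetP; exists c.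
Qed.

Lemma good_rem g r : good le I B -> algrem le B g r ->
  (I g <-> I r) /\ (nzd I g <-> nzd I r).
Proof.
move=> gB [gr _]; have ii := diff_ideal_is_ideal iI.
have [h nh Hh] : exists2 h, nzd I h & I (h * g - r).
  apply: (crt_ideal leP ii _ _ gr) => b bB; case: (gB b bB) => Ib nb _; [exact: Ib|move=> _; exact: nb].
exact: (conj (ideal_congr_iff ii nh Hh) (nzd_congr_iff ii nh Hh)).
Qed.

Lemma main_in : system_in I (F `|` C) H -> nzd I (init f) -> nzd I (sep f) ->
  system_in I (F' `|` minrk B) H'.
Proof.
move=> sys ni ns; have gC := good_Cb sys ni ns; have [_ _ sem] := fin.
have [sem1 _] := sem I iI; have [_ gB] := (proj1 sem1) gC; have [SI TI] := sys.
split=> x.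
  rewrite in_fsetU EF in_fsetD1 => /orP[/andP[_]|xM]; last first.
    have [Ix _ _] := gB x (min_sub xM); exact: Ix.
  case: rhoG => rho Hr -> /imfsetP [g /= gG ->].
  apply: (proj1 (proj1 (good_rem gB (Hr g gG)))).
  have := gG; rewrite (rg_GP le F C f) => /andP[_ H1]; apply: SI; rewrite in_fsetU.
  by case/orP: H1 => [->|/andP[-> _]]; rewrite ?orbT.
rewrite EH in_fsetU => /orP[|].
  case: rhoH => rho Hr -> /imfsetP [g /= gH ->].
  exact: (proj1 (proj2 (good_rem gB (Hr g gH))) (TI g gH)).
rewrite in_fsetU => /orP[] /imfsetP [b /= bB ->]; have [_ n1 n2] := gB b bB; [exact: n1|exact: n2].
Qed.

(** The second half of [da_sem] recovers [B] from its minima, and [Hset le B] inside [H'] makes its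
    initials and separants regular. Then [Cb] is good, which also returns the regularity of [init f]
    and [sep f]. *)
Lemma main_out : system_in I (F' `|` minrk B) H' ->
  [/\ system_in I (F `|` C) H, nzd I (init f) & nzd I (sep f)].
Proof.
move=> [SI TI]; have [_ _ sem] := fin; have [sem1 sem2] := sem I iI.
have IB : forall b, b \in B -> I b.
  by apply: sem2 => b bM; apply: SI; rewrite in_fsetU bM orbT.
have HB h : h \in Hset le B -> nzd I h by move=> hB; apply: TI; rewrite EH in_fsetU hB orbT.
have gB : good le I B.
  move=> b bB; split; first exact: IB.
    by apply: HB; rewrite in_fsetU; apply/orP; left; apply/imfsetP; exists b.
  by apply: HB; rewrite in_fsetU; apply/orP; right; apply/imfsetP; exists b.
have gC : good le I Cb by apply: (proj2 sem1); split.
have fC : f \in Cb by rewrite (rg_CP le C f) eqxx.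
have [If ni ns] := gC f fC; split; [|exact: ni|exact: ns].
have IG g : g \in G -> I g.
  move=> gG; move: rhoG EF => [rho Hr ->] EF'.
  apply: (proj2 (proj1 (good_rem gB (Hr g gG)))).
  have [->|ne] := eqVneq (rho g) 0; first by have [] := iI.
  apply: SI; rewrite in_fsetU EF' in_fsetD1 ne; apply/orP; left.
  by apply/imfsetP; exists g.
split=> x.
  rewrite in_fsetU => xFC; have [->|ne] := eqVneq x f; first exact: If.
  case: (boolP (x \in G)) => [/IG //|xG].
  have xC : x \in Cb.
    rewrite (rg_CP le C f) (negbTE ne) /=; move: xG; rewrite (rg_GP le F C f) ne /=.
    by move: xFC; case: (x \in F) => //= ->.
  by case: (gC x xC).
move=> xH; move: rhoH EH => [rho Hr ->] EH'.
apply: (proj2 (proj2 (good_rem gB (Hr x xH)))); apply: TI; rewrite EH' in_fsetU.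
by apply/orP; left; apply/imfsetP; exists x.
Qed.

End Ideal.
End Main.
End RGMain.

(** * RGBound: splitting branches *)

Lemma in_fset_ifs (T : choiceType) (b1 b2 : bool) (x y t : T) :
  (t \in if b1 then fset0 else x |` (if b2 then fset0 else [fset y])) =
  ~~ b1 && ((t == x) || ~~ b2 && (t == y)).
Proof. by case: b1 b2 => [] []; rewrite ?in_fset0 // ?in_fset1U ?in_fset0 ?in_fset1. Qed.

Lemma in_fset_ifs1 (T : choiceType) (b1 b2 : bool) (x y : T) : ~~ b1 ->
  x \in if b1 then fset0 else x |` (if b2 then fset0 else [fset y]).
Proof. by rewrite in_fset_ifs eqxx andbT. Qed.

Lemma in_fset_ifs2 (T : choiceType) (b1 b2 : bool) (x y : T) : ~~ b1 -> ~~ b2 ->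
  y \in if b1 then fset0 else x |` (if b2 then fset0 else [fset y]).
Proof. by rewrite in_fset_ifs eqxx andbT => -> ->; rewrite orbT. Qed.

Section RGSemantics.
Context (n : nat) (k : fieldType) (d : k -> k) (le : rel (der n)).
Context (dP : derivation d) (ch : [pchar k] =i pred0) (leP : ranking le).
Local Notation P := (dpoly k n).
Local Notation ld := (@ld n k le).
Local Notation init := (@init n k le).
Local Notation sep := (@sep n k le).
Implicit Types (f g b c r x a h p : P) (u v w : der n) (A B C D F G H S : {fset P}) (I : P -> Prop) (i : 'I_n).

Lemma const_unit f : isconst f -> f != 0 -> exists y, y * f = 1.
Proof.
case/isconstP => c ->; have [->|c0] := eqVneq c 0; first by rewrite [0%:MP]malgC0E eqxx.
move=> _; exists (c^-1)%:MP; apply: etrans (esym (mpolyCM _ _ _)) _.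
by rewrite mulVf // malgC1E.
Qed.

Lemma const_nzd I f : is_ideal I -> isconst f -> f != 0 -> nzd I f.
Proof. by move=> iI /const_unit H /H [y E]; apply: (nzd_unit iI E). Qed.

Lemma const_ideal I f : is_ideal I -> isconst f -> f != 0 -> I f -> I 1.
Proof.
by move=> iI fc f0 If; apply: (nzd_in _ iI (const_nzd iI fc f0) If).
Qed.

Lemma coefv_pderiv u e f : coefv u e (pderiv u f) = coefv u e.+1 f *+ e.+1.
Proof. by rewrite -!coef_upoly upoly_pderiv coef_deriv. Qed.

Lemma const_muln f e : isconst (f *+ e.+1) -> isconst f.
Proof.
move=> /isconstP [c E]; apply/isconstP; exists (c / e.+1%:R).
apply/malgP => m; have H := congr1 (fun q : P => q@_m) E.
have {}H := etrans (esym (mcoeffMn m e.+1 f)) (etrans H (mcoeffC c m)).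
have e0 : (e.+1%:R : k) != 0 by rewrite (proj1 (pcharf0P _) ch).
apply: etrans _ (esym (mcoeffC _ m)).
apply: (mulIf e0); rewrite mulr_natr H.
by case: (m == _); rewrite ?mulr1n ?mulr0n ?mul0r // divfK.
Qed.

(** The top coefficient of the separant in [u] is the degree of [f] times its initial. This
    justifies branching on the initial only when the separant is not constant. *)
Lemma init_const f u : ld f = Some u -> isconst (sep f) -> isconst (init f).
Proof.
move=> L; rewrite (sepE L) (initE L) -(prednK (ld_degv leP L)) => /eqP Hs.
apply: (@const_muln _ (degv u f).-1).
rewrite -coefv_pderiv; apply/eqP/fsetP => v; rewrite in_fset0; apply/negP => /vars_coefv.
by rewrite Hs in_fset0.
Qed.

Lemma quot_ideal I x : diff_ideal d I -> radical I ->
  diff_ideal d (fun b => I (x * b)) /\ radical (fun b => I (x * b)).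
Proof.
move=> iI rI; have ii := diff_ideal_is_ideal iI; have [q0 qD qM] := ideal_quot_is_ideal x ii.
split; last by move=> a e; apply: (ideal_quot_pow ii rI).
split; [exact: q0|exact: qD|exact: qM|].
by case: iI => _ _ _ ID a; apply: (ideal_quot_deriv ii rI (deltaM dP) ID).
Qed.

Lemma quot_system I x S T : diff_ideal d I -> system_in I S T ->
  system_in (fun b => I (x * b)) S T.
Proof.
case=> _ _ iM _ [SI TI]; split=> [f fS|h hT]; first exact: (iM _ _ (SI f fS)).
exact: (nzd_quot (TI h hT)).
Qed.

Lemma satE S T a : sat d S T a <->
  (forall I, diff_ideal d I -> radical I -> system_in I S T -> I a).
Proof.
split=> H I iI rI; first by case=> SI TI; apply: (H I iI rI SI TI).
by move=> SI TI; apply: (H I iI rI); split.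
Qed.

Lemma system_inU1 I p F C H : I p -> system_in I (F `|` C) H ->
  system_in I ((p |` F) `|` C) H.
Proof.
move=> Ip [SI TI]; split=> [x|]; last exact: TI.
by rewrite -fsetUA in_fset1U => /orP[/eqP ->|/SI].
Qed.

Lemma system_inU1_sub I p F C H : system_in I ((p |` F) `|` C) H -> system_in I (F `|` C) H.
Proof.
move=> [SI TI]; split=> [x xS|]; last exact: TI.
by apply: SI; rewrite -fsetUA in_fset1U xS orbT.
Qed.

Lemma rg_splitE F C H f t : (t \in rg_split le F C H f) = ~~ isconst (sep f) &&
  ((t == (sep f |` F, C, H)) || ~~ isconst (init f) && (t == (init f |` F, C, H))).
Proof. exact: in_fset_ifs. Qed.

Lemma split_sep_in F C H f : ~~ isconst (sep f) -> (sep f |` F, C, H) \in rg_split le F C H f.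
Proof. exact: in_fset_ifs1. Qed.

Lemma split_init_in F C H f : ~~ isconst (sep f) -> ~~ isconst (init f) ->
  (init f |` F, C, H) \in rg_split le F C H f.
Proof. exact: in_fset_ifs2. Qed.

Lemma rg_splitP F C H f (t : {fset P} * {fset P} * {fset P}) :
  t \in rg_split le F C H f -> exists2 p, ~~ isconst p /\ (p = sep f \/ p = init f)
    & t = (p |` F, C, H).
Proof.
rewrite rg_splitE => /andP[sn /orP[/eqP ->|/andP[cn /eqP ->]]].
  by exists (sep f); [split; [exact: sn|left; exact: erefl]|exact: erefl].
by exists (init f); [split; [exact: cn|right; exact: erefl]|exact: erefl].
Qed.

Lemma split_sem F C H f u a : ld f = Some u ->
  sat d (F `|` C) H a <->
  (forall I, diff_ideal d I -> radical I -> system_in I (F `|` C) H ->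
     nzd I (init f) -> nzd I (sep f) -> I a) /\
  (forall F' C' H', (F', C', H') \in rg_split le F C H f -> sat d (F' `|` C') H' a).
Proof.
move=> L; split=> [/satE Hs|[Hmain Hsplit]].
  split=> [I iI rI sI _ _|F' C' H' /rg_splitP [p _ [-> -> ->]]]; first exact: (Hs I iI rI sI).
  by apply/satE => I iI rI /system_inU1_sub; apply: (Hs I iI rI).
apply/satE => I iI rI sI; have ii := diff_ideal_is_ideal iI.
(* If [x * p] is in [I], then [I : x] contains [p] and satisfies the system of that branch. *)
have key p : (p |` F, C, H) \in rg_split le F C H f -> forall x, I (x * p) -> I (x * a).
  move=> /Hsplit /satE Hp x Ix; have [qI qR] := quot_ideal x iI rI.
  exact: (Hp _ qI qR (system_inU1 Ix (quot_system x iI sI))).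
case: (boolP (isconst (sep f))) => [sc|sn].
  apply: (Hmain I iI rI sI); first exact: (const_nzd ii (init_const L sc) (init_neq0 leP L)).
  exact: (const_nzd ii sc (sep_neq0 ch leP L)).
(* The main branch is applied to [I : (init f * sep f)], modulo which both factors are regular. *)
have Hmax : I (init f * sep f * a).
  have [qI qR] := quot_ideal (init f * sep f) iI rI.
  apply: (Hmain _ qI qR (quot_system _ iI sI)); first exact: (nzd_quot_factor ii rI).
  have N := nzd_quot_factor (x := sep f) (y := init f) ii rI.
  by rewrite (mulrC (init f)).
have Hsep := key (sep f) (split_sep_in F C H sn); case: (boolP (isconst (init f))) => [cc|cn].
  apply: (radical_split_sep ii rI (const_nzd ii cc (init_neq0 leP L)) Hmax Hsep).
exact: (radical_split_init ii rI Hmax Hsep (key (init f) (split_init_in F C H sn cn))).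
Qed.

Lemma rg_inv_add M0 F C H f p : rg_inv le M0 F C H -> f \in F -> ~~ isconst p ->
  (forall v, (degv v p <= degv v f)%N) -> rg_inv le M0 (p |` F) C H.
Proof.
move=> [F0 Fnc Cnc Clv CH red vrs bnd] fF pn pd.
have pv v : v \in vars p -> v \in vars f by rewrite -!degv_gt0 => vp; apply: leq_trans vp (pd v).
have key x v : x \in (p |` F) `|` C `|` H -> v \in vars x ->
    exists2 y, y \in F `|` C `|` H & v \in vars y.
  rewrite -!fsetUA in_fset1U => /orP[/eqP ->|xX] vx; last by exists x.
  by exists f; [rewrite in_fsetU fF|apply: pv].
split=> //.
- by apply/fset0Pn; exists p; rewrite in_fset1U eqxx.
- by move=> x; rewrite in_fset1U => /orP[/eqP ->|/Fnc].
- move=> x c; rewrite in_fset1U => /orP[/eqP ->|]; last exact: red.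
  move=> /(red _ _ fF); rewrite /alg_reduced; case: (ld c) => [v|//].
  exact: leq_ltn_trans.
- move=> c w x v cC Lc xX vx; have [y yX vy] := key x v xX vx; exact: (vrs c w y v).
apply: leq_trans bnd; rewrite leq_mul2l; apply/orP; right.
by rewrite /potential leq_add2r; apply: leq_sum => i _; apply: mord_mono.
Qed.

Lemma rg_inv_split M0 F C H f F' C' H' : rg_inv le M0 F C H -> f \in F ->
  (F', C', H') \in rg_split le F C H f -> rg_inv le M0 F' C' H'.
Proof.
move=> inv fF /rg_splitP [p [pn pE] [-> -> ->]].
apply: (rg_inv_add inv fF pn) => v; case: pE => ->; [exact: degv_sep|exact: degv_init].
Qed.

End RGSemantics.

Lemma in_fset_step (T : choiceType) (U V S : {fset T}) x t : t \in (U `\ x) `|` V `|` S ->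
  t \in U \/ t \in V \/ t \in S.
Proof.
by rewrite !in_fsetU in_fsetD1 => /orP[/orP[/andP[_]|]|]; [left|right; left|right; right].
Qed.

Lemma step_iff (T1 T2 : choiceType) (U V S : {fset T1}) (T W : {fset T2}) x (M : Prop)
  (Q : T1 -> Prop) (R : T2 -> Prop) : x \in U -> (Q x <-> M /\ forall s, s \in S -> Q s) ->
  (M <-> (forall t, t \in V -> Q t) /\ (forall t, t \in W -> R t)) ->
  (forall t, t \in U -> Q t) /\ (forall t, t \in T -> R t) <->
  (forall t, t \in (U `\ x) `|` V `|` S -> Q t) /\ (forall t, t \in T `|` W -> R t).
Proof.
move=> xU Qx ME; split=> -[HQ HR].
  have [m Hs] := Qx.1 (HQ x xU); have [HV HW] := ME.1 m.
  split=> t; first by case/in_fset_step => [/HQ|[/HV|/Hs]].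
  by rewrite in_fsetU => /orP[/HR|/HW].
split=> t tU; last by apply: HR; rewrite in_fsetU tU.
have [->|tx] := eqVneq t x; last by apply: HQ; rewrite !in_fsetU in_fsetD1 tx tU.
apply: Qx.2; split=> [|s sS]; last by apply: HQ; rewrite !in_fsetU sS !orbT.
by apply: ME.2; split=> s sV; [apply: HQ|apply: HR]; rewrite !in_fsetU sV !orbT.
Qed.

Section RGCorrect.
Context (n : nat) (k : fieldType) (d : k -> k) (le : rel (der n)).
Context (dP : derivation d) (ch : [pchar k] =i pred0) (leP : ranking le).
Local Notation P := (dpoly k n).
Local Notation ld := (@ld n k le).
Local Notation init := (@init n k le).
Local Notation sep := (@sep n k le).
Local Notation minrk := (@minrk n k le).
Implicit Types (f g b c r x a h p : P) (u v w : der n) (A B C D F G H S : {fset P}) (I : P -> Prop) (i : 'I_n).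


Definition output_ok M0 A H : Prop := [/\ nonconst A, lv_inj le A, regular_system le A H
  & (Mord (A `|` H) <= (n.-1)`! * M0)%N].

Section Step.
Context (M0 : nat) (F C H : {fset P}) (f : P).
Context (inv : rg_inv le M0 F C H) (lst : least le F f) (u : der n) (Lf : ld f = Some u).
Local Notation Cb := (rg_C le C f).
Local Notation m := (rg_m le F C H f).
Context (B : {fset P}) (run : diff_autoreduce d le Cb m B).

Definition main_sat a : Prop := forall I, diff_ideal d I -> radical I ->
  system_in I (F `|` C) H -> nzd I (init f) -> nzd I (sep f) -> I a.

Lemma main_fin : B <> [fset 1] -> da_final d le Cb m B.
Proof.
by case: (da_result dP ch leP (rg_da_input inv lst) run) => [fin|[E _]] // /(_ E).
Qed.

Lemma main_unit a : B = [fset 1] -> main_sat a.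
Proof.
move=> E I iI rI sI ni ns; apply: (ideal1 _ (diff_ideal_is_ideal iI)).
case: (da_result dP ch leP (rg_da_input inv lst) run) => [fin|[_ H1]].
  by case: (da_final_neq1 leP fin E).
exact: (H1 I iI (good_Cb inv lst sI ni ns)).
Qed.

Lemma main_drop F' H' a : B <> [fset 1] -> rg_reduce le B (rg_G le F C f) H F' H' ->
  ~ rg_consistent F' H' -> main_sat a.
Proof.
move=> /main_fin fin [R [K [rG EF rH EH]]] nc I iI rI sI ni ns.
have ii := diff_ideal_is_ideal iI.
have [SI TI] := main_in leP inv lst fin rG rH EF EH iI sI ni ns.
case: (classic (0 \in H')) => [/TI n0|n0]; first exact: (nzd0 _ n0 ii).
case: (classic (exists2 x, x \in F' & isconst x)) => [[x xF xc]|nx]; last first.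
  case: nc; split=> [x xF|]; last exact/negP.
  by apply/negP => xc; apply: nx; exists x.
have x0 : x != 0 by move: xF; rewrite EF in_fsetD1 => /andP[].
apply: (ideal1 _ ii); apply: (const_ideal ii xc x0); apply: SI.
by rewrite in_fsetU xF.
Qed.

Lemma main_keep F' H' a : B <> [fset 1] -> rg_reduce le B (rg_G le F C f) H F' H' ->
  main_sat a <-> sat d (F' `|` minrk B) H' a.
Proof.
move=> /main_fin fin [R [K [rG EF rH EH]]]; split=> [Hm|/satE Hs].
  apply/satE => I iI rI sI.
  have [sI' ni ns] := main_out leP fin rG rH EF EH iI sI; exact: (Hm I iI rI sI' ni ns).
move=> I iI rI sI ni ns; apply: (Hs I iI rI).
exact: (main_in leP inv lst fin rG rH EF EH iI sI ni ns).
Qed.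

Lemma main_push_inv F' H' : B <> [fset 1] -> rg_reduce le B (rg_G le F C f) H F' H' ->
  rg_consistent F' H' -> F' <> fset0 -> rg_inv le M0 F' (minrk B) H'.
Proof.
move=> /main_fin fin [R [K [rG EF rH EH]]] [nc _] /eqP F0.
exact: (out_rg_inv dP ch leP inv lst Lf fin rG rH EF EH F0 nc).
Qed.

Lemma main_output_ok F' H' : B <> [fset 1] -> rg_reduce le B (rg_G le F C f) H F' H' ->
  output_ok M0 (minrk B) H'.
Proof.
move=> /main_fin fin [R [K [rG EF rH EH]]]; split.
- exact: (min_nonconst leP fin).
- exact: (min_lvinj leP inv lst fin).
- exact: (out_regular dP ch leP inv lst fin rG rH EF EH).
- exact: (out_Mord dP ch leP inv lst Lf fin rG rH EF EH).
Qed.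

End Step.

Definition state_inv M0 F0 H0 (s : rg_state n k) : Prop :=
  [/\ forall t, t \in s.1 -> rg_inv le M0 t.1.1 t.1.2 t.2,
      forall t, t \in s.2 -> output_ok M0 t.1 t.2 &
      forall a, sat d F0 H0 a <->
        (forall t, t \in s.1 -> sat d (t.1.1 `|` t.1.2) t.2 a) /\
        (forall t, t \in s.2 -> sat d t.1 t.2 a)].

Lemma main_case M0 F C H f u B dU dT : rg_inv le M0 F C H -> least le F f -> ld f = Some u ->
  diff_autoreduce d le (rg_C le C f) (rg_m le F C H f) B ->
  rg_main le (rg_G le F C f) H B dU dT ->
  [/\ forall t, t \in dU -> rg_inv le M0 t.1.1 t.1.2 t.2,
      forall t, t \in dT -> output_ok M0 t.1 t.2 &
      forall a, main_sat F C H f a <->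
        (forall t, t \in dU -> sat d (t.1.1 `|` t.1.2) t.2 a) /\
        (forall t, t \in dT -> sat d t.1 t.2 a)].
Proof.
move=> inv lst Lf run M; case: M => {dU dT} [E|F' H' ne red nc|F' H' ne red nc F0|F' H' ne red nc F0].
- split=> [t|t|a]; try by rewrite in_fset0.
  by split=> _; [split=> t; rewrite in_fset0|exact: (main_unit inv lst run a E)].
- split=> [t|t|a]; try by rewrite in_fset0.
  by split=> _; [split=> t; rewrite in_fset0|exact: (main_drop inv lst run a ne red nc)].
- have K a := main_keep inv lst run a ne red.
  split=> [t|t|a]; first by rewrite in_fset0.
    rewrite in_fset1 => /eqP ->; exact: (main_output_ok inv lst Lf run ne red).
  apply: (iff_trans (K a)); rewrite F0 fset0U; split=> [Ha|[_ Ha]].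
    by split=> t; [rewrite in_fset0|rewrite in_fset1 => /eqP ->].
  by apply: (Ha (minrk B, H')); rewrite in_fset1 eqxx.
have K a := main_keep inv lst run a ne red.
split=> [t|t|a]; last 1 first.
- apply: (iff_trans (K a)); split=> [Ha|[Ha _]].
    by split=> t; [rewrite in_fset1 => /eqP ->|rewrite in_fset0].
  by apply: (Ha (F', minrk B, H')); rewrite in_fset1 eqxx.
- rewrite in_fset1 => /eqP ->; exact: (main_push_inv inv lst Lf run ne red nc F0).
by rewrite in_fset0.
Qed.

Lemma state_inv_step M0 F0 H0 s s' : state_inv M0 F0 H0 s -> rg_step d le s s' ->
  state_inv M0 F0 H0 s'.
Proof.
move=> + st; case: st => {s s'} U T F C H f B dU dT xU lst run mn [i1 i2 i3].
have inv := i1 _ xU; have [u Lf] := ld_ex leP (rg_Fnc inv (proj1 lst)).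
have [m1 m2 m3] := main_case inv lst Lf run mn.
split=> [t /in_fset_step [tU|[tU|tS]]|t|a].
- exact: i1.
- exact: m1.
- by case: t tS => [[F' C'] H']; apply: (rg_inv_split inv (proj1 lst)).
- by rewrite in_fsetU => /orP[/i2|/m2].
apply: iff_trans (i3 a) _.
apply: (step_iff (Q := fun t : {fset P} * {fset P} * {fset P} => sat d (t.1.1 `|` t.1.2) t.2 a)
  (R := fun t : {fset P} * {fset P} => sat d t.1 t.2 a) T xU _ (m3 a)).
apply: iff_trans (split_sem dP ch leP F C H a Lf) _.
split=> -[Hm Hs]; split; [exact: Hm|by case=> [[F' C'] H']; apply: Hs|exact: Hm|].
by move=> F' C' H'; apply: (Hs (F', C', H')).
Qed.

Lemma state_inv_steps M0 F0 H0 s s' : state_inv M0 F0 H0 s ->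
  clos_refl_trans _ (rg_step d le) s s' -> state_inv M0 F0 H0 s'.
Proof.
move=> + st; elim: st => {s s'} [s s' st inv|s //|s r s' _ IH1 _ IH2 inv].
  exact: (state_inv_step inv st).
exact: IH2 (IH1 inv).
Qed.

End RGCorrect.

(** * RGBound: termination *)

Section WellFounded.
Context (T : Type) (R : T -> T -> Prop) (wf : well_founded R).

Definition option_lt (r s : option T) : Prop :=
  match r, s with Some x, Some y => R x y | Some _, None => True | None, _ => False end.

Lemma option_lt_wf : well_founded option_lt.
Proof.
have H x : Acc option_lt (Some x).
  by elim: (wf x) => {}x _ IH; constructor => -[y|[]]; apply: IH.
case=> [x|]; [exact: H|constructor => -[y _|[]]; exact: H].
Qed.

Definition coord_lt n (g f : 'I_n -> T) : Prop :=
  exists2 i, R (g i) (f i) & forall j, j != i -> g j = f j.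

(** [Rl] confines the change to the coordinates in [L]. Induct on [L], then on the value at its
    head, then on accessibility for the tail, whose steps leave the head unchanged. *)
Lemma coord_lt_wf n : well_founded (@coord_lt n).
Proof.
pose Rl (L : seq 'I_n) (g f : 'I_n -> T) := exists2 i, i \in L & R (g i) (f i) /\
  forall j, j != i -> g j = f j.
suff H L f : Acc (Rl L) f.
  move=> f; elim: (H (enum 'I_n) f) => {}f _ IH; constructor => g [i Ri E].
  by apply: IH; exists i; rewrite ?mem_enum.
elim: L f => [|i L IH] f; first by constructor => g [].
move Ea: (f i) => a; elim: (wf a) f Ea => {}a _ IHa f Ea.
elim: (IH f) Ea => {}f _ IHf Ea; constructor => g [j jL [Rj E]].
case: (eqVneq j i) => [ji|ji]; first by subst j; apply: (IHa (g i)) => //; rewrite -Ea.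
apply: IHf; first by exists j => //; move: jL; rewrite inE (negbTE ji).
by rewrite E // eq_sym.
Qed.

End WellFounded.

Section FsetOrder.
Context (T : choiceType) (R : T -> T -> Prop).
Implicit Types U V N : {fset T}.

(* The Dershowitz-Manna order, for sets. *)
Definition fset_lt V U : Prop := exists x N,
  [/\ x \in U, forall y, y \in N -> R y x & V `<=` (U `\ x) `|` N].

Lemma fset_lt_sub U V : V `<=` U -> Acc fset_lt U -> Acc fset_lt V.
Proof.
move=> VU [HU]; constructor => W [x [N [xV HN WN]]]; apply: HU; exists x, N; split=> //.
  exact: (fsubsetP VU).
by apply: fsubset_trans WN _; rewrite fsetSU // fsetSD.
Qed.

Lemma fset_lt_add x U : Acc R x -> Acc fset_lt U -> Acc fset_lt (x |` U).
Proof.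
move=> ax; elim: ax U => {}x _ IHx U aU; elim: aU => {}U HU IHU; constructor.
move=> V [z [N [zU HN VN]]]; case: (eqVneq z x) => [zx|zx].
  subst z; suff HA (L : seq T) : {subset L <= N} -> Acc fset_lt (foldr (fun y A => y |` A) U L).
    apply: (fset_lt_sub _ (HA N _)) => //; apply/fsubsetP => y /(fsubsetP VN).
    have sub (L : seq T) : (y \in U) || (y \in L) -> y \in foldr (fun y A => y |` A) U L.
      elim: L => [|w L IH] /=; first by rewrite orbF.
      by rewrite in_fset1U inE orbCA => /orP[->//|/IH ->]; rewrite orbT.
    rewrite in_fsetU in_fsetD1 in_fset1U => H; apply: sub.
    by case/orP: H => [/andP[/negbTE -> /= ->]|->]; rewrite ?orbT.
  elim: L => [|y L IH] /= LN; first by constructor.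
  apply: IHx; first by apply: HN; apply: LN; apply: mem_head.
  by apply: IH => w wL; apply: LN; rewrite inE wL orbT.
have {}zU : z \in U by move: zU; rewrite in_fset1U (negbTE zx).
apply: fset_lt_sub (IHU ((U `\ z) `|` N) _); last by exists z, N; split.
apply/fsubsetP => y /(fsubsetP VN); rewrite !(in_fsetU, in_fsetD1, in_fset1).
by case: (y == x) => //=.
Qed.

Lemma fset_lt_acc U : (forall x, x \in U -> Acc R x) -> Acc fset_lt U.
Proof.
have [N] := ubnP #|` U|; elim: N U => [|N IH] U; first by rewrite ltn0.
rewrite ltnS => UN HU; case: (fset_0Vmem U) => [->|[x xU]].
  by constructor => V [x [N' [xV]]]; move: xV; rewrite in_fset0.
rewrite -(fsetD1K xU); apply: fset_lt_add; first exact: HU.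
apply: IH => [|y]; last by rewrite in_fsetD1 => /andP[_ /HU].
by move: UN; rewrite (cardfsD1 x) xU.
Qed.

End FsetOrder.

Section RGTermination.
Context (n : nat) (k : fieldType) (d : k -> k) (le : rel (der n)).
Context (dP : derivation d) (ch : [pchar k] =i pred0) (leP : ranking le).
Local Notation P := (dpoly k n).
Local Notation rk := (@rk n k le).
Local Notation lv := (@lv n k le).
Implicit Types (f g b c r x a h p : P) (u v w : der n) (A B C D F G H S : {fset P}) (I : P -> Prop) (i : 'I_n).



Definition rank_lt (r s : der n * nat) : Prop := dlt le r.1 s.1 \/ r.1 = s.1 /\ (r.2 < s.2)%N.

Lemma rank_lt_wf : well_founded rank_lt.
Proof.
case=> u e; elim: (dlt_wf leP u) e => {}u _ IHu e; elim/ltn_ind: e => e IHe.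
constructor => -[v e'] [/= H|[/= -> H]]; [exact: IHu|exact: IHe].
Qed.

(* [None], for a variable that leads no element of C, is above all ranks. *)
Definition rvec C i : option (der n * nat) :=
  obind (fun c : C => rk (val c)) [pick c : C | lv (val c) == Some i].

Lemma rvec_in C c i : lv_inj le C -> c \in C -> lv c = Some i -> rvec C i = rk c.
Proof.
move=> inj cC E; rewrite /rvec; case: pickP => [x /eqP Ex|/(_ [` cC]) /=].
  by rewrite /= (inj _ _ (valP x) cC) // Ex.
by rewrite E eqxx.
Qed.

Lemma rvec_notin C i : (forall c, c \in C -> lv c <> Some i) -> rvec C i = None.
Proof. by move=> H; rewrite /rvec; case: pickP => // x /eqP; case/(H _ (valP x)). Qed.

Definition lrk F : option (der n * nat) :=
  obind (fun f : F => rk (val f)) [pick f : F | [forall g : F, rk_le le (rk (val f)) (rk (val g))]].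

Lemma rk_le_anti : antisymmetric (rk_le le).
Proof.
case=> [[u e]|] [[v e']|] //=; rewrite (eq_sym v u); case: eqVneq => [->|ne].
  by move=> H; rewrite (@anti_leq e e').
by move=> H; case/eqP: ne; apply: (dle_anti leP).
Qed.

Lemma lrkE F f : least le F f -> lrk F = rk f.
Proof.
move=> [fF fm]; rewrite /lrk; case: pickP => [x /forallP Hx|/(_ [` fF]) /forallP []] /=.
  by apply: rk_le_anti; rewrite (fm _ (valP x)) andbT; apply: (Hx [` fF]).
by move=> g; apply: fm; apply: valP.
Qed.

Definition triple_lt (t' t : {fset P} * {fset P} * {fset P}) : Prop :=
  coord_lt (option_lt rank_lt) (rvec t'.1.2) (rvec t.1.2) \/
  t'.1.2 = t.1.2 /\ option_lt rank_lt (lrk t'.1.1) (lrk t.1.1).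

Lemma triple_lt_wf : well_founded triple_lt.
Proof.
have wo := option_lt_wf rank_lt_wf.
move=> t; move Ec : (rvec t.1.2) => c; elim: (coord_lt_wf wo c) t Ec => {}c _ IHc t Ec.
move Er : (lrk t.1.1) => r; elim: (wo r) t Ec Er => {}r _ IHr t Ec Er.
constructor => t' [H|[E H]].
  by apply: (IHc (rvec t'.1.2)) => //; rewrite -Ec.
by apply: (IHr (lrk t'.1.1)) => //; rewrite ?E // -Er.
Qed.

End RGTermination.

Section RGFinal.
Context (n : nat) (k : fieldType) (d : k -> k) (le : rel (der n)).
Context (dP : derivation d) (ch : [pchar k] =i pred0) (leP : ranking le).
Local Notation P := (dpoly k n).
Local Notation ld := (@ld n k le).
Local Notation rk := (@rk n k le).
Local Notation init := (@init n k le).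
Local Notation sep := (@sep n k le).
Local Notation lv := (@lv n k le).
Local Notation minrk := (@minrk n k le).
Implicit Types (f g b c r x a h p : P) (u v w : der n) (A B C D F G H S : {fset P}) (I : P -> Prop) (i : 'I_n).



(** Only the coordinate of [lv f] changes. If an element [c] of [C] led it, the leader of [f] has
    order at most that of [c], and for equal leaders [f] has lower degree, being reduced with
    respect to [c]; if none did, the coordinate leaves the top value [None]. *)
Lemma main_lt M0 F C H f u B : rg_inv le M0 F C H -> least le F f -> ld f = Some u ->
  da_final d le (rg_C le C f) (rg_m le F C H f) B ->
  coord_lt (option_lt (rank_lt le)) (rvec le (minrk B)) (rvec le C).
Proof.
move=> inv lst Lf fin; have inp := rg_da_input inv lst; have lf := lvE Lf.
have Minj := min_lvinj leP inv lst fin.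
exists u.1 => [|i iu].
  have fC : f \in rg_C le C f by rewrite (rg_CP le C f) eqxx.
  have [b bM Eb] := min_ex dP ch leP inp fin fC.
  rewrite (rvec_in Minj bM (etrans (rk_lv Eb) lf)) Eb (rkE Lf).
  case: (classic (exists2 c, c \in C & lv c = Some u.1)) => [[c cC lc]|N]; last first.
    by rewrite (@rvec_notin _ _ _ C) // => c cC lc; apply: N; exists c.
  rewrite (rvec_in (rg_Clv inv) cC lc); have [w Lc] := ld_ex leP (rg_Cnc inv cC).
  have E : w.1 = u.1 by move: lc; rewrite (lvE Lc) => -[].
  have fX : f \in F `|` C `|` H by rewrite !in_fsetU (rg_fF lst).
  have uf : u \in vars f by case: ((ldP leP f u).1 Lf).
  have uw := rg_vars inv cC Lc fX uf E.
  have := rg_red inv (rg_fF lst) cC; rewrite (alg_reducedE _ Lc) (rkE Lc) /= /rank_lt /=.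
  move: uw; rewrite leq_eqVlt => /orP[/eqP E2|lt] rf; last by left; rewrite (dlt_same leP).
  have Euw : u = w by move: E E2; case: (u) (w) => [? ?] [? ?] /= -> ->.
  by right; move: rf; rewrite -Euw.
case: (classic (exists2 c, c \in C & lv c = Some i)) => [[c cC lc]|N].
  have cCb : c \in rg_C le C f.
    rewrite (rg_CP le C f) cC lc lf /=; apply/orP; right.
    by apply: contraNneq iu => -[->].
  have [b bM Eb] := min_ex dP ch leP inp fin cCb.
  by rewrite (rvec_in Minj bM (etrans (rk_lv Eb) lc)) (rvec_in (rg_Clv inv) cC lc).
rewrite !rvec_notin // => c cC lc; first by apply: N; exists c.
have [c' [w [cCb _ _ E]]] := min_ld leP fin cC.
move: cCb; rewrite (rg_CP le C f) => /orP[/eqP E2|/andP[cC' _]].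
  by move: lc; rewrite (rk_lv E) E2 lf => -[ui]; case/eqP: iu.
by apply: N; exists c' => //; rewrite -(rk_lv E).
Qed.

Lemma split_rank_lt f p u : ld f = Some u -> ~~ isconst p -> p = sep f \/ p = init f ->
  exists v, ld p = Some v /\ rank_lt le (v, degv v p) (u, degv u f).
Proof.
move=> Lf pn pE; have [v Lp] := ld_ex leP pn; exists v; split; first exact: Lp.
have [uf fu] := (ldP leP f u).1 Lf; have [vp _] := (ldP leP p v).1 Lp.
have sub w : w \in vars p -> w \in vars f.
  by case: pE => ->; [exact: vars_sep|exact: vars_init].
have lt : (degv u p < degv u f)%N.
  case: pE => ->; first by rewrite (sepE Lf); apply: degv_pderiv_lt.
  rewrite (initE Lf); apply: leq_ltn_trans (ld_degv leP Lf).
  by rewrite leqNgt degv_gt0 coefv_free.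
have := fu v (sub v vp); rewrite (dle_eqVlt leP) => /orP[/eqP E|]; last by left.
by right; rewrite E.
Qed.

Lemma split_lt F C H f u p : least le F f -> ld f = Some u -> ~~ isconst p ->
  p = sep f \/ p = init f -> triple_lt le (p |` F, C, H) (F, C, H).
Proof.
move=> lst Lf pn pE; have [v [Lp lt]] := split_rank_lt Lf pn pE.
have lep : rk_le le (rk p) (rk f).
  rewrite (rkE Lp) (rkE Lf) /=; case: lt => /= [lt|[-> lt]]; last by rewrite eqxx ltnW.
  by rewrite (negbTE (dlt_neq lt)) (dltW lt).
have lstp : least le (p |` F) p.
  split; first by rewrite in_fset1U eqxx.
  move=> g; rewrite in_fset1U => /orP[/eqP ->|gF]; first exact: rk_le_refl.
  by apply: (rk_le_trans leP) lep _; case: lst => _; apply.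
right; split; first exact: erefl.
by rewrite /= (lrkE leP lstp) (lrkE leP lst) (rkE Lp) (rkE Lf).
Qed.

Definition all_inv M0 (U : {fset {fset P} * {fset P} * {fset P}}) : Prop :=
  forall t, t \in U -> rg_inv le M0 t.1.1 t.1.2 t.2.

Lemma rg_step_lt M0 s s' : all_inv M0 s.1 -> rg_step d le s s' ->
  all_inv M0 s'.1 /\ fset_lt (triple_lt le) s'.1 s.1.
Proof.
move=> + st; case: st => {s s'} U T F C H f B dU dT xU lst run mn iU.
have inv := iU _ xU; have [u Lf] := ld_ex leP (rg_Fnc inv (proj1 lst)).
have [m1 _ _] := main_case dP ch leP inv lst Lf run mn.
split.
  move=> t /in_fset_step [tU|[tU|tS]]; [exact: iU|exact: m1|].
  by case: t tS => [[F' C'] H']; apply: (rg_inv_split inv (proj1 lst)).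
exists (F, C, H), (dU `|` rg_split le F C H f); split; first exact: xU.
  move=> y; rewrite in_fsetU => /orP[yU|/rg_splitP [p [pn pE] ->]]; last first.
    exact: (split_lt C H lst Lf pn pE).
  case: mn yU => [_|F' H' _ _ _|F' H' _ _ _ _|F' H' ne _ _ _]; try by rewrite in_fset0.
  rewrite in_fset1 => /eqP ->; left.
  exact: (main_lt inv lst Lf (main_fin dP ch leP inv lst run ne)).
by rewrite /= fsetUA.
Qed.

Definition cfg_ok M0 (c : config n k) : Prop :=
  match c with CRem _ _ => True | CDA m s => inv_state le m s | CRG s => all_inv M0 s.1 end.

Lemma rg_acc M0 s : all_inv M0 s.1 -> Acc (fun c2 c1 : config n k => exec d le c1 c2) (CRG s).
Proof.
move Es : (s.1) => U; have : Acc (fset_lt (triple_lt le)) U.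
  by apply: fset_lt_acc => t _; apply: (triple_lt_wf leP).
move=> aU; elim: aU s Es => {}U _ IH s Es iU; constructor => c [H|H]; inversion H; subst.
- match goal with K : rg_step _ _ _ _ |- _ => rename K into st end.
  have [i2 lt] := rg_step_lt iU st; exact: (IH _ lt _ erefl i2).
- apply: (da_acc dP ch leP); apply: inv_state0.
  match goal with K : least _ _ _ |- _ => rename K into lst end.
  match goal with K : is_true (_ \in _) |- _ => exact: (rg_da_input (iU _ K) lst) end.
- exact: rem_acc.
Qed.

(** [algrem_set] asks for one function on all of [G], so the remainders are chosen
    simultaneously. *)
Lemma algrem_set_ex S G : exists R, algrem_set le S G R.
Proof.
pose rho g := proj1_sig (constructive_indefinite_description _ (algrem_ex leP S g)).
exists [fset rho g | g in G], rho; last exact: erefl.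
by move=> g _; rewrite /rho; case: constructive_indefinite_description.
Qed.

Lemma rg_progress M0 s : all_inv M0 s.1 -> s.1 = fset0 \/ exists s', rg_step d le s s'.
Proof.
case: s => U T /= iU; case: (fset_0Vmem U) => [|[[[F C] H] xU]]; [by left|right].
have inv := iU _ xU; have [f lst] := least_ex leP (rg_F0 inv).
have [B run] := da_exists dP ch leP (rg_da_input inv lst).
suff [dU [dT mn]] : exists dU dT, rg_main le (rg_G le F C f) H B dU dT.
  by exists ((U `\ (F, C, H)) `|` dU `|` rg_split le F C H f, T `|` dT); apply: rg_loop lst run mn.
case: (classic (B = [fset 1])) => [E|ne].
  by exists fset0, fset0; apply: rg_unit.
have [R rG] := algrem_set_ex B (rg_G le F C f); have [K rH] := algrem_set_ex B H.
have red : rg_reduce le B (rg_G le F C f) H (R `\ 0) (K `|` Hset le B).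
  by exists R, K; split; [exact: rG|exact: erefl|exact: rH|exact: erefl].
case: (classic (rg_consistent (R `\ 0) (K `|` Hset le B))) => [con|nc]; last first.
  by exists fset0, fset0; apply: rg_drop ne red nc.
case: (classic (R `\ 0 = fset0)) => E.
  by exists fset0, [fset (minrk B, K `|` Hset le B)]; apply: rg_output ne red con E.
by exists [fset (R `\ 0, minrk B, K `|` Hset le B)], fset0; apply: rg_push ne red con E.
Qed.

Lemma cfg_ok_exec M0 (c c' : config n k) : cfg_ok M0 c -> exec d le c c' -> cfg_ok M0 c'.
Proof.
move=> ok [H|H]; inversion H; subst; try exact: I.
- match goal with K : da_step _ _ _ _ _ |- _ => exact: (inv_state_step dP ch leP ok K) end.
- match goal with K : rg_step _ _ _ _ |- _ => exact: (proj1 (rg_step_lt ok K)) end.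
apply: inv_state0; match goal with K : least _ _ _ |- _ => rename K into lst end.
match goal with K : is_true (_ \in _) |- _ => exact: (rg_da_input (ok _ K) lst) end.
Qed.

Lemma cfg_progress M0 (c : config n k) : cfg_ok M0 c -> final le c \/ exists c' : config n k, advance d le c c'.
Proof.
case: c => [S f _|m s|s] /=.
- case: (classic (alg_reduced_set le S f)) => [|N]; [by left|right].
  have [b Hb] := not_all_ex_not _ _ N; have [bS /negP nr] := imply_to_and _ _ Hb.
  by have [r st] := pdiv_step_ex leP bS nr; exists (CRem S r); apply: adv_rem.
- by move=> /(da_progress d leP) [|[t st]]; [left|right; exists (CDA m t); apply: adv_da].
by move=> /rg_progress [|[t st]]; [left|right; exists (CRG t); apply: adv_rg].
Qed.

Lemma rg_terminates M0 s : all_inv M0 s.1 -> terminates d le (CRG s).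
Proof.
move=> iU; split; first exact: (rg_acc iU).
have ok : cfg_ok M0 (CRG s) := iU; move=> z st; suff : cfg_ok M0 z by apply: cfg_progress.
elim: st ok => {z} [c1 c2 H ok|c1 //|c1 c2 c3 _ IH1 _ IH2 ok]; first exact: (cfg_ok_exec ok H).
exact: IH2 (IH1 ok).
Qed.

End RGFinal.

(** * Initial state and conclusion *)

Section RGInit.
Context (n : nat) (k : fieldType) (d : k -> k) (le : rel (der n)).
Context (dP : derivation d) (ch : [pchar k] =i pred0) (leP : ranking le).
Local Notation P := (dpoly k n).
Implicit Types (f g b c r x a h p : P) (u v w : der n) (A B C D F G H S : {fset P}) (I : P -> Prop) (i : 'I_n).



Lemma sat_nonzero F H a : sat d F H a <-> sat d (F `\ 0) H a.
Proof.
split=> Hs I iI rI HF HH; apply: (Hs I iI rI) HH => f fF; last first.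
  by apply: HF; move: fF; rewrite in_fsetD1 => /andP[].
have [->|f0] := eqVneq f 0; first by case: iI.
by apply: HF; rewrite in_fsetD1 f0.
Qed.

Lemma init_inv F0 H0 : state_inv d le (Mord (F0 `|` H0)) F0 H0 (rg_init F0 H0).
Proof.
have satF := sat_nonzero F0 H0.
have sub x : x \in F0 `\ 0 -> x \in F0 by rewrite in_fsetD1 => /andP[].
rewrite /rg_init; case: ifP => [/existsP [[f fF] /= fc]|nc].
  split=> [t|t|a]; rewrite ?in_fset0 //; split=> [_|_]; first by split=> t; rewrite in_fset0.
  apply/satF => I iI rI HF _; have ii := diff_ideal_is_ideal iI.
  have f0 : f != 0 by move: fF; rewrite in_fsetD1 => /andP[].
  exact: (ideal1 a ii (const_ideal ii fc f0 (HF f fF))).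
have Fnc : nonconst (F0 `\ 0).
  by move=> f fF; apply/negP => fc; case/existsP: nc; exists [` fF].
have e0 : Hset le (fset0 : {fset P}) `<=` H0.
  by apply/fsubsetP => h; rewrite in_fsetU => /orP[] /imfsetP [x /=]; rewrite in_fset0.
have nc0 : nonconst (fset0 : {fset P}) by move=> c; rewrite in_fset0.
have inj0 : lv_inj le (fset0 : {fset P}) by move=> c c'; rewrite in_fset0.
case: eqP => [E|/eqP FN].
  split=> [t|t|a]; first by rewrite in_fset0.
    rewrite in_fset1 => /eqP ->; split; [exact: nc0|exact: inj0| |].
      split; [|by move=> h b _; rewrite in_fset0|exact: e0].
      by split=> [f|f g]; rewrite in_fset0.
    apply: (@leq_trans (Mord (F0 `|` H0))); last by rewrite leq_pmull // fact_gt0.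
    apply: leq_sum => i _; apply: mord_mono => x v xX vx; exists x => //.
    by move: xX; rewrite /= fset0U in_fsetU => ->; rewrite orbT.
  apply: (iff_trans (satF a)); rewrite E; split=> [Ha|[_ Ha]].
    by split=> t; [rewrite in_fset0|rewrite in_fset1 => /eqP ->].
  by apply: (Ha (fset0, H0)); rewrite in_fset1 eqxx.
split=> [t|t|a]; last 1 first.
- apply: (iff_trans (satF a)); split=> [Ha|[Ha _]].
    by split=> t; [rewrite in_fset1 => /eqP ->; rewrite /= fsetU0|rewrite in_fset0].
  by have := Ha (F0 `\ 0, fset0, H0); rewrite in_fset1 eqxx /= fsetU0; apply.
- rewrite in_fset1 => /eqP -> /=; split=> //.
  rewrite cardfs0 subn0 leq_mul2l; apply/orP; right.
  have s0 : (\sum_(c <- (fset0 : {fset P})) lorder le c = 0)%N.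
    by apply: big1_fset => c; rewrite in_fset0.
  rewrite /potential s0 muln0 addn0 /Mord fsetU0.
  apply: leq_sum => i _.
  apply: mord_mono => x v xX vx; exists x; last exact: vx.
  by move: xX; rewrite !in_fsetU => /orP[/sub ->|->]; rewrite ?orbT.
by rewrite in_fset0.
Qed.

End RGInit.

Theorem proposition13 (n : nat) (k : fieldType) (d : k -> k) (le : rel (der n))
    (F0 H0 : {fset dpoly k n}) :
  (0 < n)%N -> [pchar k] =i pred0 -> derivation d -> ranking le ->
  F0 != fset0 ->
  terminates d le (CRG (rg_init F0 H0)) /\
  forall T : {fset {fset dpoly k n} * {fset dpoly k n}},
    RGBound d le F0 H0 T ->
    [/\ forall A H, (A, H) \in T -> regular_system le A H,
        forall a : dpoly k n,
          colon (rad_diff_ideal_gen d F0) H0 a <->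
          (forall A H, (A, H) \in T -> colon (diff_ideal_gen d A) H a)
      & forall A H, (A, H) \in T ->
          (Mord (A `|` H) <= (n.-1)`! * Mord (F0 `|` H0))%N].
Proof.
move=> _ ch dP leP _; have inv := init_inv d le F0 H0; split.
  by have [iU _ _] := inv; exact: (rg_terminates dP ch leP iU).
move=> T run; have [_ ok semT] := state_inv_steps dP ch leP inv run.
split=> [A H AT|a|A H AT]; last 1 first.
- by have [_ _ _] := ok _ AT.
- by have [_ _] := ok _ AT.
apply: (iff_trans (sat_colon dP F0 H0 a)); apply: (iff_trans (semT a)).
have reg A H : (A, H) \in T -> sat d A H a <-> colon (diff_ideal_gen d A) H a.
  by move=> /ok [nc inj [_ _ AH] _]; apply: (sat_regular dP ch leP).
split=> [[_ Ha] A H AT|Ha]; first exact: (proj1 (reg _ _ AT) (Ha (A, H) AT)).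
split=> [t|[A H] AT]; first by rewrite in_fset0.
exact: (proj2 (reg _ _ AT) (Ha A H AT)).
Qed.
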